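(* There exist a contact manifold $(Y,\xi)$ with $c_1(Y,\xi)=0$ that is asymptotically dynamically convex (ADC), and two Liouville fillings $W_1, W_2$ of $(Y,\xi)$ whose integral cohomologies are not isomorphic, i.e. $H^k(W_1;\mathbb{Z})\not\cong H^k(W_2;\mathbb{Z})$ for some $k$.
   Context: Let $(Y,\xi)$ be a closed contact manifold of dimension $2n-1$ with $c_1(Y,\xi)=0$. For a contact form $\alpha$ for $\xi$ and a closed Reeb orbit $\gamma$ of $\alpha$, the action is $A(\gamma)=\int_{S^1}\gamma^*\alpha$. For a contractible (nondegenerate) Reeb orbit $\gamma$ the degree is $|\gamma|=\mu_{CZ}(\gamma)+n-3$, where $\mu_{CZ}(\gamma)$ is the Conley-Zehnder index of $\gamma$; it is computed with respect to a trivialization of $\xi$ along $\gamma$ that extends over a capping disk, and it is well defined because $c_1(Y,\xi)=0$. For $D>0$ let $\mathcal{P}^{<D}(Y,\alpha)$ be the set of contractible Reeb orbits $\gamma$ of $(Y,\alpha)$ with $A(\gamma)<D$. For two contact forms $\alpha_1,\alpha_2$ for $\xi$, write $\alpha_1\geq\alpha_2$ if $\alpha_1=f\alpha_2$ with $f\geq 1$ a smooth function on $Y$. $(Y,\xi)$ is called ADC (asymptotically dynamically convex) if there exist contact forms $\alpha_1\geq\alpha_2\geq\alpha_3\geq\cdots$ for $\xi$ and positive numbers $D_1<D_2<D_3<\cdots$ tending to infinity such that, for every $k$, all elements of $\mathcal{P}^{<D_k}(Y,\alpha_k)$ have positive degree. A Liouville filling of $(Y,\xi)$ is a Liouville domain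 $(W,\lambda)$ (a compact manifold with boundary with a one-form $\lambda$ such that $d\lambda$ is symplectic and the Liouville vector field dual to $\lambda$ is outward transverse to $\partial W$) whose contact boundary $(\partial W,\ker\lambda|_{\partial W})$ is contactomorphic to $(Y,\xi)$. *)

(* Defs.v *)
From HB Require Import structures.
From mathcomp Require Import all_boot all_order all_algebra.
From mathcomp Require Import generic_quotient ring_quotient.
From mathcomp Require Import all_classical all_reals all_analysis.
From mathcomp Require Import complex.

Set Implicit Arguments.
Unset Strict Implicit.
Unset Printing Implicit Defensive.

Import Order.TTheory GRing.Theory Num.Theory.
Import numFieldNormedType.Exports.

Local Open Scope classical_set_scope.
Local Open Scope ring_scope.

(** * Singular cohomology with integer coefficients

    [H^k(X; Z)] is built as an honest quotient group, cocycles modulo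
    coboundaries of the singular cochain complex. *)

Definition std_simplex (R : realType) (k : nat) : set 'rV[R]_k.+1 :=
  [set x | (forall i, 0 <= x 0 i) /\ \sum_i x 0 i = 1].

Arguments std_simplex : clear implicits.

Section Faces.
Variables (R : realType) (k : nat).

(* The [i]-th face inclusion: insert the coordinate [0] at position [i]. *)
Definition face_map (i : 'I_k.+2) (x : 'rV[R]_k.+1) : 'rV[R]_k.+2 :=
  \row_j (if unlift i j is Some j' then x 0 j' else 0).

Lemma face_map_simplex i x :
  std_simplex R k x -> std_simplex R k.+1 (face_map i x).
Proof.
move=> [x0 x1]; split=> [j|]; first by rewrite mxE; case: unliftP.
rewrite (bigD1_ord i) //= mxE unlift_none add0r -x1.
by apply: eq_bigr => j _; rewrite mxE liftK.
Qed.

Definition face (i : 'I_k.+2) (x : set_type (std_simplex R k)) :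
    set_type (std_simplex R k.+1) :=
  SigSub (mem_set (face_map_simplex i (set_mem (valP x)))).

Lemma face_map_continuous i : continuous (face_map i).
Proof.
move=> x A [e /= e0 eA]; exists (fun a b => e a (lift i b)) => /= [a b|y xy].
  by have := e0 a (lift i b); rewrite mxE liftK ord1.
apply: eA => a b; rewrite mxE; case: unliftP => [j ->|bi].
  by rewrite -(ord1 a); exact: xy.
apply: nbhs_singleton; have := e0 a b.
by rewrite mxE bi unlift_none.
Qed.

Lemma face_continuous i : continuous (face i).
Proof.
apply: continuous_comp_initial => /=.
rewrite (_ : _ \o _ = face_map i \o set_val)//.
move=> x; apply: continuous_comp; first exact: initial_continuous.
exact: face_map_continuous.
Qed.

End Faces.

Section Cohomology.
Variables (R : realType) (X : topologicalType).

Record singular_simplex (k : nat) := SingularSimplex {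
  simplex_fun :> set_type (std_simplex R k) -> X;
  simplex_continuous : continuous simplex_fun }.

Lemma simplex_face_continuous k (s : singular_simplex k.+1) (i : 'I_k.+2) :
  continuous (s \o @face R k i).
Proof.
move=> x; apply: continuous_comp; first exact: face_continuous.
exact: simplex_continuous.
Qed.

Definition simplex_face k (s : singular_simplex k.+1) (i : 'I_k.+2) :
  singular_simplex k := SingularSimplex (@simplex_face_continuous k s i).

Definition cochain (k : nat) : zmodType := (singular_simplex k -> int : zmodType).

Definition codiff k (c : cochain k) : cochain k.+1 :=
  fun s => \sum_(i < k.+2) (-1) ^+ i * c (simplex_face s i).

Lemma codiffB k (c c' : cochain k) : codiff (c - c') = codiff c - codiff c'.
Proof.
apply/funext => s; rewrite /codiff !fctE -sumrB.
by apply: eq_bigr => i _; rewrite mulrBr.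
Qed.

Definition cocycle_pred k : {pred cochain k} := fun c => `[< codiff c = 0 >].

(* There are no nonzero coboundaries in degree [0]. *)
Definition is_coboundary k : cochain k -> Prop :=
  match k with
  | 0 => fun c => c = 0
  | k'.+1 => fun c => exists b : cochain k', c = codiff b
  end.

Lemma codiff0 k : codiff (0 : cochain k) = 0.
Proof. by rewrite -(subrr 0) codiffB subrr. Qed.

Lemma cocycle_zmod_closed k : zmod_closed (@cocycle_pred k).
Proof.
split; first by apply/asboolP; exact: codiff0.
move=> c c' /asboolP dc /asboolP dc'; apply/asboolP.
by rewrite codiffB dc dc' subrr.
Qed.

HB.instance Definition _ k :=
  GRing.isZmodClosed.Build (cochain k) (@cocycle_pred k) (@cocycle_zmod_closed k).

Record cocycle k := Cocycle {
  cocycle_val :> cochain k; cocycleP : cocycle_val \in @cocycle_pred k }.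

HB.instance Definition _ k := [isSub for @cocycle_val k].
HB.instance Definition _ k := [Choice of cocycle k by <:].
HB.instance Definition _ k := [SubChoice_isSubZmodule of cocycle k by <:].

Definition coboundary_pred k : {pred cocycle k} :=
  fun c => `[< is_coboundary (cocycle_val c) >].

Lemma coboundary_zmod_closed k : zmod_closed (@coboundary_pred k).
Proof.
split.
  by apply/asboolP; case: k => [|k] //=; exists 0; rewrite codiff0.
move=> c c' /asboolP; rewrite /coboundary_pred.
case: k c c' => [|k] c c' /=.
  by move=> c0 /asboolP /= c'0; apply/asboolP; rewrite /= c0 c'0 subrr.
move=> [b cb] /asboolP [b' cb']; apply/asboolP; exists (b - b').
by rewrite codiffB -cb -cb'.
Qed.

HB.instance Definition _ k :=
  GRing.isZmodClosed.Build (cocycle k) (@coboundary_pred k)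
    (@coboundary_zmod_closed k).

Definition cohomology (k : nat) : zmodType :=
  Quotient.quot (@coboundary_pred k : zmodClosed (cocycle k)).

End Cohomology.

Definition group_isomorphic (A B : zmodType) : Prop :=
  exists f : {additive A -> B}, bijective f.

(** * Submanifolds of Euclidean space

    Manifolds are submanifolds of some ['rV[R]_N], which by Whitney's theorem
    costs no generality for compact manifolds; tangent vectors are vectors of
    ['rV[R]_N]. *)

Section Smooth.
Variables (R : realType) (V W : normedModType R).

Fixpoint Ck (k : nat) (U : set V) (f : V -> W) : Prop :=
  match k with
  | 0 => forall p, U p -> {for p, continuous f}
  | k'.+1 => (forall p, U p -> differentiable f p) /\
             (forall v, Ck k' U (fun p => 'D_v f p))
  end.

(* To be used for open [U] only. *)
Definition smooth (U : set V) (f : V -> W) : Prop := forall k, Ck k U f.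

Definition local_extension (M : set V) (f : V -> W) (p : V)
    (U : set V) (g : V -> W) : Prop :=
  [/\ open U, U p, smooth U g & forall q, U q -> M q -> f q = g q].

Definition smooth_on (M : set V) (f : V -> W) : Prop :=
  forall p, M p -> exists U g, local_extension M f p U g.

(* For [p] in a submanifold [M] and [v] tangent to [M] at [p], the only [w] in
   this relation is the image of [v] under the differential of [f : M -> W]. *)
Definition has_differential (M : set V) (f : V -> W) (p v : V) (w : W) : Prop :=
  exists U g, local_extension M f p U g /\ w = 'd g p v.

End Smooth.

Section Submanifolds.
Variables (R : realType) (N : nat).
Local Notation E := 'rV[R]_N.

(* The half-space [{x | x_0 >= 0}] of dimension [m] in [R^N]. *)
Definition half_space (m : nat) : set E :=
  [set x | (forall i : 'I_N, (m <= i)%N -> x 0 i = 0) /\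
           (forall i : 'I_N, i = 0%N :> nat -> 0 <= x 0 i)].

Record straightening (m : nat) (M : set E) (p : E)
    (U V : set E) (phi psi : E -> E) : Prop := Straightening {
  straight_open_dom : open U;
  straight_open_codom : open V;
  straight_at : U p;
  straight_smooth : smooth U phi;
  straight_inv_smooth : smooth V psi;
  straight_maps : forall x, U x -> V (phi x) /\ psi (phi x) = x;
  straight_inv_maps : forall y, V y -> U (psi y) /\ phi (psi y) = y;
  straight_half_space : forall x, U x -> (M x <-> half_space m (phi x)) }.

(* Smooth [m]-dimensional submanifold with (possibly empty) boundary; [m >= 1]
   since the model is a half-space. *)
Definition submanifold (m : nat) (M : set E) : Prop :=
  (0 < m <= N)%N /\
  forall p, M p -> exists U V phi psi, straightening m M p U V phi psi.

Definition boundary (m : nat) (M : set E) : set E :=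
  [set p | M p /\ exists U V phi psi, straightening m M p U V phi psi /\
     forall i : 'I_N, i = 0%N :> nat -> phi p 0 i = 0].

Definition tangent (m : nat) (M : set E) (p v : E) : Prop :=
  M p /\ exists U V phi psi, straightening m M p U V phi psi /\
     forall i : 'I_N, (m <= i)%N -> ('d phi p v) 0 i = 0.

Definition outward (m : nat) (M : set E) (p v : E) : Prop :=
  tangent m M p v /\
  exists U V phi psi, [/\ straightening m M p U V phi psi,
     (forall i : 'I_N, i = 0%N :> nat -> phi p 0 i = 0) &
     (forall i : 'I_N, i = 0%N :> nat -> ('d phi p v) 0 i < 0)].

Definition closed_submanifold (m : nat) (M : set E) : Prop :=
  [/\ submanifold m M, compact M & boundary m M = set0].

(** One-forms on a compact submanifold are restrictions of smooth one-forms
    of the ambient space, here given by their coefficients. *)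

Definition form1 := E -> E.

Definition eval1 (a : form1) (p v : E) : R := \sum_(i < N) a p 0 i * v 0 i.

(* [da (u, v) = u (a v) - v (a u)] for constant vector fields [u], [v]. *)
Definition ext_d (a : form1) (p u v : E) : R :=
  eval1 (fun q => 'D_u a q) p v - eval1 (fun q => 'D_v a q) p u.

End Submanifolds.

(** * The Conley-Zehnder index

    [R^2k] has coordinates [(x, y)] and symplectic form [sum dx_j /\ dy_j];
    matrices act on column vectors. *)

Section ConleyZehnder.
Variables (R : realType) (k : nat).
Local Notation M2k := 'M[R]_(k + k).

(* Matrix of the symplectic form: [omega (u, v) = u^T *m sympl_form *m v]. *)
Definition sympl_form : M2k := block_mx 0 1%:M (- 1%:M) 0.

Definition symplectic (A : M2k) : Prop := A^T *m sympl_form *m A = sympl_form.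

(* The complex-linear part [(A - J A J) / 2] of [A], as a complex matrix,
   where [J (x, y) = (- y, x)] is multiplication by ['i] on [x + i y]. *)
Definition complex_part (A : M2k) : 'M[R[i]]_k :=
  \matrix_(i, j) Complex ((ulsubmx A i j + drsubmx A i j) / 2)
                         ((dlsubmx A i j - ursubmx A i j) / 2).

Definition is_argument (z : R[i]) (t : R) : Prop :=
  exists2 r : R, 0 < r & z = Complex (r * cos t) (r * sin t).

(* The two normal forms of symplectic matrices without eigenvalue [1]:
   [W+ = - 1] and [W- = diag (2, -1, .., -1, 1/2, -1, .., -1)]. *)
Definition Wplus : M2k := - 1%:M.

Definition Wminus : M2k :=
  block_mx (diag_mx (\row_(i < k) if (i == 0 :> nat)%N then 2 else -1)) 0
           0 (diag_mx (\row_(i < k) if (i == 0 :> nat)%N then 2^-1 else -1)).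

(* [mu] is the Conley-Zehnder index of the path [Psi] on [[0, 1]]: extend
   [Psi] to [[0, 2]], without eigenvalue [1] on [[1, 2]], up to [W+] or [W-];
   then [mu] is the degree of the square of the normalized determinant of the
   complex-linear part (which is a circle map extending the determinant of the
   unitary group).  This forces [Psi 1] not to have the eigenvalue [1]. *)
Definition conley_zehnder (Psi : R -> M2k) (mu : int) : Prop :=
  Psi 0 = 1%:M /\
  exists (PsiX : R -> M2k) (theta : R -> R),
    [/\ {within `[0, 2], continuous PsiX} /\
        (forall t, 0 <= t <= 2 -> symplectic (PsiX t)),
        (forall t, 0 <= t <= 1 -> PsiX t = Psi t),
        (forall t, 1 <= t <= 2 -> \det (1%:M - PsiX t) != 0),
        PsiX 2 = Wplus \/ PsiX 2 = Wminus &
        [/\ {within `[0, 2], continuous theta},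
            (forall t, 0 <= t <= 2 ->
               is_argument (\det (complex_part (PsiX t))) (theta t)) &
            theta 2 - theta 0 = pi * mu%:~R]].

End ConleyZehnder.

(** * Contact manifolds

    [n] is half the dimension of the symplectization; contact manifolds have
    dimension [2 n - 1] and their contact planes rank [2 (n - 1)]. *)

Section Contact.
Variables (R : realType) (n N : nat).
Local Notation E := 'rV[R]_N.
Local Notation dimY := (n.*2.-1).
Local Notation T := (@tangent R N dimY).

(* [xi p] is the contact plane at [p]. *)
Implicit Types (Y : set E) (xi : E -> set E) (alpha : form1 R N).

(* [alpha] is a contact form on [Y] with kernel [xi]: [alpha] does not vanish
   and [d alpha] is nondegenerate on the kernel of [alpha]. *)
Definition contact_form Y xi alpha : Prop :=
  [/\ smooth setT alpha,
      (forall p v, Y p -> (xi p v <-> T Y p v /\ eval1 alpha p v = 0)),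
      (forall p, Y p -> exists2 v, T Y p v & eval1 alpha p v != 0) &
      (forall p v, Y p -> xi p v -> v != 0 ->
         exists2 w, xi p w & ext_d alpha p v w != 0)].

Definition closed_contact_manifold Y xi : Prop :=
  closed_submanifold dimY Y /\ exists alpha, contact_form Y xi alpha.

Definition reeb_vector Y alpha (p v : E) : Prop :=
  [/\ T Y p v, eval1 alpha p v = 1 & forall w, T Y p w -> ext_d alpha p v w = 0].

Definition reeb_trajectory Y alpha (gamma : R -> E) : Prop :=
  forall t, [/\ Y (gamma t), derivable gamma t 1 &
                reeb_vector Y alpha (gamma t) ('D_1 gamma t)].

(* Closed Reeb orbits are parametrized on [R / period Z]; multiply covered
   orbits are included. *)
Definition reeb_orbit Y alpha (gamma : R -> E) (period : R) : Prop :=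
  [/\ 0 < period, reeb_trajectory Y alpha gamma &
      forall t, gamma (t + period) = gamma t].

Definition action alpha (gamma : R -> E) (period : R) : R :=
  \int[lebesgue_measure]_(t in `[0, period])
    eval1 alpha (gamma t) ('D_1 gamma t).

Definition disk : set (R * R) := [set z | z.1 ^+ 2 + z.2 ^+ 2 <= 1].

Definition circle_point (t : R) : R * R := (cos (2 * pi * t), sin (2 * pi * t)).

Definition capping_disk Y (gamma : R -> E) (period : R) (u : R * R -> E) : Prop :=
  [/\ {within disk, continuous u}, (forall z, disk z -> Y (u z)) &
      forall t, u (circle_point t) = gamma (t * period)].

Definition contractible Y (gamma : R -> E) (period : R) : Prop :=
  exists u, capping_disk Y gamma period u.

(* The rows of [e z] form a symplectic basis of the contact plane at [u z]. *)
Definition trivialization xi alpha (u : R * R -> E)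
    (e : R * R -> 'M[R]_(n.-1 + n.-1, N)) : Prop :=
  {within disk, continuous e} /\
  forall z, disk z ->
    (forall i, xi (u z) (row i (e z))) /\
    (forall i j, ext_d alpha (u z) (row i (e z)) (row j (e z)) =
                 sympl_form R n.-1 i j).

Definition reeb_flow Y alpha (Phi : R -> E -> E) : Prop :=
  forall p, Y p -> Phi 0 p = p /\ reeb_trajectory Y alpha (Phi ^~ p).

(* [Psi t] is the matrix of the differential of the Reeb flow at time
   [t * period], from the contact plane at [gamma 0] to the contact plane at
   [gamma (t * period)], in the bases given by the trivialization. *)
Definition linearized_flow Y alpha (gamma : R -> E) (period : R)
    (e : R * R -> 'M[R]_(n.-1 + n.-1, N))
    (Psi : R -> 'M[R]_(n.-1 + n.-1)) : Prop :=
  exists2 Phi, reeb_flow Y alpha Phi &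
    forall t i, 0 <= t <= 1 ->
      has_differential Y (Phi (t * period)) (gamma 0)
        (row i (e (circle_point 0)))
        (row i ((Psi t)^T *m e (circle_point t))).

Definition orbit_cz_index Y xi alpha (gamma : R -> E) (period : R) (mu : int) :
    Prop :=
  exists u e Psi,
    [/\ capping_disk Y gamma period u, trivialization xi alpha u e,
        linearized_flow Y alpha gamma period e Psi & conley_zehnder Psi mu].

Definition orbit_degree Y xi alpha (gamma : R -> E) (period : R) (d : int) :
    Prop :=
  exists2 mu, orbit_cz_index Y xi alpha gamma period mu & d = mu + n%:Z - 3.

(* The first conjunct says in particular that [gamma] is nondegenerate. *)
Definition positive_degree Y xi alpha (gamma : R -> E) (period : R) : Prop :=
  (exists d, orbit_degree Y xi alpha gamma period d) /\
  (forall d, orbit_degree Y xi alpha gamma period d -> 0 < d).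

Definition form_ge Y alpha1 alpha2 : Prop :=
  exists f : E -> R,
    [/\ smooth_on Y f, (forall p, Y p -> 1 <= f p) &
        forall p v, T Y p v -> eval1 alpha1 p v = f p * eval1 alpha2 p v].

Definition adc Y xi : Prop :=
  exists (alpha : nat -> form1 R N) (D : nat -> R),
    [/\ (forall k, contact_form Y xi (alpha k)) /\
        (forall k, form_ge Y (alpha k) (alpha k.+1)),
        (forall k, 0 < D k) /\ (forall k, D k < D k.+1),
        D @ \oo --> +oo &
        forall k gamma period,
          reeb_orbit Y (alpha k) gamma period ->
          contractible Y gamma period ->
          action (alpha k) gamma period < D k ->
          positive_degree Y xi (alpha k) gamma period].

(** ** The first Chern class

    [c_1] of the complex bundle [(xi, J)] is the class in Cech cohomology of
    the image of the transition functions of the determinant line bundle under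
    the connecting map of the exponential sequence. *)

(* [J p] acts on row vectors on the right. *)
Definition compatible_complex_structure Y xi alpha (J : E -> 'M[R]_N) : Prop :=
  {within Y, continuous J} /\
  forall p v, Y p -> xi p v ->
    [/\ xi p (v *m J p), v *m J p *m J p = - v,
        (v != 0 -> 0 < ext_d alpha p v (v *m J p)) &
        forall w, xi p w ->
          ext_d alpha p (v *m J p) (w *m J p) = ext_d alpha p v w].

Definition finite_open_cover Y q (U : 'I_q -> set E) : Prop :=
  (forall i, open (U i)) /\ (forall p, Y p -> exists i, U i p).

(* Local frames of [(xi, J)], given by the rows of [e]. *)
Definition complex_frame Y xi (J : E -> 'M[R]_N) (U : set E)
    (e : E -> 'M[R]_(n.-1, N)) : Prop :=
  {within Y `&` U, continuous e} /\
  forall p, Y p -> U p ->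
    (forall a, xi p (row a (e p))) /\ row_free (col_mx (e p) (e p *m J p)).

Definition complex_mul (J : 'M[R]_N) (g : 'M[R[i]]_n.-1) (e : 'M[R]_(n.-1, N)) :
    'M[R]_(n.-1, N) :=
  map_mx (@complex.Re R) g *m e + map_mx (@complex.Im R) g *m (e *m J).

(* [c] is a Cech cocycle representing [c_1 (xi, J)]: [theta i j] is an argument
   of the determinant of the transition matrix from [e i] to [e j]. *)
Definition chern_cocycle Y xi (J : E -> 'M[R]_N) q (U : 'I_q -> set E)
    (c : 'I_q -> 'I_q -> 'I_q -> E -> int) : Prop :=
  exists (e : 'I_q -> E -> 'M[R]_(n.-1, N)) (theta : 'I_q -> 'I_q -> E -> R),
    [/\ (forall i, complex_frame Y xi J (U i) (e i)),
        (forall i j, {within Y `&` U i `&` U j, continuous (theta i j)}),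
        (forall i j p, Y p -> U i p -> U j p ->
           exists2 g, e j p = complex_mul (J p) g (e i p) &
                      is_argument (\det g) (theta i j p)) &
        (forall i j k p, Y p -> U i p -> U j p -> U k p ->
           theta i j p + theta j k p - theta i k p = 2 * pi * (c i j k p)%:~R)].

Definition locally_constant (A : set E) (f : E -> int) : Prop :=
  forall p, A p -> \forall q \near p, A q -> f q = f p.

Definition cech_coboundary Y q (U : 'I_q -> set E)
    (c : 'I_q -> 'I_q -> 'I_q -> E -> int) : Prop :=
  exists b : 'I_q -> 'I_q -> E -> int,
    (forall i j, locally_constant (Y `&` U i `&` U j) (b i j)) /\
    (forall i j k p, Y p -> U i p -> U j p -> U k p ->
       c i j k p = b i j p + b j k p - b i k p).

(* [c_1] depends neither on the contact form nor on [J]. *)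
Definition c1_vanishes Y xi : Prop :=
  exists alpha J, [/\ contact_form Y xi alpha,
    compatible_complex_structure Y xi alpha J &
    exists q (U : 'I_q -> set E) c,
      [/\ finite_open_cover Y U, chern_cocycle Y xi J U c &
          cech_coboundary Y U c]].

End Contact.

(** * Liouville fillings *)

Section Liouville.
Variables (R : realType) (n N : nat).
Local Notation E := 'rV[R]_N.

Definition liouville_vector (W : set E) (lambda : form1 R N) (p v : E) : Prop :=
  tangent n.*2 W p v /\
  forall w, tangent n.*2 W p w -> ext_d lambda p v w = eval1 lambda p w.

Definition liouville_domain (W : set E) (lambda : form1 R N) : Prop :=
  [/\ submanifold n.*2 W, compact W, smooth setT lambda,
      (forall p v, tangent n.*2 W p v -> v != 0 ->
         exists2 w, tangent n.*2 W p w & ext_d lambda p v w != 0) &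
      (forall p, boundary n.*2 W p ->
         exists2 v, liouville_vector W lambda p v & outward n.*2 W p v)].

Definition contact_boundary (W : set E) (lambda : form1 R N) (p : E) : set E :=
  [set v | tangent n.*2.-1 (boundary n.*2 W) p v /\ eval1 lambda p v = 0].

End Liouville.

Definition contactomorphic (R : realType) (n N1 N2 : nat)
    (Y1 : set 'rV[R]_N1) (xi1 : 'rV[R]_N1 -> set 'rV[R]_N1)
    (Y2 : set 'rV[R]_N2) (xi2 : 'rV[R]_N2 -> set 'rV[R]_N2) : Prop :=
  exists (f : 'rV[R]_N1 -> 'rV[R]_N2) (g : 'rV[R]_N2 -> 'rV[R]_N1),
    [/\ smooth_on Y1 f /\ smooth_on Y2 g,
        (forall p, Y1 p -> Y2 (f p) /\ g (f p) = p),
        (forall q, Y2 q -> Y1 (g q) /\ f (g q) = q) &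
        forall p v w, tangent n.*2.-1 Y1 p v -> has_differential Y1 f p v w ->
          (xi1 p v <-> xi2 (f p) w)].

Definition liouville_filling (R : realType) (n N N' : nat)
    (Y : set 'rV[R]_N) (xi : 'rV[R]_N -> set 'rV[R]_N)
    (W : set 'rV[R]_N') (lambda : form1 R N') : Prop :=
  liouville_domain n W lambda /\
  contactomorphic n (boundary n.*2 W) (contact_boundary n W lambda) Y xi.

(* Main.v *)
Require Import Defs.
From mathcomp Require Import all_boot all_order all_algebra.
From mathcomp Require Import generic_quotient ring_quotient.
From mathcomp Require Import all_classical all_reals all_analysis.
From mathcomp Require Import complex.
From mathcomp Require Import ring lra.
Import numFieldNormedType.Exports.

(** Let [A = (1 1; 1 0)], with eigenvalues [phi = (1 + sqrt 5) / 2] and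
    [- 1 / phi], act on the torus [T^2].  Both fillings are quotients of
    [{1, 2} x [-1, 1] x T^2 x R], with coordinates [(j, s, p, tau)], by the
    transformation [(s, p, tau) |-> (- s, A p, tau - 1)], which either fixes the
    label [j] (giving two components) or exchanges the two labels (giving one
    component): [H^0] is [Z^2] or [Z].  In eigencoordinates [x, y] of [A] the form
    [phi^tau dx + s phi^(- tau) dy] is invariant, and it is Liouville with
    Liouville field [d/dtau / ln phi + 2 s d/ds].  Because the transformation
    changes the sign of [s], exchanging the labels where [s = -1] identifies the
    boundaries [{s = 1 or -1}] of the two quotients.

    On the boundary the Reeb field is constant and nonzero on each torus fibre.
    If a closed orbit bounded a disk, one could lift [tau] to a real function on
    the disk and move all fibres back to a single torus; the orbit would then wind
    zero times around that torus, which is absurd.  So there is no contractible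
    closed orbit, and asymptotic dynamical convexity holds vacuously.  The first
    Chern class vanishes since the contact planes have a global frame. *)

Set Implicit Arguments.
Unset Strict Implicit.
Unset Printing Implicit Defensive.
Import Order.TTheory GRing.Theory Num.Theory.
Local Open Scope classical_set_scope.
Local Open Scope ring_scope.

(** * Smooth functions *)

(** The boundary is disconnected: for either behaviour of the labels it is two copies of the mapping
    torus of [A^2]. Exchanged labels give the product of [-1, 1] with that mapping torus, whose two
    ends are the two copies; fixed labels give two twisted interval bundles over the mapping torus
    of [A], each bounded by one copy. The determinant -1 of [A] is essential: in the invariant form,
    the sign change of [s] compensates the negative eigenvalue. Manifolds are subsets of Euclidean
    space and forms are ambient, so the quotients are embedded by explicit formulas. Bump functions
    of [tau] whose squares sum to 1 let one ambient form with linear coefficients restrict to the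
    Liouville form. Tangency and boundary are defined by the existence of some straightening, so
    arbitrary straightenings must be compared with the explicit charts. At a boundary point only
    half of the directions stay in the manifold, which is why the comparison uses one-sided
    derivatives. *)

Section NearEq.
Variables (R : realType) (V W : normedModType R).

Lemma differentiable_near0 (h : V -> W) p :
  (\forall q \near p, h q = 0) -> differentiable h p.
Proof.
move=> h0.
have hE : h \o shift p = cst (h p) + cst 0 +o_ 0 id.
  apply/eqaddoP => _/posnumP[e]; near=> x.
  rewrite !fctE /= (nbhs_singleton h0) add0r subr0.
  suff -> : h (x + p) = 0 by rewrite normr0 mulr_ge0.
  near: x; have := h0; rewrite (near_shift 0 p) /=.
  by apply: filterS => x; rewrite subr0.
have d0 := @diff_unique _ _ _ h (\0 : {linear V -> W}) p
  (@cst_continuous _ _ 0) hE.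
by apply/diff_locallyP; rewrite d0; split => //; exact: cst_continuous.
Unshelve. all: by end_near. Qed.

Lemma near_eq_differentiable (f g : V -> W) p :
  (\forall q \near p, f q = g q) -> differentiable f p -> differentiable g p.
Proof.
move=> fg df; rewrite (_ : g = f + (g - f)); last by rewrite addrC subrK.
apply: differentiableD => //; apply: differentiable_near0.
by apply: filterS fg => q /= e; rewrite !fctE e subrr.
Qed.

(** On an open set, agreement holds near each point and therefore passes to all directional
    derivatives, which is what the induction needs. *)
Lemma Ck_eq k (U : set V) (f g : V -> W) : open U ->
  (forall p, U p -> f p = g p) -> Ck k U f -> Ck k U g.
Proof.
move=> oU; elim: k f g => [|k ih] f g fg /=.
  move=> cf p Up; change (g @ p --> g p); rewrite -(fg _ Up).
  apply: cvg_trans (cf p Up); apply: near_eq_cvg.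
  by apply: filterS (open_nbhs_nbhs (conj oU Up)) => q /fg.
move=> [df Df]; split=> [p Up|v].
  apply: near_eq_differentiable (df p Up).
  by apply: filterS (open_nbhs_nbhs (conj oU Up)) => q /fg.
apply: ih (Df v) => p Up; apply: near_eq_derive.
by apply: filterS (open_nbhs_nbhs (conj oU Up)) => q /fg.
Qed.

Lemma Ck_pred k (U : set V) (f : V -> W) : Ck k.+1 U f -> Ck k U f.
Proof.
elim: k f => [|k ih] f [df Df]; first by move=> p Up; exact: differentiable_continuous (df p Up).
by split=> // v; exact: ih.
Qed.

Lemma Ck_sub k (U U' : set V) (f : V -> W) : U' `<=` U -> Ck k U f -> Ck k U' f.
Proof.
move=> sU; elim: k f => [|k ih] f /=; first by move=> cf p /sU; exact: cf.
by move=> [df Df]; split=> [p /sU|v]; [exact: df|exact: ih].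
Qed.

Lemma Ck_cst k (U : set V) (a : W) : Ck k U (cst a).
Proof.
elim: k a => [|k ih] a /=; first by move=> p _; exact: cst_continuous.
split=> [p _|v]; first exact: differentiable_cst.
by rewrite (_ : (fun p => _) = cst 0) //; apply/funext => p; rewrite derive_cst.
Qed.

Lemma Ck_add k (U : set V) (f g : V -> W) : open U -> Ck k U f -> Ck k U g ->
  Ck k U (fun p => f p + g p).
Proof.
move=> oU; elim: k f g => [|k ih] f g /=.
  by move=> cf cg p Up; apply: continuousD; [exact: cf|exact: cg].
move=> [df Df] [dg Dg]; split=> [p Up|v].
  by apply: differentiableD; [exact: df|exact: dg].
apply: Ck_eq (ih _ _ (Df v) (Dg v)) => // p Up.
by rewrite -deriveD //; apply: diff_derivable; [exact: df|exact: dg].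
Qed.

Lemma Ck_sum k (U : set V) (I : Type) (s : seq I) (f : I -> V -> W) : open U ->
  (forall i, Ck k U (f i)) -> Ck k U (fun p => \sum_(i <- s) f i p).
Proof.
move=> oU cf; elim: s => [|i s ih].
  by apply: Ck_eq (Ck_cst k U 0) => // p _; rewrite big_nil.
by apply: Ck_eq (Ck_add oU (cf i) ih) => // p _; rewrite big_cons.
Qed.

Lemma Ck_lin k (U : set V) (f : {linear V -> W}) : continuous f -> Ck k U f.
Proof.
case: k => [|k] cf /=; first by move=> p _; exact: cf.
split=> [p _|v]; first exact: linear_differentiable.
rewrite (_ : (fun p => _) = cst (f v)); first exact: Ck_cst.
apply/funext => p; rewrite deriveE; last exact: linear_differentiable.
by rewrite diff_lin.
Qed.

End NearEq.

Section CkScalar.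
Variables (R : realType) (V : normedModType R) (U : set V).
Hypothesis oU : open U.

Lemma Ck_mul k (f g : V -> R) : Ck k U f -> Ck k U g ->
  Ck k U (fun p => f p * g p).
Proof.
elim: k f g => [|k ih] f g.
  by move=> cf cg p Up; apply: continuousM; [exact: cf|exact: cg].
move=> cf cg; have cf' := Ck_pred cf; have cg' := Ck_pred cg.
move: cf cg => [df Df] [dg Dg]; split=> [p Up|v].
  by apply: differentiableM; [exact: df|exact: dg].
apply: Ck_eq (Ck_add oU (ih _ _ cf' (Dg v)) (ih _ _ cg' (Df v))) => // p Up.
rewrite deriveM //; apply: diff_derivable; [exact: df|exact: dg].
Qed.

Lemma Ck_opp k (f : V -> R) : Ck k U f -> Ck k U (fun p => - f p).
Proof.
move=> /(Ck_mul (Ck_cst k U (-1 : R))); apply: Ck_eq => // p _.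
by rewrite /cst mulN1r.
Qed.

Lemma derive_comp1 (f : V -> R) (h : R -> R) p v : differentiable f p ->
  differentiable h (f p) -> 'D_v (h \o f) p = 'D_1 h (f p) * 'D_v f p.
Proof.
move=> df dh; have dhf : differentiable (h \o f) p by exact: differentiable_comp.
rewrite !deriveE // diff_comp //=.
by rewrite -[X in 'd h _ X]mulr1 -[_ * 1]/(_ *: _) linearZ mulrC.
Qed.

Lemma Ck_comp1 k (A : set R) (f : V -> R) (h : R -> R) :
  (forall p, U p -> A (f p)) -> Ck k U f -> Ck k A h -> Ck k U (h \o f).
Proof.
elim: k f h => [|k ih] f h Af.
  by move=> cf ch p Up; apply: continuous_comp; [exact: cf|exact/ch/Af].
move=> cf ch; have cf' := Ck_pred cf.
move: cf ch => [df Df] [dh Dh]; split=> [p Up|v].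
  by apply: differentiable_comp; [exact: df|exact/dh/Af].
apply: Ck_eq (Ck_mul (ih _ _ Af cf' (Dh 1)) (Df v)) => // p Up.
by rewrite derive_comp1 //; [exact: df|exact/dh/Af].
Qed.

End CkScalar.

Section CkRow.
Variables (R : realType) (V : normedModType R) (U : set V).
Hypothesis oU : open U.

Lemma differentiable_row n (f : V -> 'rV[R]_n) p :
  (forall j, differentiable (fun x => f x 0 j) p) -> differentiable f p.
Proof.
move=> df; rewrite (_ : f = \sum_(j < n) (fun x => f x 0 j *: delta_mx 0 j)).
  apply: differentiable_sum => j; exact: differentiableZl.
by apply/funext => x; rewrite fct_sumE {1}[f x]row_sum_delta.
Qed.

Lemma differentiable_entry n (f : V -> 'rV[R]_n) p j :
  differentiable f p -> differentiable (fun x => f x 0 j) p.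
Proof.
move=> df; apply: (@differentiable_comp _ _ _ _ f (fun M : 'rV[R]_n => M 0 j)) => //.
exact: differentiable_coord.
Qed.

Lemma derive_entry n (f : V -> 'rV[R]_n) p v j :
  differentiable f p -> ('D_v f p) 0 j = 'D_v (fun x => f x 0 j) p.
Proof. by move=> df; rewrite derive_mx ?mxE //; exact: diff_derivable. Qed.

Lemma continuous_row n (f : V -> 'rV[R]_n) p :
  (forall j, {for p, continuous (fun x => f x 0 j)}) -> {for p, continuous f}.
Proof.
move=> cf; rewrite (_ : f = \sum_(j < n) (fun x => f x 0 j *: delta_mx 0 j)).
  elim/big_ind : _ => [|g h cg ch|j _]; first exact: cst_continuous.
    exact: continuousD.
  exact: continuousZr_tmp.
by apply/funext => x; rewrite fct_sumE {1}[f x]row_sum_delta.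
Qed.

Lemma Ck_row k n (f : V -> 'rV[R]_n) :
  (forall j, Ck k U (fun x => f x 0 j)) -> Ck k U f.
Proof.
elim: k f => [|k ih] f cf; first by move=> p Up; apply: continuous_row => j; exact: cf.
split=> [p Up|v].
  by apply: differentiable_row => j; have [+ _] := cf j; exact.
apply: ih => j; have [df Df] := cf j; apply: Ck_eq (Df v) => // p Up.
rewrite derive_entry //; apply: differentiable_row => i.
by have [+ _] := cf i; exact.
Qed.

Lemma Ck_entry k n (f : V -> 'rV[R]_n) j :
  Ck k U f -> Ck k U (fun x => f x 0 j).
Proof.
elim: k f => [|k ih] f cf.
  move=> p Up; apply: (@continuous_comp _ _ _ f (fun M : 'rV[R]_n => M 0 j)).
    exact: cf.
  exact: coord_continuous.
have [df Df] := cf; split=> [p Up|v]; first exact/differentiable_entry/df.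
apply: Ck_eq (ih _ (Df v)) => // p Up; rewrite derive_entry //; exact: df.
Qed.

Lemma derive_comp_row n (f : V -> 'rV[R]_n) (h : 'rV[R]_n -> R) p v :
  differentiable f p -> differentiable h (f p) ->
  'D_v (h \o f) p = \sum_j 'D_(delta_mx 0 j) h (f p) * 'D_v (fun x => f x 0 j) p.
Proof.
move=> df dh; have dhf : differentiable (h \o f) p by exact: differentiable_comp.
rewrite deriveE // diff_comp //= {1}['d f p v]row_sum_delta linear_sum.
apply: eq_bigr => j _; rewrite linearZ /= -derive_entry // !deriveE //.
by rewrite mulrC.
Qed.

Lemma Ck_comp_row k n (A : set 'rV[R]_n) (f : V -> 'rV[R]_n) (h : 'rV[R]_n -> R) :
  (forall p, U p -> A (f p)) -> Ck k U f -> Ck k A h -> Ck k U (h \o f).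
Proof.
elim: k f h => [|k ih] f h Af.
  by move=> cf ch p Up; apply: continuous_comp; [exact: cf|exact/ch/Af].
move=> cf ch; have cf' := Ck_pred cf.
move: (cf) ch => [df Df] [dh Dh]; split=> [p Up|v].
  by apply: differentiable_comp; [exact: df|exact/dh/Af].
pose F j := fun p => 'D_(delta_mx 0 j) h (f p) * 'D_v (fun x => f x 0 j) p.
have cF j : Ck k U (F j).
  have [_ cfj] := Ck_entry j cf.
  exact: (Ck_mul oU (ih _ _ Af cf' (Dh _)) (cfj v)).
apply: Ck_eq (Ck_sum (index_enum _) oU cF) => // p Up.
by rewrite derive_comp_row //; [exact: df|exact/dh/Af].
Qed.

End CkRow.

Lemma Ck_comp (R : realType) (V : normedModType R) (U : set V) k n m
  (A : set 'rV[R]_n) (f : V -> 'rV[R]_n) (h : 'rV[R]_n -> 'rV[R]_m) :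
  open U -> open A ->
  (forall p, U p -> A (f p)) -> Ck k U f -> Ck k A h -> Ck k U (h \o f).
Proof.
move=> oU oA Af cf ch; apply: Ck_row => // j.
exact: (Ck_comp_row oU Af cf (Ck_entry oA j ch)).
Qed.

(** * Functions of one variable and bump functions *)

Section OneVar.
Variable R : realType.

(** Regularity by bootstrapping: [expR], [cos] with [sin], and the family [flat] express their
    derivatives through themselves, so each application raises the order by one. *)
Lemma Ck_is_derive k (A : set R) (h h' : R -> R) : open A ->
  (forall x, A x -> is_derive x 1 h (h' x)) -> Ck k A h' -> Ck k.+1 A h.
Proof.
move=> oA dh ch'; have dfh x : A x -> differentiable h x.
  by move=> Ax; apply/derivable1_diffP; have [] := dh _ Ax.
split=> // v; apply: Ck_eq (Ck_mul oA (Ck_cst k A (v : R)) ch') => // x Ax.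
have [_ <-] := dh _ Ax; rewrite !deriveE; [|exact: dfh|exact: dfh].
rewrite /cst (_ : 'd h x v = 'd h x ((v : R) *: (1 : R))); first by rewrite linearZ.
by rewrite -[_ *: _]/(_ * _) mulr1.
Qed.

Lemma Ck_id k (A : set R) : Ck k A (@id R).
Proof. by apply: (@Ck_lin _ _ _ k A (@idfun R)) => x; exact: cvg_id. Qed.

Lemma Ck_expR k (A : set R) : open A -> Ck k A (@expR R).
Proof.
move=> oA; elim: k => [|k ih]; first by move=> x _; exact: continuous_expR.
by apply: (Ck_is_derive oA) ih => x _; exact: is_derive_expR.
Qed.

Lemma Ck_cos_sin k (A : set R) : open A -> Ck k A (@cos R) /\ Ck k A (@sin R).
Proof.
move=> oA; elim: k => [|k [ihc ihs]].
  by split=> x _; [exact: continuous_cos|exact: continuous_sin].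
split; last by apply: (Ck_is_derive oA) ihc => x _; exact: is_derive_sin.
by apply: (Ck_is_derive oA) (Ck_opp oA ihs) => x _; exact: is_derive_cos.
Qed.

Lemma open_neq0 : open [set x : R | x != 0].
Proof. exact: open_neq. Qed.

Lemma Ck_inv k : Ck k [set x : R | x != 0] (@GRing.inv R).
Proof.
elim: k => [|k ih]; first by move=> x x0; exact: inv_continuous.
apply: (Ck_is_derive open_neq0) (Ck_opp open_neq0 (Ck_mul open_neq0 ih ih)) => x x0.
have /DeriveDef := derivableV x0 (@derivable_id _ _ x 1).
apply; rewrite (deriveV x0 (@derivable_id _ _ x 1)) derive_id.
by rewrite -[_ *: _]/(_ * _) mulr1 expr2 invfM.
Qed.

Lemma Ck_atan k (A : set R) : open A -> Ck k A (@atan R).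
Proof.
move=> oA; case: k => [|k]; first by move=> x _; exact: continuous_atan.
have c1 : Ck k A (fun x : R => 1 + x * x).
  by apply: Ck_add => //; [exact: Ck_cst|apply: Ck_mul => //; exact: Ck_id].
have p1 (x : R) : A x -> [set x : R | x != 0] (1 + x * x).
  by move=> _ /=; rewrite gt_eqF // ltr_wpDr // -expr2 sqr_ge0.
apply: (Ck_is_derive oA) (Ck_comp1 oA p1 c1 (@Ck_inv k)).
Qed.

(** [flat 0] is the classical smooth function that is flat at 0. The negative powers are included
    because they occur in its derivatives. *)
Definition flat n (x : R) : R := if 0 < x then x ^- n * expR (- x^-1) else 0.

Lemma flat_ge0 n x : 0 <= flat n x.
Proof.
rewrite /flat; case: ifPn => // x0.
by rewrite mulr_ge0 ?expR_ge0 // invr_ge0 exprn_ge0 // ltW.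
Qed.

(** The term of degree [n.+2] of the exponential series bounds [expR x^-1] from below. A quadratic
    bound makes the difference quotient at 0 tend to 0. *)
Lemma flat_le n x : flat n x <= (n.+2)`!%:R * x ^+ 2.
Proof.
rewrite /flat; case: ifPn => x0; last by rewrite mulr_ge0 ?sqr_ge0.
have xV0 : 0 < x^-1 by rewrite invr_gt0.
have := expR_ge1Dxn n.+1 (ltW xV0).
set c := _`!%:R; have c0 : 0 < c by rewrite ltr0n fact_gt0.
move=> h; have {}h : x ^- n.+2 / c <= expR x^-1.
  by rewrite exprVn in h; apply: le_trans h; rewrite lerDr.
rewrite expRN ler_pdivrMr ?expR_gt0 //.
have -> : x ^- n = c * x ^+ 2 * (x ^- n.+2 / c).
  rewrite -[n.+2]addn2 exprD invfM; field.
  by rewrite !expf_neq0 ?gt_eqF.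
by rewrite ler_pM2l // mulr_gt0 // exprn_gt0.
Qed.

Lemma is_derive_flat n x :
  is_derive (x : R) (1 : R) (flat n) (flat n.+2 x - n%:R * flat n.+1 x : R).
Proof.
have [x0|x0|->] := ltgtP x 0.
- rewrite /flat ltNge (ltW x0) /= mulr0 subr0.
  apply: (near_eq_is_derive _ (is_derive_cst (0 : R) x 1)).
  near=> y; rewrite /= ltNge; suff -> : y <= 0 by [].
  by near: y; exact: lt_le_nbhsl.
- have nf : \forall y \near x, y ^- n * expR (- y^-1) = flat n y.
    near=> y; rewrite /flat; suff -> : 0 < y by [].
    by near: y; exact: lt_nbhsr.
  apply: (near_eq_is_derive nf); clear nf.
  have xn0 : x != 0 by rewrite gt_eqF.
  have dV : is_derive x 1 (fun y : R => y^-1) (- x ^- 2).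
    have /DeriveDef := derivableV xn0 (@derivable_id _ _ x 1).
    apply; rewrite (deriveV xn0 (@derivable_id _ _ x 1)) derive_id.
    by rewrite -[_ *: _]/(_ * _) mulr1.
  have dN : is_derive x 1 (fun y : R => - y^-1) (x ^- 2).
    by apply: is_derive_eq; rewrite opprK.
  have dE : is_derive x 1 (fun y : R => expR (- y^-1)) (expR (- x^-1) * x ^- 2).
    exact: (@is_derive1_comp _ expR (fun y : R => - y^-1)).
  have dX : is_derive x 1 (fun y : R => y ^- n) (- (n%:R * x ^- n.+1)).
    have -> : (fun y : R => y ^- n) = (fun y : R => y^-1) ^+ n.
      by apply/funext => y; rewrite -exprVn exprfctE.
    apply: is_derive_eq; case: n => [|n]; first by rewrite !mul0r oppr0 scale0r.
    rewrite [LHS](_ : _ = n.+1%:R * x^-1 ^+ n * (- x ^- 2)) //.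
    by rewrite -!exprVn !exprS; ring.
  apply: is_derive_eq; rewrite /flat x0 -[_ *: _]/(_ * _).
  rewrite -[X in _ + X = _]/(_ * _) -!exprVn !exprS; ring.
- rewrite /flat ltxx mulr0 subr0 /=.
  set C : R := (n.+2)`!%:R; have C0 : 0 < C by rewrite ltr0n fact_gt0.
  have l0 : h^-1 *: (flat n (h *: (1 : R) + 0) - flat n 0) @[h --> 0^'] --> (0 : R).
    apply/cvgrPdist_le => e e0; near=> h; rewrite sub0r normrN.
    have hn0 : h != 0 by near: h; exact: nbhs_dnbhs_neq.
    rewrite {2}/flat ltxx subr0 addr0 normrM normfV.
    rewrite ler_pdivrMl ?normr_gt0 // ger0_norm ?flat_ge0 //.
    rewrite (le_trans (flat_le _ _)) // -[h *: 1]/(h * 1) mulr1 -real_normK ?num_real //.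
    rewrite expr2 mulrCA ler_pM2l ?normr_gt0 // -ler_pdivlMl //.
    by near: h; apply: dnbhs0_le; rewrite mulr_gt0 // invr_gt0.
  apply: DeriveDef; first by apply/cvg_ex; exists 0.
  exact: cvg_lim l0.
Unshelve. all: by end_near. Qed.

Lemma Ck_flat k n : Ck k setT (flat n).
Proof.
have oT : open [set: R] by exact: openT.
elim: k n => [|k ih] n.
  move=> x _; apply: differentiable_continuous; apply/derivable1_diffP.
  by have [] := is_derive_flat n x.
apply: (Ck_is_derive oT (fun x _ => is_derive_flat n x)).
apply: Ck_add => //; apply: Ck_opp => //; apply: Ck_mul => //; exact: Ck_cst.
Qed.

Definition step (x : R) : R := flat 0 x / (flat 0 x + flat 0 (1 - x)).

Lemma flat0_gt0 (x : R) : (0 < flat 0 x) = (0 < x).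
Proof. by rewrite /flat; case: ifP => [_|_]; rewrite ?ltxx // expr0 invr1 mul1r expR_gt0. Qed.

Lemma step_den_gt0 (x : R) : 0 < flat 0 x + flat 0 (1 - x).
Proof.
have [x0|x0] := ltP 0 x.
  by rewrite ltr_pwDl ?flat_ge0 // flat0_gt0.
by rewrite ltr_wpDl ?flat_ge0 // flat0_gt0 subr_gt0 (le_lt_trans x0).
Qed.

Lemma step_le0 x : x <= 0 -> step x = 0.
Proof. by move=> x0; rewrite /step /flat ltNge x0 mul0r. Qed.

Lemma step_ge1 x : 1 <= x -> step x = 1.
Proof.
move=> x1; rewrite /step; have -> : flat 0 (1 - x) = 0.
  by rewrite /flat subr_gt0 ltNge x1.
by rewrite addr0 divff // gt_eqF // flat0_gt0 (lt_le_trans ltr01).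
Qed.

Lemma step_gt0 x : 0 < x -> 0 < step x.
Proof. by move=> x0; rewrite divr_gt0 ?step_den_gt0 ?flat0_gt0. Qed.

Lemma step_lt1 x : x < 1 -> step x < 1.
Proof.
by move=> x0; rewrite ltr_pdivrMr ?step_den_gt0 // mul1r ltrDl flat0_gt0 subr_gt0.
Qed.

Lemma Ck_step k : Ck k setT step.
Proof.
have oT : open [set: R] by exact: openT.
have c1 : Ck k setT (fun x : R => 1 - x).
  by apply: Ck_add => //; [exact: Ck_cst|apply: Ck_opp => //; exact: Ck_id].
have c2 := Ck_comp1 oT (fun _ _ => I) c1 (@Ck_flat k 0).
have p (x : R) : setT x -> [set y : R | y != 0] (flat 0 x + flat 0 (1 - x)).
  by move=> _ /=; rewrite gt_eqF // step_den_gt0.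
exact: (Ck_mul oT (@Ck_flat k 0) (Ck_comp1 oT p (Ck_add oT (@Ck_flat k 0) c2) (@Ck_inv k))).
Qed.

(* The squares of [cutoff] and of its translate by [1/2] form a partition of
   unity of the circle [R / Z]. *)
Definition cutoff (x : R) : R := sin (pi / 2 * (step (2 * x) + step (2 * x - 1))).

Lemma cutoff_out x : ~~ (0 < x < 1) -> cutoff x = 0.
Proof.
rewrite negb_and -!leNgt /cutoff => /orP[x0|x1].
  by rewrite !step_le0 ?addr0 ?mulr0 ?sin0 //; lra.
rewrite !step_ge1; [|lra|lra].
by rewrite (_ : _ * _ = pi) ?sinpi //; field.
Qed.

Lemma cutoff_gt0 x : 0 < x < 1 -> 0 < cutoff x.
Proof.
move=> /andP[x0 x1]; rewrite /cutoff; have := @pi_gt0 R => pi0.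
have s0 : 0 < step (2 * x) by apply: step_gt0; lra.
have s1 : step (2 * x - 1) < 1 by apply: step_lt1; lra.
have t0 : 0 <= step (2 * x - 1).
  by have [?|?] := leP (2 * x - 1) 0; [rewrite step_le0|rewrite ltW // step_gt0].
have t1 : step (2 * x) <= 1.
  by have [?|?] := leP 1 (2 * x); [rewrite step_ge1|rewrite ltW // step_lt1].
by apply: sin_gt0_pi; apply/andP; split; nra.
Qed.

(** On this range both values of [cutoff] come from the same angle [pi / 2 * step (2 * x)], once as
    it is and once increased by [pi / 2]: one is its sine, the other its cosine. *)
Lemma cutoff_unity x : 0 <= x <= 1 / 2 -> cutoff x ^+ 2 + cutoff (x + 1 / 2) ^+ 2 = 1.
Proof.
move=> /andP[x0 x1]; rewrite /cutoff.
rewrite [step (2 * x - 1)]step_le0; last lra.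
rewrite [step (2 * (x + 1 / 2))]step_ge1; last lra.
rewrite addr0 (_ : 2 * (x + 1 / 2) - 1 = 2 * x); last by field.
by rewrite mulrDr mulr1 [pi / 2 + _]addrC sinDpihalf addrC cos2Dsin2.
Qed.

Lemma Ck_cutoff k : Ck k setT cutoff.
Proof.
have oT : open [set: R] by exact: openT.
have c2 : Ck k setT (fun x : R => 2 * x).
  by apply: Ck_mul => //; [exact: Ck_cst|exact: Ck_id].
have c3 : Ck k setT (fun x : R => 2 * x - 1) by apply: Ck_add => //; exact: Ck_cst.
have [_ cs] := Ck_cos_sin k oT.
apply: (Ck_comp1 oT (fun _ _ => I) _ cs); apply: Ck_mul => //; first exact: Ck_cst.
apply: Ck_add => //; apply: (Ck_comp1 oT (fun _ _ => I) _ (@Ck_step k)) => //.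
Qed.

End OneVar.

(** * Charts of submanifolds *)

Lemma Ck_coord (R : realType) n k (U : set 'rV[R]_n) (j : 'I_n) :
  open U -> Ck k U (fun x : 'rV[R]_n => x 0 j : R).
Proof.
move=> oU; apply: (@Ck_entry _ _ _ oU k n id).
by apply: (@Ck_lin _ _ _ k U (@idfun 'rV[R]_n)) => x; exact: cvg_id.
Qed.

Lemma Ck_idrow (R : realType) n k (U : set 'rV[R]_n) : open U -> Ck k U id.
Proof. by move=> oU; apply: Ck_row => // j; exact: Ck_coord. Qed.

Lemma Ck_addrow (R : realType) (V : normedModType R) n k (U : set V)
  (f g : V -> 'rV[R]_n) : open U ->
  Ck k U f -> Ck k U g -> Ck k U (fun x => f x + g x).
Proof. by move=> oU; exact: Ck_add. Qed.

Lemma Ck_opprow (R : realType) (V : normedModType R) n k (U : set V)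
  (f : V -> 'rV[R]_n) : open U -> Ck k U f -> Ck k U (fun x => - f x).
Proof.
move=> oU cf; apply: Ck_row => // j.
apply: Ck_eq (Ck_opp oU (Ck_entry oU j cf)) => // x _; by rewrite mxE.
Qed.

Lemma smooth_differentiable (R : realType) (V W : normedModType R) (U : set V)
  (f : V -> W) x : smooth U f -> U x -> differentiable f x.
Proof. by move=> /(_ 1%N) [df _]; exact: df. Qed.

Lemma smooth_continuous (R : realType) (V W : normedModType R) (U : set V)
  (f : V -> W) x : smooth U f -> U x -> {for x, continuous f}.
Proof. by move=> /(_ 0%N); exact. Qed.

Lemma near_eq_diff (R : realType) (V W : normedModType R) (f g : V -> W) p v :
  (\forall q \near p, f q = g q) -> differentiable f p -> 'd f p v = 'd g p v.
Proof.
move=> fg df; rewrite -!deriveE //; first exact: near_eq_derive.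
exact: near_eq_differentiable df.
Qed.

Lemma diff_comp_near (R : realType) (V V' W : normedModType R) (f : V -> V')
    (g : V' -> W) (h : V -> W) (p w : V) :
  differentiable f p -> differentiable g (f p) ->
  (\forall q \near p, g (f q) = h q) -> 'd g (f p) ('d f p w) = 'd h p w.
Proof.
move=> df dg gfh; have dgf := differentiable_comp df dg.
by rewrite -(near_eq_diff w gfh dgf) (diff_comp df dg).
Qed.

Lemma diff_idE (R : realType) (V : normedModType R) (p v : V) : 'd (@id V) p v = v.
Proof. by rewrite -deriveE ?derive_id //; exact: (ex_diff (x := nbhs p)). Qed.

Lemma diff_subE (R : realType) (V W : normedModType R) (f g : V -> W) (p d : V) :
  differentiable f p -> differentiable g p -> 'd (f - g) p d = 'd f p d - 'd g p d.
Proof. by move=> df dg; rewrite diffB. Qed.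

Lemma diff_oppE (R : realType) (V W : normedModType R) (f : V -> W) (p d : V) :
  differentiable f p -> 'd (- f) p d = - 'd f p d.
Proof. by move=> df; rewrite diffN. Qed.

(** At a boundary point only the half-line [r > 0] stays inside a manifold, so sign information is
    one-sided; differentiability turns it into a sign of the differential. *)
Lemma diff_right_ge0 (R : realType) (V : normedModType R) (f : V -> R) q d :
  differentiable f q -> f q = 0 ->
  (\forall r \near (0 : R)^'+, 0 <= f (r *: d + q)) -> 0 <= 'd f q d.
Proof.
move=> df f0 fge; rewrite -deriveE //.
have dv : derivable f q d by exact: diff_derivable.
rewrite /derive cvg_at_rightE //.
apply: limr_ge.
  apply/cvg_ex; move: dv => /cvg_ex [l lP]; exists l.
  apply: cvg_trans lP => A [e /= e0 eA].
  by exists e => //= y ye y0; apply: eA => //=; rewrite gt_eqF.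
near=> r; rewrite f0 subr0 mulr_ge0 //; first by rewrite invr_ge0 ltW.
by near: r.
Unshelve. all: by end_near. Qed.

Lemma diff_right_eq0 (R : realType) (V : normedModType R) n
  (f : V -> 'rV[R]_n) q d :
  differentiable f q -> f q = 0 ->
  (\forall r \near (0 : R)^'+, f (r *: d + q) = 0) -> 'd f q d = 0.
Proof.
move=> df f0 fE; apply/rowP => j; rewrite mxE -deriveE // derive_entry //.
have dfj := differentiable_entry j df.
rewrite deriveE //; apply/eqP; rewrite eq_le; apply/andP; split.
  have dN : differentiable (- (fun x => f x 0 j)) q by exact: differentiableN.
  have : 0 <= 'd (- (fun x => f x 0 j)) q d.
    apply: diff_right_ge0 => //; first by rewrite !fctE f0 mxE oppr0.
    by apply: filterS fE => r /= e; rewrite !fctE e mxE oppr0.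
  by rewrite (diff_oppE d dfj) oppr_ge0.
apply: diff_right_ge0 => //; first by rewrite f0 mxE.
by apply: filterS fE => r e; rewrite e mxE.
Qed.

Lemma diff_compE (R : realType) (V V' W : normedModType R) (f : V -> V')
    (g : V' -> W) (p w : V) :
  differentiable f p -> differentiable g (f p) ->
  'd (g \o f) p w = 'd g (f p) ('d f p w).
Proof. by move=> df dg; apply/esym/diff_comp_near => //; exact: nearW. Qed.

Lemma diff_entry_comp (R : realType) (V V' : normedModType R) n (f : V -> V')
    (g : V' -> 'rV[R]_n) (p w : V) j :
  differentiable f p -> differentiable g (f p) ->
  'd (fun q => g (f q) 0 j : R) p w = ('d g (f p) ('d f p w)) 0 j.
Proof.
move=> df dg; have dgf := differentiable_comp df dg.
rewrite -(diff_compE w df dg) -(deriveE w dgf) (derive_entry w j dgf) deriveE //.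
exact: (differentiable_entry j dgf).
Qed.

(** If [f] factors through [h] along a half-line only, its derivative in that direction still lies
    in the image of ['d h]. Later [f] is the inverse of an arbitrary straightening and [h] a
    parametrization of the manifold. *)
Lemma diff_right_comp (R : realType) (V W : normedModType R) n (f : V -> 'rV[R]_n)
    (g : 'rV[R]_n -> W) (h : W -> 'rV[R]_n) (p d : V) :
  differentiable f p -> differentiable g (f p) -> differentiable h (g (f p)) ->
  f p = h (g (f p)) ->
  (\forall r \near (0 : R)^'+, f (r *: d + p) = h (g (f (r *: d + p)))) ->
  'd f p d = 'd h (g (f p)) ('d g (f p) ('d f p d)).
Proof.
move=> df dg dh fp fr; have dgf := differentiable_comp df dg.
have dhgf := @differentiable_comp _ _ _ _ (g \o f) h p dgf dh.
rewrite -(diff_compE d df dg) -(@diff_compE _ _ _ _ (g \o f) h p d dgf dh).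
apply/eqP; rewrite -subr_eq0; apply/eqP.
have := @diff_right_eq0 _ _ _ (f - (h \o (g \o f))) p d.
move=> H; rewrite -(diff_subE d df dhgf); apply: H; first exact: differentiableB.
  by rewrite !fctE /= -fp subrr.
by apply: filterS fr => r e; rewrite !fctE /= -e subrr.
Qed.

Lemma open_preimage_in (T T' : topologicalType) (U : set T) (O : set T') (h : T -> T') :
  open U -> open O -> (forall x, U x -> {for x, continuous h}) ->
  open [set x | U x /\ O (h x)].
Proof.
move=> oU oO ch; rewrite openE => x [Ux Ox].
have nU : nbhs x U by exact: open_nbhs_nbhs.
have nO : nbhs x (h @^-1` O) by apply: (ch x Ux); exact: open_nbhs_nbhs.
exact: filterI nU nO.
Qed.

Lemma near_line (R : realType) (V : normedModType R) (A : set V) q d :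
  open A -> A q -> \forall r \near (0 : R)^'+, A (r *: d + q).
Proof.
move=> oA Aq.
have cl : {for 0, continuous (fun r : R => r *: d + q)}.
  by apply: continuousD; [exact: continuousZr_tmp|exact: cst_continuous].
have : nbhs (0 *: d + q) A by rewrite scale0r add0r; exact: open_nbhs_nbhs.
by move=> /cl /cvg_at_right_filter; exact.
Qed.

(** * Explicit straightenings; tangent vectors and boundary in a chart *)

Section Straight.
Variables (R : realType) (m K : nat) (le_mK : (m <= K)%N).
Hypothesis m_gt0 : (0 < m)%N.
Local Notation E := 'rV[R]_K.

Definition trim (x : E) : 'rV[R]_m := \row_i x 0 (widen_ord le_mK i).
Definition pad (a : 'rV[R]_m) : E :=
  \row_j (if insub (val j) : option 'I_m is Some i then a 0 i else 0).

Lemma padK a : trim (pad a) = a.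
Proof. by apply/rowP => i; rewrite !mxE /= valK. Qed.

Lemma trimD x y : trim (x + y) = trim x + trim y.
Proof. by apply/rowP => i; rewrite !mxE. Qed.

Lemma trimN x : trim (- x) = - trim x.
Proof. by apply/rowP => i; rewrite !mxE. Qed.

Lemma padN a : pad (- a) = - pad a.
Proof. by apply/rowP => i; rewrite !mxE; case: insub => [j|]; rewrite ?mxE ?oppr0. Qed.

Lemma pad_ge a (i : 'I_K) : (m <= i)%N -> pad a 0 i = 0.
Proof. by move=> mi; rewrite mxE insubF //= ltnNge mi. Qed.

Lemma pad_lt a (j : 'I_K) (i : 'I_m) : val j = val i -> pad a 0 j = a 0 i.
Proof. by move=> ji; rewrite mxE ji valK. Qed.

Lemma pad_trim (x : E) : (forall i : 'I_K, (m <= i)%N -> x 0 i = 0) -> pad (trim x) = x.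
Proof.
move=> x0; apply/rowP => i; rewrite mxE; case: insubP => [j _ ji|].
  by rewrite mxE; congr (x _ _); apply/val_inj.
by rewrite /= -leqNgt => /x0.
Qed.

Lemma Ck_trim k U : open U -> Ck k U trim.
Proof.
move=> oU; apply: Ck_row => // j; apply: Ck_eq (Ck_coord k (widen_ord le_mK j) oU) => //.
by move=> x _; rewrite mxE.
Qed.

Lemma Ck_pad k U : open U -> Ck k U pad.
Proof.
move=> oU; apply: Ck_row => // j.
case jE : (insub (val j) : option 'I_m) => [i|].
  by apply: Ck_eq (Ck_coord k i oU) => // x _; rewrite mxE jE.
by apply: Ck_eq (Ck_cst k U 0) => // x _; rewrite mxE jE.
Qed.

Lemma diff_pad a w : 'd pad a w = pad w.
Proof.
have cI : Ck 1 setT pad by apply: Ck_pad; exact: openT.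
rewrite -deriveE; last by case: cI => + _; exact.
apply: cvg_lim => //; apply: cvg_near_cst.
near=> h; have hn0 : h != 0 by near: h; exact: nbhs_dnbhs_neq.
apply/rowP => j; rewrite !mxE; case: insub => [i|]; last by rewrite subr0 mulr0.
by rewrite !mxE addrK mulrA mulVf // mul1r.
Unshelve. all: by end_near. Qed.

Definition first_ge0 (a : 'rV[R]_m) := forall i : 'I_m, i = 0%N :> nat -> 0 <= a 0 i.

(* The first [m] coordinates vanish on [M] and are ignored by [G]: this leaves
   room for a straightening that is explicit in terms of [F] and [G]. *)
Record chart (M : set E) (O : set 'rV[R]_m) (F : 'rV[R]_m -> E)
    (U : set E) (G : E -> 'rV[R]_m) : Prop := Chart {
  chart_open_dom : open O;
  chart_open_codom : open U;
  chart_smooth : smooth O F;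
  chart_inv_smooth : smooth U G;
  chart_trim : forall a, trim (F a) = 0;
  chart_shift : forall x y, U x -> U (x + pad y) /\ G (x + pad y) = G x;
  chart_maps : forall a, O a -> U (F a) /\ G (F a) = a;
  chart_first : forall a, O a -> (M (F a) <-> first_ge0 a);
  chart_inv_maps : forall x, U x -> M x -> O (G x) /\ x = F (G x) }.

Section OneChart.
Variables (M : set E) (O : set 'rV[R]_m) (F : 'rV[R]_m -> E)
  (U : set E) (G : E -> 'rV[R]_m).
Hypothesis cM : chart M O F U G.

Let oO := chart_open_dom cM.
Let oU := chart_open_codom cM.

(** The composite of two shears: [x |-> x + pad (G x)], inverted by subtraction because [G] ignores
    the first [m] coordinates, and [y |-> y - F (trim y)], inverted by addition because these
    coordinates of [F] vanish. At a point [F a] only [pad a] remains. *)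
Definition Phi (x : E) : E := x + pad (G x) - F (trim x + G x).
Definition Psi (b : E) : E := b + F (trim b) - pad (G (b + F (trim b))).
Definition domPhi : set E := [set x | U x /\ O (trim x + G x)].
Definition domPsi : set E := [set b | O (trim b) /\ U (b + F (trim b))].

Lemma openPhi : open domPhi.
Proof.
apply: open_preimage_in oU oO _ => x Ux; apply: (@continuousD _ _ _ trim G x).
  have cp : Ck 0 setT trim by apply: Ck_trim; exact: openT.
  exact: cp.
exact: smooth_continuous (chart_inv_smooth cM) Ux.
Qed.

Lemma smooth_Psi0 k (A : set E) : open A -> (forall b, A b -> O (trim b)) ->
  Ck k A (fun b => b + F (trim b)).
Proof.
move=> oA AO; apply: Ck_addrow => //; first exact: Ck_idrow.
exact: (Ck_comp oA oO AO (Ck_trim k oA) (chart_smooth cM k)).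
Qed.

Lemma open_trimO : open [set b : E | O (trim b)].
Proof.
have cp : Ck 0 setT trim by apply: Ck_trim; exact: openT.
rewrite (_ : [set b | _] = [set b | setT b /\ O (trim b)]); last first.
  by rewrite eqEsubset; split=> x //= [].
by apply: open_preimage_in => //; exact: openT.
Qed.

Lemma openPsi : open domPsi.
Proof.
apply: open_preimage_in open_trimO oU _.
move=> x Ox; exact: (smooth_Psi0 0 open_trimO (fun b H => H)).
Qed.

Lemma smooth_Phi : smooth domPhi Phi.
Proof.
move=> k; have oP := openPhi.
have cG : Ck k domPhi G by apply: Ck_sub (chart_inv_smooth cM k) => x [].
have cI : Ck k domPhi (pad \o G).
  exact: (Ck_comp oP (@openT _) (fun _ _ => I) cG (Ck_pad k (@openT _))).
have cS : Ck k domPhi (fun x => trim x + G x).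
  by apply: Ck_addrow => //; exact: Ck_trim.
have cF : Ck k domPhi (F \o (fun x => trim x + G x)).
  by apply: (Ck_comp oP oO _ cS (chart_smooth cM k)) => p [].
apply: Ck_addrow => //; last exact: Ck_opprow.
by apply: Ck_addrow => //; exact: Ck_idrow.
Qed.

Lemma smooth_Psi : smooth domPsi Psi.
Proof.
move=> k; have oP := openPsi.
have c0 : Ck k domPsi (fun b => b + F (trim b)).
  by apply: smooth_Psi0 => // b [].
have cG : Ck k domPsi (G \o (fun b => b + F (trim b))).
  by apply: (Ck_comp oP oU _ c0 (chart_inv_smooth cM k)) => p [].
apply: Ck_addrow => //; apply: Ck_opprow => //.
exact: (Ck_comp oP (@openT _) (fun _ _ => I) cG (Ck_pad k (@openT _))).
Qed.

Lemma G_shift x y : U x -> G (x - pad y) = G x.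
Proof. by move=> Ux; rewrite -padN; case: (chart_shift cM (- y) Ux). Qed.

Lemma U_shift x y : U x -> U (x - pad y).
Proof. by move=> Ux; rewrite -padN; case: (chart_shift cM (- y) Ux). Qed.

Lemma trim_Phi x : trim (Phi x) = trim x + G x.
Proof. by rewrite /Phi trimD trimN trimD padK (chart_trim cM) subr0. Qed.

Lemma PhiF a : O a -> Phi (F a) = pad a.
Proof.
move=> Oa; have [_ Ga] := chart_maps cM Oa.
by rewrite /Phi Ga (chart_trim cM) add0r addrAC subrr add0r.
Qed.

Lemma PsiI a : O a -> Psi (pad a) = F a.
Proof.
move=> Oa; have [Ua Ga] := chart_maps cM Oa.
rewrite /Psi padK [pad a + _]addrC; have [_ ->] := chart_shift cM a Ua.
by rewrite Ga addrK.
Qed.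

Lemma domPhiF a : O a -> domPhi (F a).
Proof.
move=> Oa; have [Ua Ga] := chart_maps cM Oa.
by split=> //=; rewrite Ga (chart_trim cM) add0r.
Qed.

Lemma Phi_maps x : domPhi x -> domPsi (Phi x) /\ Psi (Phi x) = x.
Proof.
move=> [Ux Ox]; have e : Phi x + F (trim (Phi x)) = x + pad (G x).
  by rewrite trim_Phi /Phi subrK.
have [Ux' Gx'] := chart_shift cM (G x) Ux.
split; first by split; rewrite /= ?e // trim_Phi.
by rewrite /Psi e Gx' addrK.
Qed.

Lemma Psi_maps b : domPsi b -> domPhi (Psi b) /\ Phi (Psi b) = b.
Proof.
move=> [Ob Ub]; have e : trim (Psi b) + G (Psi b) = trim b.
  by rewrite /Psi G_shift // trimD trimN trimD padK (chart_trim cM) addr0 subrK.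
split; first by split=> /=; rewrite ?e //; exact: U_shift.
by rewrite /Phi e /Psi G_shift // subrK addrK.
Qed.

Lemma chart_straightening a : O a ->
  straightening m M (F a) domPhi domPsi Phi Psi.
Proof.
move=> Oa; split; [exact: openPhi|exact: openPsi|exact: domPhiF|exact: smooth_Phi|
  exact: smooth_Psi|exact: Phi_maps|exact: Psi_maps|].
move=> x [Ux Ox]; split=> [Mx|[hx h0]].
  have [OG xE] := chart_inv_maps cM Ux Mx.
  rewrite xE PhiF //; split=> [i|i i0]; first exact: pad_ge.
  rewrite (@pad_lt _ _ (Ordinal m_gt0)) //.
  by apply: (chart_first cM OG).1; rewrite -?xE.
have [[Op _] e] := Phi_maps (conj Ux Ox).
rewrite -e -(pad_trim hx) PsiI //; apply/(chart_first cM Op) => i i0.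
by rewrite mxE h0.
Qed.

Lemma diff_Phi a w : O a -> 'd Phi (F a) ('d F a w) = pad w.
Proof.
move=> Oa; have dF := smooth_differentiable (chart_smooth cM) Oa.
have dP := smooth_differentiable smooth_Phi (domPhiF Oa).
rewrite (diff_comp_near (h := pad) w dF dP) ?diff_pad //.
by apply: filterS (open_nbhs_nbhs (conj oO Oa)) => q; exact: PhiF.
Qed.

(** For [d] pointing into the half-space, [psi (r *: d + phi p)] with small [r > 0] stays in [M] and
    so factors through [F]; linearity gives the opposite directions. This makes tangency independent
    of the straightening. *)
Lemma straightening_diff U' V' phi psi a (d : E) : O a -> M (F a) ->
  straightening m M (F a) U' V' phi psi ->
  (forall i : 'I_K, (m <= i)%N -> d 0 i = 0) ->
  exists w, 'd psi (phi (F a)) d = 'd F a w.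
Proof.
move=> Oa Ma S d0; set p := F a.
have [Ua Ga] := chart_maps cM Oa.
wlog dpos : d d0 / forall i : 'I_K, i = 0%N :> nat -> 0 <= d 0 i.
  move=> H; pose i0 := widen_ord le_mK (Ordinal m_gt0).
  have i0E (i : 'I_K) : i = 0%N :> nat -> i = i0 by move=> ?; exact/val_inj.
  have [dp|dn] := leP 0 (d 0 i0).
    by apply: (H d) => // i /i0E ->.
  have [w wE] : exists w, 'd psi (phi p) (- d) = 'd F a w.
    apply: H => i; first by rewrite mxE => /d0 ->; rewrite oppr0.
    by rewrite mxE => /i0E ->; rewrite oppr_ge0 ltW.
  by exists (- w); rewrite linearN -wE linearN opprK.
have [Vp psip] := straight_maps S (straight_at S).
have oV := straight_open_codom S.
have spsi := straight_inv_smooth S.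
have dpsi := smooth_differentiable spsi Vp.
have dF := smooth_differentiable (chart_smooth cM) Oa.
have dG := smooth_differentiable (chart_inv_smooth cM) Ua.
rewrite -/p in Vp psip dpsi dF dG *; rewrite -/p in Ga.
have GpE : G (psi (phi p)) = a by rewrite psip.
have dG' : differentiable G (psi (phi p)) by rewrite psip.
have dF' : differentiable F (G (psi (phi p))) by rewrite GpE.
exists ('d G (psi (phi p)) ('d psi (phi p) d)); rewrite -[in RHS]GpE.
apply: diff_right_comp => //; first by rewrite GpE psip.
near=> r; have r0 : 0 < r by near: r; exact: nbhs_right_gt.
have Vr : V' (r *: d + phi p) by near: r; exact: near_line.
have Ur : U (psi (r *: d + phi p)).
  suff : [set y | V' y /\ U (psi y)] (r *: d + phi p) by case.
  near: r; apply: near_line; last by split=> //; rewrite psip.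
  by apply: open_preimage_in => // y; exact: smooth_continuous.
have [Uc phic] := straight_inv_maps S Vr.
have [h1 h2] := (straight_half_space S (straight_at S)).1 Ma.
have Mr : M (psi (r *: d + phi p)).
  apply/(straight_half_space S Uc); rewrite phic; split=> i hi.
    by rewrite !mxE d0 // h1 // mulr0 addr0.
  by rewrite !mxE addr_ge0 ?h2 // mulr_ge0 ?dpos // ltW.
have [_ e] := chart_inv_maps cM Ur Mr.
by rewrite -e.
Unshelve. all: by end_near. Qed.

Lemma straightening_diffK p U' V' phi psi d :
  straightening m M p U' V' phi psi -> 'd phi p ('d psi (phi p) d) = d.
Proof.
move=> S; have [Vp psip] := straight_maps S (straight_at S).
have dpsi := smooth_differentiable (straight_inv_smooth S) Vp.
have dphi : differentiable phi (psi (phi p)).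
  by rewrite psip; exact: smooth_differentiable (straight_smooth S) (straight_at S).
rewrite -[X in 'd phi X]psip (diff_comp_near (h := id) d dpsi dphi) ?diff_idE //.
have := open_nbhs_nbhs (conj (straight_open_codom S) Vp).
by apply: filterS => q /(straight_inv_maps S) [].
Qed.

Lemma straightening_diffK' p U' V' phi psi v :
  straightening m M p U' V' phi psi -> 'd psi (phi p) ('d phi p v) = v.
Proof.
move=> S; have [Vp psip] := straight_maps S (straight_at S).
have dpsi := smooth_differentiable (straight_inv_smooth S) Vp.
have dphi := smooth_differentiable (straight_smooth S) (straight_at S).
rewrite (diff_comp_near (h := id) v dphi dpsi) ?diff_idE //.
have := open_nbhs_nbhs (conj (straight_open_dom S) (straight_at S)).
by apply: filterS => q /(straight_maps S) [].
Qed.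

Lemma chart_tangent a v : O a -> M (F a) ->
  tangent m M (F a) v <-> exists w, v = 'd F a w.
Proof.
move=> Oa Ma; split=> [[_ [U' [V' [phi [psi [S dv]]]]]]|[w ->]].
  have [w wE] := straightening_diff Oa Ma S dv.
  by exists w; rewrite -wE (straightening_diffK' _ S).
split=> //; exists domPhi, domPsi, Phi, Psi; split; first exact: chart_straightening.
by move=> i mi; rewrite diff_Phi // pad_ge.
Qed.

(** Where the first coordinate of [a] is positive, nearby values of [F] stay in [M]. If a
    straightening put [F a] on the boundary, its first coordinate along [F] would have a minimum at
    [a] and zero differential, although some direction is sent to the first unit vector. *)
Lemma chart_boundary a : O a -> first_ge0 a ->
  boundary m M (F a) <-> (forall i : 'I_m, i = 0%N :> nat -> a 0 i = 0).
Proof.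
move=> Oa a0; have Ma := (chart_first cM Oa).2 a0.
split=> [[_ [U' [V' [phi [psi [S phi0]]]]]] i i0|ai0]; last first.
  split=> //; exists domPhi, domPsi, Phi, Psi; split; first exact: chart_straightening.
  move=> i i0; rewrite PhiF // (@pad_lt _ _ (Ordinal m_gt0)) //; exact: ai0.
apply/eqP; rewrite eq_le a0 // andbT leNgt; apply/negP => ai.
pose j0 := widen_ord le_mK (Ordinal m_gt0).
have [w wE] : exists w, 'd psi (phi (F a)) (delta_mx 0 j0) = 'd F a w.
  apply: (straightening_diff Oa Ma S) => j mj; rewrite mxE /=.
  case: eqP => // e; move: mj; rewrite e /=; by rewrite leqNgt m_gt0.
have [Vp psip] := straight_maps S (straight_at S).
have dF := smooth_differentiable (chart_smooth cM) Oa.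
have dphi := smooth_differentiable (straight_smooth S) (straight_at S).
have dpF := differentiable_comp dF dphi.
pose h : 'rV[R]_m -> R := fun b => phi (F b) 0 j0.
have dh : differentiable h a by exact: (differentiable_entry j0 dpF).
have dhE w' : 'd h a w' = ('d phi (F a) ('d F a w')) 0 j0.
  exact: diff_entry_comp.
have hge w' : 0 <= 'd h a w'.
  apply: diff_right_ge0 => //; first by rewrite /h phi0.
  near=> r; rewrite /h.
  have Or : O (r *: w' + a) by near: r; exact: near_line.
  have Ur : U' (F (r *: w' + a)).
    suff : [set b | O b /\ U' (F b)] (r *: w' + a) by case.
    near: r; apply: near_line; last by split=> //; exact: straight_at S.
    apply: open_preimage_in => //; first exact: (straight_open_dom S).
    by move=> y; exact: smooth_continuous (chart_smooth cM).
  have ar : 0 < (r *: w' + a) 0 i.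
    suff : [set b : 'rV[R]_m | setT b /\ [set t : R | 0 < t] (b 0 i)] (r *: w' + a) by case.
    near: r; apply: near_line; last by split.
    apply: open_preimage_in; [exact: openT|exact: open_gt|].
    by move=> y _; exact: coord_continuous.
  have Mr : M (F (r *: w' + a)).
    apply/(chart_first cM Or) => k k0.
    by rewrite (_ : k = i) ?ltW //; apply/val_inj; rewrite /= k0 i0.
  by have [_] := (straight_half_space S Ur).1 Mr; apply.
have h0 : 'd h a w = 0.
  apply/eqP; rewrite eq_le hge andbT -oppr_ge0 -linearN; exact: hge.
move: h0; rewrite dhE -wE (straightening_diffK _ S) mxE !eqxx => /eqP.
by rewrite oner_eq0.
Unshelve. all: by end_near. Qed.

Lemma chart_outward a (w : 'rV[R]_m) : O a -> first_ge0 a ->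
  (forall i : 'I_m, i = 0%N :> nat -> a 0 i = 0 /\ w 0 i < 0) ->
  outward m M (F a) ('d F a w).
Proof.
move=> Oa a0 aw; have Ma := (chart_first cM Oa).2 a0.
split; first by apply/(chart_tangent _ Oa Ma); exists w.
have [az wz] := aw (Ordinal m_gt0) erefl.
exists domPhi, domPsi, Phi, Psi; split; first exact: chart_straightening.
  by move=> i i0; rewrite PhiF // (@pad_lt _ _ (Ordinal m_gt0)).
by move=> i i0; rewrite diff_Phi // (@pad_lt _ _ (Ordinal m_gt0)).
Qed.

(** [has_differential] allows any local extension [g] of [f]. Since [F] takes its values in [M],
    [g \o F] agrees with [H] near [a] whatever the extension. *)
Lemma chart_differential K' (f : E -> 'rV[R]_K') (H : 'rV[R]_m -> 'rV[R]_K') a w v :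
  O a -> (forall b, O b -> M (F b)) -> (forall b, O b -> f (F b) = H b) ->
  differentiable H a -> has_differential M f (F a) ('d F a w) v -> v = 'd H a w.
Proof.
move=> Oa MF fF dH [U' [g [[oU' Ua sg fg] ->]]].
have dF := smooth_differentiable (chart_smooth cM) Oa.
have dg := smooth_differentiable sg Ua.
have cF : {for a, continuous F} by exact: differentiable_continuous.
apply: diff_comp_near => //.
near=> b; have Ob : O b by near: b; exact: open_nbhs_nbhs.
rewrite -fF // fg //; last exact: MF.
by near: b; exact: (cF _ (open_nbhs_nbhs (conj oU' Ua))).
Unshelve. all: by end_near. Qed.

End OneChart.
End Straight.

(** * The models and their embedding *)

(* Points of the cover have coordinates [(s, p1, p2, tau)]. *)
Local Notation o0 := (@Ordinal 4 0 isT).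
Local Notation o1 := (@Ordinal 4 1 isT).
Local Notation o2 := (@Ordinal 4 2 isT).
Local Notation o3 := (@Ordinal 4 3 isT).
Local Notation sc b := (b 0 o0).
Local Notation p1 b := (b 0 o1).
Local Notation p2 b := (b 0 o2).
Local Notation tc b := (b 0 o3).
Local Notation y0 := (@Ordinal 3 0 isT).
Local Notation y1 := (@Ordinal 3 1 isT).
Local Notation y2 := (@Ordinal 3 2 isT).

Section Golden.
Variable R : realType.

Definition golden : R := (1 + Num.sqrt 5) / 2.

Lemma golden_sq : golden ^+ 2 = golden + 1.
Proof.
have := sqr_sqrtr (ler0n R 5); rewrite /golden; set r := Num.sqrt _ => r2.
rewrite (_ : _ ^+ 2 = (1 + 2 * r + r ^+ 2) / 4); last by field.
by rewrite r2; field.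
Qed.

Lemma golden_gt1 : 1 < golden.
Proof.
have : 1 < Num.sqrt 5 :> R by rewrite -[X in X < _]sqrtr1 ltr_sqrt // ltr1n.
by rewrite /golden; lra.
Qed.

Lemma golden_gt0 : 0 < golden.
Proof. exact: lt_trans golden_gt1. Qed.

Lemma golden_inv : golden^-1 = golden - 1.
Proof.
have g0 : golden != 0 by rewrite gt_eqF // golden_gt0.
by apply: (mulfI g0); rewrite divff // mulrBr -expr2 golden_sq; ring.
Qed.

Definition growth : R := ln golden.

Lemma growth_gt0 : 0 < growth.
Proof. exact/ln_gt0/golden_gt1. Qed.

Lemma expR_growth : expR growth = golden.
Proof. by apply: lnK; rewrite posrE golden_gt0. Qed.

End Golden.

Section Model.
Variable R : realType.

(* The first four coordinates vanish on the models (see [chart]).  The others are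
   indexed by a label [j], a patch [i] of the circle of values of [tau] modulo
   [1], and the entry of [vec] below: the block [(j, i)] of a point is [vec]
   multiplied by a bump function of [tau] supported in the patch [i]. *)
Notation index := (bool * bool * 'I_11)%type.
Definition ambient := (4 + #|{: index}|)%N.
Local Notation E := 'rV[R]_ambient.
Local Notation C4 := 'rV[R]_4.
Local Notation golden := (golden R).
Local Notation growth := (growth R).

Definition crd (x : E) (j i : bool) (n : nat) : R :=
  if (insub n : option 'I_11) is Some c
  then x 0 (rshift 4 (enum_rank ((j, i, c) : index))) else 0.

Definition mkE (f : bool -> bool -> nat -> R) : E :=
  row_mx 0 (\row_k let: (j, i, c) := (enum_val k : index) in f j i (val c)).

Lemma crd_mkE f j i n : (n < 11)%N -> crd (mkE f) j i n = f j i n.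
Proof. by move=> n11; rewrite /crd /mkE insubT row_mxEr mxE enum_rankK. Qed.

Lemma eq_mkE f f' : (forall j i n, (n < 11)%N -> f j i n = f' j i n) -> mkE f = mkE f'.
Proof.
move=> ff'; congr row_mx; apply/rowP => k; rewrite !mxE.
by case: (enum_val k) => -[j i] c; apply: ff'; exact: ltn_ord.
Qed.

Lemma crdD x y j i n : crd (x + y) j i n = crd x j i n + crd y j i n.
Proof. by rewrite /crd; case: insub => [c|]; rewrite ?mxE ?addr0. Qed.

Lemma crdZ a x j i n : crd (a *: x) j i n = a * crd x j i n.
Proof. by rewrite /crd; case: insub => [c|]; rewrite ?mxE ?mulr0. Qed.

Lemma crd_pad m (a : 'rV[R]_m) j i n : (m <= 4)%N -> crd (pad ambient a : E) j i n = 0.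
Proof.
move=> m4; rewrite /crd; case: insub => [c|] //.
by rewrite pad_ge // (leq_trans m4) //= leq_addr.
Qed.

Lemma trim_mkE m (le : (m <= ambient)%N) f : (m <= 4)%N -> trim le (mkE f) = 0.
Proof.
move=> m4; apply/rowP => k; rewrite !mxE.
case: splitP => [a _|a /= e]; first by rewrite mxE.
by have := leq_trans (ltn_ord k) m4; rewrite e ltnNge leq_addr.
Qed.

Lemma Ck_crd k U j i n : open U -> Ck k U (fun x : E => crd x j i n).
Proof.
move=> oU; rewrite /crd; case: insub => [c|]; first exact: Ck_coord.
exact: Ck_cst.
Qed.

Lemma continuous_crd j i n : continuous (fun x : E => crd x j i n).
Proof. by move=> x; have := @Ck_crd 0 setT j i n (@openT _); exact. Qed.

Lemma Ck_mkE (V : normedModType R) k (U : set V) (f : V -> bool -> bool -> nat -> R) :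
  open U -> (forall j i n, Ck k U (fun b => f b j i n)) ->
  Ck k U (fun b => mkE (f b)).
Proof.
move=> oU cf; apply: Ck_row => // c.
case: (splitP c) => [a ca|a ca].
  apply: Ck_eq (Ck_cst k U 0) => // x _.
  by rewrite (_ : c = lshift _ a) ?row_mxEl ?mxE //; exact/val_inj.
case iE : (enum_val a) => [[j i] n].
apply: Ck_eq (cf j i n) => // x _.
by rewrite (_ : c = rshift _ a) ?row_mxEr ?mxE ?iE //; exact/val_inj.
Qed.

Definition mk4 (s p1 p2 t : R) : C4 := \row_(k < 4) nth 0 [:: s; p1; p2; t] k.

Lemma mk4E s q1 q2 t : (mk4 s q1 q2 t 0 o0 = s) * (mk4 s q1 q2 t 0 o1 = q1) *
  (mk4 s q1 q2 t 0 o2 = q2) * (mk4 s q1 q2 t 0 o3 = t).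
Proof. by rewrite !mxE. Qed.

Lemma mk4K (b : C4) : mk4 (sc b) (p1 b) (p2 b) (tc b) = b.
Proof.
apply/rowP => -[[|[|[|[|k]]]] lt] //; rewrite mxE /=; congr (b _ _); exact/val_inj.
Qed.

(* The deck transformation of the mapping torus: [(p1, p2) |-> (p1 + p2, p1)]
   has eigenvalues [golden] and [- golden^-1]. *)
Definition deck (b : C4) : C4 := mk4 (- sc b) (p1 b + p2 b) (p1 b) (tc b - 1).
Definition deckV (b : C4) : C4 := mk4 (- sc b) (p2 b) (p1 b - p2 b) (tc b + 1).

Lemma deckK : cancel deck deckV.
Proof.
move=> b; rewrite -[RHS]mk4K /deckV /deck !mk4E; congr mk4; ring.
Qed.

Lemma deckVK : cancel deckV deck.
Proof.
move=> b; rewrite -[RHS]mk4K /deckV /deck !mk4E; congr mk4; ring.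
Qed.

(* The Liouville form is [cft1 dp1 + cft2 dp2]. *)
Definition cft1 (b : C4) : R :=
  golden * expR (growth * tc b) - sc b * golden^-1 * expR (- (growth * tc b)).
Definition cft2 (b : C4) : R :=
  expR (growth * tc b) + sc b * expR (- (growth * tc b)).

(** The entries before index 7 recover the point on a patch. The last four put the coefficients of
    the form next to the circle coordinates, which is what allows an ambient form with linear
    coefficients. *)
Definition vec (b : C4) : seq R :=
  [:: 1; tc b; sc b; cos (p1 b); sin (p1 b); cos (p2 b); sin (p2 b);
      cft1 b * cos (p1 b); cft1 b * sin (p1 b);
      cft2 b * cos (p2 b); cft2 b * sin (p2 b)].

Definition offset (i : bool) : R := if i then 1 / 2 else 0.

Definition blk (i : bool) (n : nat) (b : C4) : R :=
  cutoff (tc b + offset i) * (vec b)`_n.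

Lemma offset_bd i : 0 <= offset i <= 1 / 2.
Proof. by rewrite /offset; case: i; lra. Qed.

Definition window i (b : C4) := 0 < tc b + offset i < 1.

Lemma blk_out i n b : ~ window i b -> blk i n b = 0.
Proof. by move=> /negP w; rewrite /blk cutoff_out ?mul0r. Qed.

(* [deck] identifies [(j, b)] with [(j (+) g, deck b)]. Three terms of the orbit
   are enough for [tc b] near [[0, 1]], since the patches have length [1]. *)
Definition Fblk (g j : bool) (b : C4) (j' i : bool) (n : nat) : R :=
  (j' == j)%:R * blk i n b +
  (j' == j (+) g)%:R * (blk i n (deck b) + blk i n (deckV b)).

Definition F (g j : bool) (b : C4) : E := mkE (Fblk g j b).

(** Passing from [b] to [deck b] loses the term of [deckV b] and gains that of [deck (deck b)]; in
    this range of [tau] both lie outside every window. *)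
Lemma F_deck g j (b : C4) : 0 <= tc b <= 3 / 2 -> F g (j (+) g) (deck b) = F g j b.
Proof.
move=> tb; apply: eq_mkE => j' i n _; rewrite /Fblk deckK addbK.
have sb := offset_bd i.
rewrite [blk i n (deck (deck b))]blk_out; last by rewrite /window !mk4E; lra.
rewrite [blk i n (deckV b)]blk_out; last by rewrite /window !mk4E; lra.
by rewrite add0r addr0 addrC.
Qed.

Lemma F_deckV g j (b : C4) : -1 <= tc b <= 1 / 2 -> F g (j (+) g) (deckV b) = F g j b.
Proof.
move=> tb; rewrite -{2}(addbK g j) -{2}(deckVK b) F_deck //.
by rewrite !mk4E; lra.
Qed.

Lemma Fblk_window g j b j' i n : window i b ->
  Fblk g j b j' i n = (j' == j)%:R * blk i n b.
Proof.
rewrite /window => wb; rewrite /Fblk.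
rewrite [blk i n (deck b)]blk_out; last by rewrite /window !mk4E; lra.
rewrite [blk i n (deckV b)]blk_out; last by rewrite /window !mk4E; lra.
by rewrite addr0 mulr0 addr0.
Qed.

Lemma crd_F g j b i n : window i b -> (n < 11)%N -> crd (F g j b) j i n = blk i n b.
Proof. by move=> wb n11; rewrite crd_mkE // Fblk_window // eqxx mul1r. Qed.

Lemma blk_ext i n (b b' : C4) : sc b = sc b' -> tc b = tc b' ->
  cos (p1 b) = cos (p1 b') -> sin (p1 b) = sin (p1 b') ->
  cos (p2 b) = cos (p2 b') -> sin (p2 b) = sin (p2 b') -> blk i n b = blk i n b'.
Proof.
by move=> es et c1 s1 c2 s2; rewrite /blk /vec /cft1 /cft2 es et c1 s1 c2 s2.
Qed.

Lemma F_ext g j (b b' : C4) : sc b = sc b' -> tc b = tc b' ->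
  cos (p1 b) = cos (p1 b') -> sin (p1 b) = sin (p1 b') ->
  cos (p2 b) = cos (p2 b') -> sin (p2 b) = sin (p2 b') -> F g j b = F g j b'.
Proof.
move=> es et c1 s1 c2 s2; apply: eq_mkE => j' i n _; rewrite /Fblk.
rewrite (@blk_ext i n b b') // (@blk_ext i n (deck b) (deck b')); first last.
- by rewrite !mk4E.
- by rewrite !mk4E.
- by rewrite !mk4E !sinD c1 s1 c2 s2.
- by rewrite !mk4E !cosD c1 s1 c2 s2.
- by rewrite !mk4E et.
- by rewrite !mk4E es.
rewrite (@blk_ext i n (deckV b) (deckV b')) //.
- by rewrite !mk4E es.
- by rewrite !mk4E et.
- by rewrite !mk4E.
- by rewrite !mk4E.
- by rewrite !mk4E !cosB c1 s1 c2 s2.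
- by rewrite !mk4E !sinB c1 s1 c2 s2.
Qed.

Definition W (g : bool) : set E :=
  [set x | exists j b, [/\ x = F g j b, sc b ^+ 2 <= 1 & 0 <= tc b <= 1]].

Lemma W_window g j i b : window i b -> sc b ^+ 2 <= 1 -> W g (F g j b).
Proof.
rewrite /window => wb sb; have := offset_bd i => hi.
have [t0|t0] := leP 0 (tc b); first by exists j, b; split=> //; lra.
exists (j (+) g), (deckV b); split; first by rewrite F_deckV //; lra.
  by rewrite !mk4E sqrrN.
by rewrite !mk4E; lra.
Qed.

(** The entry of index 0 is the bump itself. Its positivity tells which term of the orbit is active
    on the block, hence which representative and label to take. *)
Lemma W_repr g j i x : W g x -> 0 < crd x j i 0 ->
  exists b, [/\ x = F g j b, window i b & sc b ^+ 2 <= 1].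
Proof.
move=> [j' [b [-> sb tb]]]; rewrite crd_mkE // /Fblk.
have := offset_bd i => hi; rewrite [blk i 0 (deckV b)]blk_out; last first.
  by rewrite /window !mk4E; lra.
rewrite addr0 => c0.
have [wb|nwb] := pselect (window i b).
  exists b; split=> //; move: c0; rewrite (@blk_out _ _ (deck b)).
    rewrite mulr0 addr0; case: eqVneq => [<- //|_]; by rewrite mul0r ltxx.
  by move: wb; rewrite /window !mk4E; lra.
have [wd|nwd] := pselect (window i (deck b)).
  exists (deck b); split=> //; last by rewrite !mk4E sqrrN.
  move: c0; rewrite (blk_out _ nwb) mulr0 add0r; case: eqVneq => [-> _|_].
    by rewrite F_deck //; lra.
  by rewrite mul0r ltxx.
by move: c0; rewrite (blk_out _ nwb) (blk_out _ nwd) !mulr0 addr0 ltxx.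
Qed.

Lemma W_patch g x : W g x -> exists j i b, [/\ x = F g j b, window i b & sc b ^+ 2 <= 1].
Proof.
move=> [j [b [-> sb tb]]].
have [t0|t0] := ltP 0 (tc b); last first.
  by exists j, true, b; split=> //; rewrite /window /offset; lra.
have [t1|t1] := ltP (tc b) 1.
  by exists j, false, b; split=> //; rewrite /window /offset; lra.
exists (j (+) g), true, (deck b); rewrite F_deck //; last lra.
by rewrite /window !mk4E sqrrN /offset; split=> //; lra.
Qed.

(** The argument of [(c, s)] nearest to [p], smooth on the half-plane of vectors with positive
    component in the direction of angle [p]. It does not depend on the length of [(c, s)], so a bump
    factor does no harm. *)
Definition angle (c s p : R) : R :=
  p + atan ((s * cos p - c * sin p) / (c * cos p + s * sin p)).

Lemma angle_cos_sin k q p : 0 < k -> 0 < cos (q - p) ->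
  cos (angle (k * cos q) (k * sin q) p) = cos q /\
  sin (angle (k * cos q) (k * sin q) p) = sin q.
Proof.
move=> k0 c0; rewrite /angle.
have -> : (k * sin q * cos p - k * cos q * sin p) /
    (k * cos q * cos p + k * sin q * sin p) = tan (q - p).
  have -> : k * sin q * cos p - k * cos q * sin p = k * sin (q - p).
    by rewrite sinB; ring.
  have -> : k * cos q * cos p + k * sin q * sin p = k * cos (q - p).
    by rewrite cosB; ring.
  by rewrite -mulf_div divff ?mul1r // gt_eqF.
set d := q - p; have -> : q = p + d by rewrite /d addrC subrK.
set a := atan (tan d).
have ca : 0 < cos a by apply: cos_gt0_pihalf; rewrite atan_gtNpi2 atan_ltpi2.
have ta : tan a = tan d by rewrite /a atanK.
have cn : cos a != 0 by rewrite gt_eqF.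
have dn : cos d != 0 by rewrite gt_eqF.
have cc : cos a = cos d.
  apply/eqP; rewrite -(eqrXn2 (n := 2)) ?ltW //.
  have := cos2_tan2 cn; have := cos2_tan2 dn; rewrite ta => <- /eqP.
  by move=> /eqP /invr_inj ->.
have ss : sin a = sin d.
  by move: ta; rewrite /tan cc => /(mulIf (invr_neq0 dn)).
by rewrite cosD sinD cc ss -cosD -sinD.
Qed.

Lemma angle_near k q p : 0 < k -> `|q - p| < pi / 2 ->
  angle (k * cos q) (k * sin q) p = q.
Proof.
move=> k0; rewrite ltr_norml => /andP[q1 q2].
have c0 : 0 < cos (q - p) by apply: cos_gt0_pihalf; rewrite q1 q2.
rewrite /angle.
have -> : (k * sin q * cos p - k * cos q * sin p) /
    (k * cos q * cos p + k * sin q * sin p) = tan (q - p).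
  have -> : k * sin q * cos p - k * cos q * sin p = k * sin (q - p).
    by rewrite sinB; ring.
  have -> : k * cos q * cos p + k * sin q * sin p = k * cos (q - p).
    by rewrite cosB; ring.
  by rewrite -mulf_div divff ?mul1r // gt_eqF.
by rewrite tanK ?in_itv /= ?q1 ?q2 // addrC subrK.
Qed.

Definition Gb (j i : bool) (q1 q2 : R) (x : E) : C4 :=
  mk4 (crd x j i 2 / crd x j i 0) (angle (crd x j i 3) (crd x j i 4) q1)
    (angle (crd x j i 5) (crd x j i 6) q2) (crd x j i 1 / crd x j i 0).

Definition Ub (j i : bool) (q1 q2 : R) : set E :=
  [set x | [/\ 0 < crd x j i 0, 0 < crd x j i 3 * cos q1 + crd x j i 4 * sin q1 &
            0 < crd x j i 5 * cos q2 + crd x j i 6 * sin q2]].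

Definition Ob (i : bool) (q1 q2 : R) : set C4 :=
  [set b | [/\ window i b, `|p1 b - q1| < pi / 2 & `|p2 b - q2| < pi / 2]].

Lemma open_Ub j i q1 q2 : open (Ub j i q1 q2).
Proof.
have op (f : E -> R) : continuous f -> open [set x | 0 < f x].
  move=> cf; apply: (@open_comp _ _ f [set r : R | 0 < r]) => [x _|]; first exact: cf.
  exact: open_gt.
rewrite (_ : Ub j i q1 q2 = [set x | 0 < crd x j i 0] `&`
   ([set x | 0 < crd x j i 3 * cos q1 + crd x j i 4 * sin q1] `&`
    [set x | 0 < crd x j i 5 * cos q2 + crd x j i 6 * sin q2])); last first.
  by rewrite eqEsubset; split=> x; [case|case=> ? []].
have cl n m (a c : R) : continuous (fun x => crd x j i n * a + crd x j i m * c).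
  move=> x; apply: (@continuousD _ _ _ (fun x => crd x j i n * a) (fun x => crd x j i m * c)).
    exact: continuousM (@continuous_crd j i n x) (@cst_continuous _ _ _ _).
  exact: continuousM (@continuous_crd j i m x) (@cst_continuous _ _ _ _).
apply: openI; first exact/op/continuous_crd.
by apply: openI; apply/op/cl.
Qed.

Lemma open_Ob i q1 q2 : open (Ob i q1 q2).
Proof.
have op (f : C4 -> R) (A : set R) : continuous f -> open A -> open [set x | A (f x)].
  by move=> cf oA; apply: (@open_comp _ _ f A) => // x _; exact: cf.
rewrite (_ : Ob i q1 q2 = [set b | `]- offset i, 1 - offset i[%classic (tc b)] `&`
  ([set b | `]q1 - pi / 2, q1 + pi / 2[%classic (p1 b)] `&`
   [set b | `]q2 - pi / 2, q2 + pi / 2[%classic (p2 b)])).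
  apply: openI; first by apply: op; [exact: coord_continuous|exact: itv_open].
  by apply: openI; apply: op; [exact: coord_continuous|exact: itv_open|
     exact: coord_continuous|exact: itv_open].
rewrite eqEsubset; split=> b; rewrite /Ob /window /= !in_itv /= !ltr_norml.
  by case=> /andP[? ?] /andP[? ?] /andP[? ?]; do !split; lra.
by case=> /andP[? ?] [/andP[? ?] /andP[? ?]]; split; lra.
Qed.

Lemma cutoff_window i b : window i b -> 0 < cutoff (tc b + offset i).
Proof. exact: cutoff_gt0. Qed.

Lemma blkE i b : (blk i 0 b = cutoff (tc b + offset i)) *
  (blk i 1 b = cutoff (tc b + offset i) * tc b) * (blk i 2 b = cutoff (tc b + offset i) * sc b) *
  (blk i 3 b = cutoff (tc b + offset i) * cos (p1 b)) *
  (blk i 4 b = cutoff (tc b + offset i) * sin (p1 b)) *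
  (blk i 5 b = cutoff (tc b + offset i) * cos (p2 b)) *
  (blk i 6 b = cutoff (tc b + offset i) * sin (p2 b)).
Proof. by rewrite /blk /= mulr1. Qed.

Lemma F_maps g j i q1 q2 b : Ob i q1 q2 b ->
  Ub j i q1 q2 (F g j b) /\ Gb j i q1 q2 (F g j b) = b.
Proof.
move=> [wb d1 d2]; have k0 := cutoff_window wb.
have cp (q p : R) : `|p - q| < pi / 2 -> 0 < cos (p - q).
  by rewrite ltr_norml => /andP[? ?]; apply: cos_gt0_pihalf; apply/andP.
split.
  by split; rewrite !crd_F // !blkE // -!mulrA -mulrDr -cosB mulr_gt0 // cp.
rewrite /Gb !crd_F // !blkE !angle_near // -[RHS]mk4K.
by congr mk4; rewrite mulrC mulKf // gt_eqF.
Qed.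

(** The angles of [b] may be far from [q1] and [q2]; they come back modulo [2 * pi], a change that
    [F] does not see. *)
Lemma Gb_inv g j i q1 q2 b : window i b -> Ub j i q1 q2 (F g j b) ->
  [/\ sc (Gb j i q1 q2 (F g j b)) = sc b, tc (Gb j i q1 q2 (F g j b)) = tc b,
   Ob i q1 q2 (Gb j i q1 q2 (F g j b)) & F g j (Gb j i q1 q2 (F g j b)) = F g j b].
Proof.
move=> wb [_]; rewrite !crd_F // !blkE // => c1 c2; have k0 := cutoff_window wb.
have kn : cutoff (tc b + offset i) != 0 by rewrite gt_eqF.
move: c1; rewrite -!mulrA -mulrDr -cosB pmulr_rgt0 // => c1.
move: c2; rewrite -!mulrA -mulrDr -cosB pmulr_rgt0 // => c2.
have [C1 S1] := angle_cos_sin k0 c1; have [C2 S2] := angle_cos_sin k0 c2.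
have es : sc (Gb j i q1 q2 (F g j b)) = sc b.
  by rewrite !mk4E !crd_F // !blkE mulrC mulKf.
have et : tc (Gb j i q1 q2 (F g j b)) = tc b.
  by rewrite !mk4E !crd_F // !blkE mulrC mulKf.
have na (c s q : R) : `|angle c s q - q| < pi / 2.
  by rewrite /angle addrC addKr ltr_norml atan_gtNpi2 atan_ltpi2.
split=> //; first by split; rewrite ?/window ?et // !mk4E.
by apply: F_ext => //; rewrite !mk4E !crd_F // !blkE.
Qed.

End Model.

#[local] Opaque cutoff mk4.

(** * The differential of the embedding and the Liouville form *)

Section ModelForms.
Variable R : realType.

Local Notation E := 'rV[R]_ambient.
Local Notation C4 := 'rV[R]_4.
Local Notation golden := (golden R).
Local Notation growth := (growth R).

Definition dcut (x : R) : R := 'D_1 (@cutoff R) x.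

Lemma cutoff_diff (x : R) : differentiable (@cutoff R) x.
Proof. by case: (@Ck_cutoff R 1) => h _; exact: h. Qed.

Lemma is_derive_cutoff (x : R) : is_derive x (1 : R) (@cutoff R) (dcut x).
Proof. exact/derivableP/diff_derivable/cutoff_diff. Qed.

Lemma cutoff_ge0 (x : R) : 0 <= cutoff x.
Proof.
by case: (boolP (0 < x < 1)) => [/cutoff_gt0/ltW //|/cutoff_out ->].
Qed.

(** A zero of the nonnegative [cutoff] is a minimum, so the differential there is nonnegative in
    every direction and hence zero. The endpoints 0 and 1 are covered. *)
Lemma dcut_out (x : R) : ~ (0 < x < 1) -> dcut x = 0.
Proof.
move=> /negP /cutoff_out c0; rewrite /dcut deriveE; last exact: cutoff_diff.
have ge (d : R) : 0 <= 'd (@cutoff R) x d.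
  apply: diff_right_ge0 => //; first exact: cutoff_diff.
  by apply: nearW => r; exact: cutoff_ge0.
by apply/eqP; rewrite eq_le ge andbT -oppr_ge0 -linearN; exact: ge.
Qed.

Definition dcft1 (b w : C4) : R :=
  golden * (growth * tc w * expR (growth * tc b))
  - golden^-1 * (sc w - sc b * growth * tc w) * expR (- (growth * tc b)).
Definition dcft2 (b w : C4) : R :=
  growth * tc w * expR (growth * tc b)
  + (sc w - sc b * growth * tc w) * expR (- (growth * tc b)).

Definition dvec (b w : C4) : seq R :=
  [:: 0; tc w; sc w; - sin (p1 b) * p1 w; cos (p1 b) * p1 w;
      - sin (p2 b) * p2 w; cos (p2 b) * p2 w;
      dcft1 b w * cos (p1 b) - cft1 b * (sin (p1 b) * p1 w);
      dcft1 b w * sin (p1 b) + cft1 b * (cos (p1 b) * p1 w);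
      dcft2 b w * cos (p2 b) - cft2 b * (sin (p2 b) * p2 w);
      dcft2 b w * sin (p2 b) + cft2 b * (cos (p2 b) * p2 w)].

Definition dblk (i : bool) (n : nat) (b w : C4) : R :=
  dcut (tc b + offset R i) * tc w * (vec b)`_n + cutoff (tc b + offset R i) * (dvec b w)`_n.

Definition ldeck (w : C4) : C4 := mk4 (- sc w) (p1 w + p2 w) (p1 w) (tc w).
Definition ldeckV (w : C4) : C4 := mk4 (- sc w) (p2 w) (p1 w - p2 w) (tc w).

Definition dFblk (g j : bool) (b w : C4) (j' i : bool) (n : nat) : R :=
  (j' == j)%:R * dblk i n b w +
  (j' == j (+) g)%:R * (dblk i n (deck b) (ldeck w) + dblk i n (deckV b) (ldeckV w)).

Definition dF (g j : bool) (b w : C4) : E := mkE (dFblk g j b w).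

Let oT (V : topologicalType) : open [set: V]. Proof. exact: openT. Qed.

Lemma Ck_coordT k (j : 'I_4) : Ck k setT (fun b : C4 => b 0 j : R).
Proof. by apply: Ck_coord; exact: openT. Qed.

Lemma Ck_cft k : Ck k setT (@cft1 R) /\ Ck k setT (@cft2 R).
Proof.
have cg : Ck k setT (fun b : C4 => growth * tc b).
  by apply: Ck_mul => //; [exact: Ck_cst|exact: Ck_coordT].
have cN : Ck k setT (fun b : C4 => - (growth * tc b)) by exact: Ck_opp.
have ce : Ck k setT (fun b : C4 => expR (growth * tc b)).
  exact: (Ck_comp1 (@oT _) (fun _ _ => I) cg (Ck_expR k (@oT _))).
have ceN : Ck k setT (fun b : C4 => expR (- (growth * tc b))).
  exact: (Ck_comp1 (@oT _) (fun _ _ => I) cN (Ck_expR k (@oT _))).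
split; apply: Ck_add => //.
- by apply: Ck_mul => //; exact: Ck_cst.
- apply: Ck_opp => //; apply: Ck_mul => //; apply: Ck_mul => //.
    exact: Ck_coordT.
  exact: Ck_cst.
- by apply: Ck_mul => //; exact: Ck_coordT.
Qed.

Lemma Ck_trig k (j : 'I_4) : Ck k setT (fun b : C4 => cos (b 0 j)) /\
  Ck k setT (fun b : C4 => sin (b 0 j)).
Proof.
have [cc cs] := @Ck_cos_sin R k setT (@oT _).
by split; [exact: (Ck_comp1 (@oT _) (fun _ _ => I) (Ck_coordT k j) cc)|
  exact: (Ck_comp1 (@oT _) (fun _ _ => I) (Ck_coordT k j) cs)].
Qed.

Lemma Ck_vec k n : Ck k setT (fun b : C4 => (vec b)`_n).
Proof.
have [c1 c2] := Ck_cft k.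
have [cp1 sp1] := Ck_trig k o1; have [cp2 sp2] := Ck_trig k o2.
by do 11! [case: n => [|n]; first by [exact: Ck_cst|exact: Ck_coordT| exact: Ck_mul|]];
  rewrite /= nth_nil; exact: Ck_cst.
Qed.

Lemma Ck_blk k i n : Ck k setT (@blk R i n).
Proof.
have co : Ck k setT (fun b : C4 => tc b + offset R i).
  by apply: Ck_add => //; [exact: Ck_coordT|exact: Ck_cst].
apply: Ck_mul => //; last exact: Ck_vec.
exact: (Ck_comp1 (@oT _) (fun _ _ => I) co (@Ck_cutoff R k)).
Qed.

Lemma Ck_mk4 (V : normedModType R) k (U : set V) (s q1 q2 t : V -> R) : open U ->
  Ck k U s -> Ck k U q1 -> Ck k U q2 -> Ck k U t ->
  Ck k U (fun b => mk4 (s b) (q1 b) (q2 b) (t b)).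
Proof.
move=> oU cs c1 c2 ct; apply: Ck_row => // -[[|[|[|[|j]]]] lt] //.
- apply: Ck_eq cs => // x _.
  by rewrite (_ : Ordinal lt = o0) ?mk4E //; exact/val_inj.
- apply: Ck_eq c1 => // x _.
  by rewrite (_ : Ordinal lt = o1) ?mk4E //; exact/val_inj.
- apply: Ck_eq c2 => // x _.
  by rewrite (_ : Ordinal lt = o2) ?mk4E //; exact/val_inj.
- apply: Ck_eq ct => // x _.
  by rewrite (_ : Ordinal lt = o3) ?mk4E //; exact/val_inj.
Qed.

Lemma Ck_deck k : Ck k setT (@deck R) /\ Ck k setT (@deckV R).
Proof.
have c := Ck_coordT k.
split; apply: Ck_mk4 => //; try exact: Ck_opp; try (apply: Ck_add => //; try exact: Ck_cst).
exact: Ck_opp.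
Qed.

Lemma diff_affine (V W : normedModType R) (f : V -> W) (b w : V) (v : W) :
  differentiable f b ->
  (forall h : R, f (h *: w + b) - f b = h *: v) -> 'd f b w = v.
Proof.
move=> df fE; rewrite -deriveE //; apply: cvg_lim => //; apply: cvg_near_cst.
near=> h; have hn0 : h != 0 by near: h; exact: nbhs_dnbhs_neq.
by rewrite /= fE scalerA mulVf // scale1r.
Unshelve. all: by end_near. Qed.

Lemma deck_diff b : differentiable (@deck R) b /\ differentiable (@deckV R) b.
Proof. by have [[d1 _] [d2 _]] := Ck_deck 1; split; [exact: d1|exact: d2]. Qed.

Lemma diff_deck b w : 'd (@deck R) b w = ldeck w /\ 'd (@deckV R) b w = ldeckV w.
Proof.
have [d1 d2] := deck_diff b.
split; apply: diff_affine => // h; apply/rowP => -[[|[|[|[|j]]]] lt] //;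
  rewrite !mxE /= ?mxE; ring.
Qed.

Lemma is_derive_coord (b w : C4) (j : 'I_4) : is_derive b w (fun x : C4 => x 0 j : R) (w 0 j).
Proof.
have dc : differentiable (fun x : C4 => x 0 j : R) b by exact: differentiable_coord.
apply: DeriveDef; first exact: diff_derivable.
by rewrite deriveE //; apply: diff_affine => // h; rewrite !mxE addrK.
Qed.

Lemma is_derive_comp_scalar (V : normedModType R) (h : R -> R) (f : V -> R)
    (b w : V) (df dh : R) : differentiable f b ->
  is_derive b w f df -> is_derive (f b) (1 : R) h dh ->
  is_derive b w (fun x => h (f x)) (dh * df).
Proof.
move=> dfb [_ <-] [hd <-].
have dh' : differentiable h (f b) by apply/derivable1_diffP.
apply: DeriveDef; first by apply: diff_derivable; exact: differentiable_comp.
exact: derive_comp1.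
Qed.

Lemma is_derive_mulS (V : normedModType R) (f h : V -> R) (b w : V) (df dh : R) :
  is_derive b w f df -> is_derive b w h dh ->
  is_derive b w (fun x => f x * h x) (df * h b + f b * dh).
Proof.
by move=> ? ?; apply: is_derive_eq; rewrite -?[_ *: _]/(_ * _) addrC [h b * _]mulrC.
Qed.

Lemma is_derive_vec n b w : is_derive b w (fun x : C4 => (vec x)`_n) (dvec b w)`_n.
Proof.
have dc j : differentiable (fun x : C4 => x 0 j : R) b by exact: differentiable_coord.
have ic := is_derive_coord b w.
have icos j : is_derive b w (fun x : C4 => cos (x 0 j)) (- sin (b 0 j) * w 0 j).
  exact: (is_derive_comp_scalar (dc j) (ic j) (is_derive_cos _)).
have isin j : is_derive b w (fun x : C4 => sin (x 0 j)) (cos (b 0 j) * w 0 j).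
  exact: (is_derive_comp_scalar (dc j) (ic j) (is_derive_sin _)).
have dg : differentiable (fun x : C4 => growth * tc x) b.
  by have [+ _] := Ck_mul (@oT _) (Ck_cst 1 setT growth) (Ck_coordT 1 o3); exact.
have ig : is_derive b w (fun x : C4 => growth * tc x) (growth * tc w).
  by apply: is_derive_eq (is_derive_mulS (is_derive_cst growth b w) (ic o3)) _; rewrite mul0r add0r.
have dgN : differentiable (fun x : C4 => - (growth * tc x)) b.
  exact: differentiableN dg.
have igN : is_derive b w (fun x : C4 => - (growth * tc x)) (- (growth * tc w)).
  exact: is_deriveN.
have ie := is_derive_comp_scalar dg ig (is_derive_expR _).
have ieN := is_derive_comp_scalar dgN igN (is_derive_expR _).
have i1 : is_derive b w (@cft1 R) (dcft1 b w).
  apply: is_derive_eq; rewrite /dcft1 -!/(_ * _).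
  by rewrite -?[_ *: _]/(_ * _); ring.
have i2 : is_derive b w (@cft2 R) (dcft2 b w).
  apply: is_derive_eq; rewrite /dcft2.
  by rewrite -?[_ *: _]/(_ * _); ring.
case: n => [|n]; first exact: is_derive_cst.
case: n => [|n]; first exact: (ic o3).
case: n => [|n]; first exact: (ic o0).
case: n => [|n]; first exact: (icos o1).
case: n => [|n]; first exact: (isin o1).
case: n => [|n]; first exact: (icos o2).
case: n => [|n]; first exact: (isin o2).
case: n => [|n]; first by apply: is_derive_eq (is_derive_mulS i1 (icos o1)) _ => /=; ring.
case: n => [|n]; first by apply: is_derive_eq (is_derive_mulS i1 (isin o1)) _ => /=; ring.
case: n => [|n]; first by apply: is_derive_eq (is_derive_mulS i2 (icos o2)) _ => /=; ring.
case: n => [|n]; first by apply: is_derive_eq (is_derive_mulS i2 (isin o2)) _ => /=; ring.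
by rewrite /= !nth_nil; exact: is_derive_cst.
Qed.

Lemma blk_diff i n b : differentiable (@blk R i n) b.
Proof. by have [+ _] := Ck_blk 1 i n; exact. Qed.

Lemma diff_blk i n b w : 'd (@blk R i n) b w = dblk i n b w.
Proof.
have d0 : differentiable (fun x : C4 => tc x + offset R i) b.
  apply: differentiableD; first exact: differentiable_coord.
  exact: differentiable_cst.
have i0 : is_derive b w (fun x : C4 => tc x + offset R i) (tc w).
  have it := is_derive_coord b w o3.
  by apply: is_derive_eq; rewrite addr0.
have i1 := is_derive_comp_scalar d0 i0 (is_derive_cutoff _).
have i2 := is_derive_vec n b w.
have : is_derive b w (@blk R i n) (dblk i n b w).
  apply: is_derive_eq; rewrite /dblk -?[_ *: _]/(_ * _); ring.
by move=> [_ <-]; rewrite deriveE //; exact: blk_diff.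
Qed.

Lemma Ck_Fblk k g j j' i n : Ck k setT (fun b : C4 => Fblk g j b j' i n).
Proof.
have [cd cdV] := Ck_deck k.
have cm (a : R) (f : C4 -> R) : Ck k setT f -> Ck k setT (fun b => a * f b).
  by move=> cf; apply: Ck_mul => //; exact: Ck_cst.
apply: Ck_add => //; apply: cm; first exact: Ck_blk.
apply: Ck_add => //.
  exact: (Ck_comp_row (@oT _) (fun _ _ => I) cd (Ck_blk k i n)).
exact: (Ck_comp_row (@oT _) (fun _ _ => I) cdV (Ck_blk k i n)).
Qed.

Lemma smooth_F g j : smooth setT (@F R g j).
Proof. by move=> k; apply: Ck_mkE => // j' i n; exact: Ck_Fblk. Qed.

Lemma F_diff g j b : differentiable (@F R g j) b.
Proof. exact: smooth_differentiable (smooth_F g j) I. Qed.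

Lemma diff_Fblk g j b w j' i n :
  'd (fun b : C4 => Fblk g j b j' i n) b w = dFblk g j b w j' i n.
Proof.
have [dd dV] := deck_diff b; have [ed eV] := diff_deck b w.
have db b' := blk_diff i n b'.
have d1 := differentiable_comp dd (db (deck b)).
have d2 := differentiable_comp dV (db (deckV b)).
have e1 := etrans (diff_compE w dd (db (deck b)))
  (etrans (congr1 ('d (blk i n) (deck b)) ed) (diff_blk i n (deck b) (ldeck w))).
have e2 := etrans (diff_compE w dV (db (deckV b)))
  (etrans (congr1 ('d (blk i n) (deckV b)) eV) (diff_blk i n (deckV b) (ldeckV w))).
have i0 : is_derive b w (@blk R i n) (dblk i n b w).
  apply: DeriveDef; first exact: diff_derivable (db b).
  by rewrite (deriveE w (db b)) diff_blk.
have i1 : is_derive b w (fun b => blk i n (deck b)) (dblk i n (deck b) (ldeck w)).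
  by apply: DeriveDef; [exact: diff_derivable d1|exact: etrans (deriveE w d1) e1].
have i2 : is_derive b w (fun b => blk i n (deckV b)) (dblk i n (deckV b) (ldeckV w)).
  by apply: DeriveDef; [exact: diff_derivable d2|exact: etrans (deriveE w d2) e2].
have dF : differentiable (fun b : C4 => Fblk g j b j' i n) b.
  by have [+ _] := Ck_Fblk 1 g j j' i n; exact.
rewrite -deriveE //.
have : is_derive b w (fun b : C4 => Fblk g j b j' i n) (dFblk g j b w j' i n).
  have := is_deriveD (is_derive_mulS (is_derive_cst ((j' == j)%:R : R) b w) i0)
    (is_derive_mulS (is_derive_cst ((j' == j (+) g)%:R : R) b w) (is_deriveD i1 i2)).
  by rewrite !mul0r !add0r.
by case.
Qed.

Lemma diff_F g j b w : 'd (@F R g j) b w = dF g j b w.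
Proof.
have dFb := F_diff g j b.
apply/rowP => k.
rewrite -(deriveE w dFb) (derive_entry w k dFb).
rewrite /dF /mkE !mxE.
case: splitP => [a ka|a ka].
  rewrite mxE (_ : (fun x => _) = cst 0) ?derive_cst //.
  apply/funext => x; rewrite mxE; case: splitP => [c|c kc]; first by rewrite mxE.
  by have := ltn_ord a; rewrite -ka kc ltnNge leq_addr.
rewrite mxE.
have kE : k = rshift 4 a by exact/val_inj.
case iE : (enum_val a) => [[j' i] n].
rewrite (_ : (fun x => _) = (fun b : C4 => Fblk g j b j' i n)); last first.
  by apply/funext => x; rewrite /F /mkE kE row_mxEr mxE iE.
rewrite deriveE; first by rewrite diff_Fblk.
by have [+ _] := Ck_Fblk 1 g j j' i n; exact.
Qed.

(* Since [c dp] is [(c cos p) d(sin p) - (c sin p) d(cos p)] and the squares of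
   the bump functions sum to [1], this linear form restricts to the Liouville
   form. *)
Definition lamA : form1 R ambient := fun x => mkE (fun j i n => nth 0
  [:: 0; 0; 0; - crd x j i 8; crd x j i 7; - crd x j i 10; crd x j i 9; 0; 0; 0; 0] n).

Definition pairB (f h : nat -> R) : R :=
  f 7%N * h 4%N - f 8%N * h 3%N + f 9%N * h 6%N - f 10%N * h 5%N.

Lemma smooth_lamA : smooth setT lamA.
Proof.
move=> k; apply: Ck_mkE => // j i n.
have cc m : Ck k setT (fun x : E => crd x j i m) by exact: Ck_crd.
by do 11! [case: n => [|n]; first by
    [exact: Ck_cst|exact: (Ck_opp (@oT _) (cc _))|exact: cc]];
  rewrite /= nth_nil; exact: Ck_cst.
Qed.

Lemma sum_crd (f : bool -> bool -> nat -> R) (v : E) :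
  \sum_k (mkE f) 0 k * v 0 k =
  \sum_j \sum_i \sum_(0 <= n < 11) f j i n * crd v j i n.
Proof.
rewrite big_split_ord /= big1 ?add0r; last first.
  by move=> k _; rewrite row_mxEl mxE mul0r.
rewrite pair_bigA /=.
under [RHS]eq_bigr do rewrite big_mkord.
rewrite pair_bigA /=.
rewrite (reindex (@enum_rank (bool * bool * 'I_11)%type)) /=; last first.
  by apply: onW_bij; exact: enum_rank_bij.
apply: eq_bigr => -[[j i] n] _; rewrite row_mxEr mxE enum_rankK /= /crd.
by rewrite valK.
Qed.

Lemma eval_lamA x v : eval1 lamA x v = \sum_j \sum_i pairB (crd x j i) (crd v j i).
Proof.
rewrite /eval1 sum_crd; apply: eq_bigr => j _; apply: eq_bigr => i _.
rewrite !big_nat_recr //= big_geq //= /pairB; ring.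
Qed.

Lemma derive_lamA x u : 'D_u lamA x = lamA u.
Proof.
have dl := smooth_differentiable smooth_lamA (I : setT x).
rewrite deriveE //; apply: diff_affine => // h.
apply/rowP => k; rewrite !mxE; case: splitP => [a _|a _].
  by rewrite !mxE subrr mulr0.
rewrite !mxE; case: (enum_val a) => [[j i] [n lt]] /=.
do 11! [case: n lt => [|n] lt; first by rewrite /= ?crdD ?crdZ; ring].
by [].
Qed.

Lemma ext_lamA x u v : ext_d lamA x u v =
  \sum_j \sum_i (pairB (crd u j i) (crd v j i) - pairB (crd v j i) (crd u j i)).
Proof.
rewrite /ext_d.
have e a c : eval1 (fun q => 'D_a lamA q) x c = \sum_j \sum_i pairB (crd a j i) (crd c j i).
  by rewrite -eval_lamA /eval1; apply: eq_bigr => k _; rewrite derive_lamA.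
apply: (etrans (congr2 (fun a c => a - c) (e u v) (e v u))).
by rewrite -sumrB; apply: eq_bigr => j _; rewrite -sumrB.
Qed.

(** In the eigencoordinates [x = golden * p1 + p2] and [y = p2 - golden^-1 * p1] this is
    [phi^tau dx + s phi^(- tau) dy], with [phi^tau] written [expR (growth * tau)]. Its exterior
    derivative is [om0]. *)
Definition lam0 (b w : C4) : R := cft1 b * p1 w + cft2 b * p2 w.
Definition om0 (b u w : C4) : R := dcft1 b u * p1 w - dcft1 b w * p1 u
  + (dcft2 b u * p2 w - dcft2 b w * p2 u).

Lemma pair_blk i b w : pairB (blk i ^~ b) (fun n => dblk i n b w) =
  cutoff (tc b + offset R i) ^+ 2 * lam0 b w.
Proof.
rewrite /pairB /blk /dblk /= /lam0.
have h1 := sin2cos2 (p1 b); have h2 := sin2cos2 (p2 b).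
ring: h1 h2.
Qed.

(** The last term comes from differentiating the squared bump. It disappears only after summation
    over the patches, because the squares have constant sum. *)
Lemma pair_dblk i b u w :
  pairB (fun n => dblk i n b u) (fun n => dblk i n b w) -
  pairB (fun n => dblk i n b w) (fun n => dblk i n b u) =
  cutoff (tc b + offset R i) ^+ 2 * om0 b u w +
  2 * (cutoff (tc b + offset R i) * dcut (tc b + offset R i)) *
    (tc u * lam0 b w - tc w * lam0 b u).
Proof.
rewrite /pairB /dblk /= /lam0 /om0.
have h1 := sin2cos2 (p1 b); have h2 := sin2cos2 (p2 b).
ring: h1 h2.
Qed.

Lemma expR_tc (b : C4) : (expR (growth * (tc b - 1)) = expR (growth * tc b) * golden^-1) *
  (expR (- (growth * (tc b - 1))) = expR (- (growth * tc b)) * golden).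
Proof.
split; first by rewrite mulrBr mulr1 expRD expRN expR_growth.
by rewrite mulrBr mulr1 opprB addrC expRD expR_growth.
Qed.

Lemma lam0_deck b w : lam0 (deck b) (ldeck w) = lam0 b w.
Proof.
rewrite /lam0 /cft1 /cft2 /ldeck /deck !mk4E !expR_tc.
have g0 : golden != 0 by rewrite gt_eqF // golden_gt0.
have gI := golden_inv R; have gs := golden_sq R.
by field: gI gs.
Qed.

Lemma om0_deck b u w : om0 (deck b) (ldeck u) (ldeck w) = om0 b u w.
Proof.
rewrite /om0 /dcft1 /dcft2 /ldeck /deck !mk4E !expR_tc.
have gI := golden_inv R; have gs := golden_sq R.
rewrite gI; ring: gs.
Qed.

Lemma ldeckVK w : ldeck (ldeckV w) = w.
Proof.
rewrite -[RHS]mk4K /ldeckV /ldeck !mk4E; congr mk4; ring.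
Qed.

(** At most one of the three orbit terms lies in window [i], so the sum is the squared bump of
    whichever is active; [dsq] is half its derivative. *)
Definition sq i t := cutoff (t + offset R i) ^+ 2 + cutoff (t - 1 + offset R i) ^+ 2
  + cutoff (t + 1 + offset R i) ^+ 2.
Definition dsq i t := cutoff (t + offset R i) * dcut (t + offset R i)
  + cutoff (t - 1 + offset R i) * dcut (t - 1 + offset R i)
  + cutoff (t + 1 + offset R i) * dcut (t + 1 + offset R i).

(** The range is the union of the two windows. On each of its three subintervals of length 1/2 one
    term per patch is left, and [cutoff_unity] applies to the pair. *)
Lemma sq_sum t : - (1 / 2) < t < 1 -> sq false t + sq true t = 1.
Proof.
move=> /andP[t1 t2]; rewrite /sq /offset !addr0.
have [t0|t0] := ltP t 0.
  rewrite [cutoff t]cutoff_out; last by apply/negP; lra.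
  rewrite [cutoff (t - 1)]cutoff_out; last by apply/negP; lra.
  rewrite [cutoff (t - 1 + 1 / 2)]cutoff_out; last by apply/negP; lra.
  rewrite [cutoff (t + 1 + 1 / 2)]cutoff_out; last by apply/negP; lra.
  have H : 0 <= t + 1 / 2 <= 1 / 2 by lra.
  have := cutoff_unity H; rewrite (_ : t + 1 / 2 + 1 / 2 = t + 1); last by field.
  by rewrite expr0n /= !add0r !addr0 addrC.
rewrite [cutoff (t - 1)]cutoff_out; last by apply/negP; lra.
rewrite [cutoff (t + 1)]cutoff_out; last by apply/negP; lra.
rewrite [cutoff (t + 1 + 1 / 2)]cutoff_out; last by apply/negP; lra.
have [th|th] := ltP t (1 / 2).
  rewrite [cutoff (t - 1 + 1 / 2)]cutoff_out; last by apply/negP; lra.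
  have H : 0 <= t <= 1 / 2 by lra.
  by have := cutoff_unity H; rewrite expr0n /= !addr0.
rewrite [cutoff (t + 1 / 2)]cutoff_out; last by apply/negP; lra.
have H : 0 <= t - 1 + 1 / 2 <= 1 / 2 by lra.
have := cutoff_unity H; rewrite (_ : t - 1 + 1 / 2 + 1 / 2 = t); last by field.
by rewrite expr0n /= !addr0 add0r addrC.
Qed.

Lemma dsq_sum t : - (1 / 2) < t < 1 -> dsq false t + dsq true t = 0.
Proof.
move=> tw.
have ic (a : R) : is_derive t (1 : R) (fun r : R => cutoff (r + a)) (dcut (t + a)).
  have dd : differentiable (fun r : R => r + a) t.
    by apply: differentiableD; [exact: (ex_diff (x := nbhs t))|exact: differentiable_cst].
  have i0 : is_derive t (1 : R) (fun r : R => r + a) 1.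
    by apply: is_derive_eq; rewrite addr0.
  by have := is_derive_comp_scalar dd i0 (is_derive_cutoff _); rewrite mulr1.
have ic2 (a : R) : is_derive t (1 : R) (fun r : R => cutoff (r + a) ^+ 2)
    (2 * (cutoff (t + a) * dcut (t + a))).
  by apply: is_derive_eq (is_derive_mulS (ic a) (ic a)) _; ring.
have isq i : is_derive t (1 : R) (sq i) (2 * dsq i t).
  have := is_deriveD (is_deriveD (ic2 (offset R i)) (ic2 (- 1 + offset R i)))
    (ic2 (1 + offset R i)).
  rewrite -!mulrDr /dsq !addrA.
  rewrite (_ : _ + _ + _ = sq i) //; apply/funext => r.
  by rewrite /sq !fctE !addrA.
have [_ e1] := is_deriveD (isq false) (isq true); have : 'D_1 (sq false + sq true) t = 0.
  rewrite (@near_eq_derive _ _ _ _ (cst (1 : R))) ?derive_cst //.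
  have : nbhs t `]- (1 / 2), 1[%classic.
    by apply: open_nbhs_nbhs; split; [exact: itv_open|rewrite /= in_itv].
  by apply: filterS => r; rewrite /= in_itv /= => /sq_sum; rewrite fctE.
rewrite e1 -mulrDr => /eqP; rewrite mulf_eq0 => /orP[|/eqP //].
by rewrite pnatr_eq0.
Qed.

Lemma dblk_out i n (b w : C4) : ~ window i b -> dblk i n b w = 0.
Proof.
move=> nw; rewrite /dblk dcut_out // cutoff_out; last exact/negP.
by rewrite !mul0r addr0.
Qed.

Lemma window_deck i (b : C4) : window i b -> ~ window i (deck b).
Proof. by rewrite /window mk4E; move: (tc b) (offset R i) => t o; lra. Qed.

Lemma window_deckV i (b : C4) : window i b -> ~ window i (deckV b).
Proof. by rewrite /window mk4E; move: (tc b) (offset R i) => t o; lra. Qed.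

Lemma window_deck_deckV i (b : C4) : window i (deck b) -> ~ window i (deckV b).
Proof. by rewrite /window !mk4E; move: (tc b) (offset R i) => t o; lra. Qed.

(** The windows of the three orbit terms are disjoint, so on patch [i] the sums defining [F] and
    [dF] reduce to one term, at a translate [b'] of [b], with [L] the linear part of the
    translation. Invariance of the form brings the result back to [b]. *)
Lemma patch_active g j i (b : C4) : exists l (b' : C4) (L : C4 -> C4),
  [/\ (forall j' n, Fblk g j b j' i n = (j' == l)%:R * blk i n b'),
      (forall w j' n, dFblk g j b w j' i n = (j' == l)%:R * dblk i n b' (L w)),
      (forall w, lam0 b' (L w) = lam0 b w /\ tc (L w) = tc w),
      (forall u w, om0 b' (L u) (L w) = om0 b u w) &
      cutoff (tc b' + offset R i) ^+ 2 = sq i (tc b) /\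
      cutoff (tc b' + offset R i) * dcut (tc b' + offset R i) = dsq i (tc b)].
Proof.
have e1 : tc (deck b) = tc b - 1 by rewrite mk4E.
have e2 : tc (deckV b) = tc b + 1 by rewrite mk4E.
have out c : ~ window i c -> cutoff (tc c + offset R i) = 0.
  by move=> nw; rewrite cutoff_out //; exact/negP.
have sqE : sq i (tc b) = cutoff (tc b + offset R i) ^+ 2 +
    cutoff (tc (deck b) + offset R i) ^+ 2 + cutoff (tc (deckV b) + offset R i) ^+ 2.
  by rewrite e1 e2.
have dsqE : dsq i (tc b) = cutoff (tc b + offset R i) * dcut (tc b + offset R i) +
    cutoff (tc (deck b) + offset R i) * dcut (tc (deck b) + offset R i) +
    cutoff (tc (deckV b) + offset R i) * dcut (tc (deckV b) + offset R i).
  by rewrite e1 e2.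
have [wb|nwb] := pselect (window i b).
  have nd := window_deck wb; have nV := window_deckV wb.
  exists j, b, id; split.
  - by move=> j' n; rewrite Fblk_window.
  - by move=> w j' n; rewrite /dFblk (dblk_out _ _ nd) (dblk_out _ _ nV) addr0 mulr0 addr0.
  - exact: (fun w => conj erefl erefl).
  - exact: (fun u w => erefl).
  - rewrite sqE dsqE (out _ nd) (out _ nV) !mul0r expr0n /= !addr0; exact: (conj erefl erefl).
have [wd|nd] := pselect (window i (deck b)).
  have nV := window_deck_deckV wd.
  exists (j (+) g), (deck b), ldeck; split.
  - by move=> j' n; rewrite /Fblk (blk_out _ nwb) (blk_out _ nV) mulr0 add0r addr0.
  - by move=> w j' n; rewrite /dFblk (dblk_out _ _ nwb) (dblk_out _ _ nV) mulr0 add0r addr0.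
  - move=> w; rewrite lam0_deck mk4E; exact: (conj erefl erefl).
  - exact: om0_deck.
  - rewrite sqE dsqE (out _ nwb) (out _ nV) !mul0r expr0n /= !addr0 !add0r.
    exact: (conj erefl erefl).
(* This case includes the absence of any active term: the term of [deckV b] is then zero and the
   equations still hold. *)
exists (j (+) g), (deckV b), ldeckV; split.
- by move=> j' n; rewrite /Fblk (blk_out _ nwb) (blk_out _ nd) mulr0 !add0r.
- by move=> w j' n; rewrite /dFblk (dblk_out _ _ nwb) (dblk_out _ _ nd) mulr0 !add0r.
- move=> w; rewrite -lam0_deck deckVK ldeckVK mk4E; exact: (conj erefl erefl).
- by move=> u w; rewrite -om0_deck deckVK !ldeckVK.
- rewrite sqE dsqE (out _ nwb) (out _ nd) !mul0r expr0n /= !add0r; exact: (conj erefl erefl).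
Qed.

Lemma sum_label (l : bool) (f h f' h' : bool -> nat -> R) (a c : nat -> R) :
  (forall j n, (n < 11)%N -> f j n = (j == l)%:R * a n) ->
  (forall j n, (n < 11)%N -> h j n = (j == l)%:R * c n) ->
  \sum_j pairB (f j) (h j) = pairB a c.
Proof.
by move=> fE hE; rewrite big_bool /pairB !fE // !hE //; case: l {fE hE} => /=; ring.
Qed.

Lemma eval_lamA_F g j (b w : C4) : - (1 / 2) < tc b < 1 ->
  eval1 lamA (F g j b) (dF g j b w) = lam0 b w.
Proof.
move=> tw; rewrite eval_lamA exchange_big /=.
have H i : \sum_j0 pairB (crd (F g j b) j0 i) (crd (dF g j b w) j0 i) =
    sq i (tc b) * lam0 b w.
  have [l [b' [L [h1 h2 h3 h4 [h5 h6]]]]] := patch_active g j i b.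
  rewrite (@sum_label l _ _ (fun _ _ => 0) (fun _ _ => 0) (blk i ^~ b') (fun n => dblk i n b' (L w))).
  - by rewrite pair_blk h5; have [-> _] := h3 w.
  - by move=> j' n n11; rewrite crd_mkE.
  - by move=> j' n n11; rewrite crd_mkE.
by rewrite big_bool /= !H -mulrDl addrC sq_sum // mul1r.
Qed.

Lemma ext_lamA_F g j (b : C4) x (u w : C4) : - (1 / 2) < tc b < 1 ->
  ext_d lamA x (dF g j b u) (dF g j b w) = om0 b u w.
Proof.
move=> tw; rewrite ext_lamA exchange_big /=.
have H i : \sum_j0 (pairB (crd (dF g j b u) j0 i) (crd (dF g j b w) j0 i) -
     pairB (crd (dF g j b w) j0 i) (crd (dF g j b u) j0 i)) =
    sq i (tc b) * om0 b u w + 2 * dsq i (tc b) * (tc u * lam0 b w - tc w * lam0 b u).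
  have [l [b' [L [h1 h2 h3 h4 [h5 h6]]]]] := patch_active g j i b.
  rewrite sumrB.
  rewrite (@sum_label l _ _ (fun _ _ => 0) (fun _ _ => 0) (fun n => dblk i n b' (L u)) (fun n => dblk i n b' (L w))); first last.
  - by move=> j' n n11; rewrite crd_mkE.
  - by move=> j' n n11; rewrite crd_mkE.
  rewrite (@sum_label l _ _ (fun _ _ => 0) (fun _ _ => 0) (fun n => dblk i n b' (L w)) (fun n => dblk i n b' (L u))); first last.
  - by move=> j' n n11; rewrite crd_mkE.
  - by move=> j' n n11; rewrite crd_mkE.
  rewrite pair_dblk h5 h6 h4.
  by have [-> ->] := h3 w; have [-> ->] := h3 u.
rewrite big_bool /= !H addrACA -mulrDl [sq true _ + _]addrC sq_sum // mul1r.
by rewrite -mulrDl -mulrDr [dsq true _ + _]addrC dsq_sum // mulr0 mul0r addr0.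
Qed.

End ModelForms.

Lemma le4 : (4 <= ambient)%N. Proof. exact: leq_addr. Qed.
Lemma le3 : (3 <= ambient)%N. Proof. exact: leq_trans le4. Qed.

(** * Charts of the fillings and of their boundaries *)

Section ModelCharts.
Variable R : realType.

Local Notation E := 'rV[R]_ambient.
Local Notation C4 := 'rV[R]_4.
Local Notation C3 := 'rV[R]_3.

Let oT (V : topologicalType) : open [set: V]. Proof. exact: openT. Qed.

Definition mk3 (t q1 q2 : R) : C3 := \row_(k < 3) nth 0 [:: t; q1; q2] k.

Lemma mk3E t q1 q2 : (mk3 t q1 q2 0 y0 = t) * (mk3 t q1 q2 0 y1 = q1) *
  (mk3 t q1 q2 0 y2 = q2).
Proof. by rewrite !mxE. Qed.

Lemma mk3K (a : C3) : mk3 (a 0 y0) (a 0 y1) (a 0 y2) = a.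
Proof.
by apply/rowP => -[[|[|[|k]]] lt] //; rewrite mxE /=; congr (a _ _); exact/val_inj.
Qed.

Lemma mk4_inj s q1 q2 t s' q1' q2' t' : s = s' -> q1 = q1' -> q2 = q2' -> t = t' ->
  mk4 s q1 q2 t = mk4 s' q1' q2' t' :> C4.
Proof. by move=> -> -> -> ->. Qed.

Lemma Ck_mk3 (V : normedModType R) k (U : set V) (t q1 q2 : V -> R) : open U ->
  Ck k U t -> Ck k U q1 -> Ck k U q2 -> Ck k U (fun b => mk3 (t b) (q1 b) (q2 b)).
Proof.
move=> oU ct c1 c2; apply: Ck_row => // -[[|[|[|j]]] lt] //.
- by apply: Ck_eq ct => // x _; rewrite mxE.
- by apply: Ck_eq c1 => // x _; rewrite mxE.
- by apply: Ck_eq c2 => // x _; rewrite mxE.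
Qed.

Lemma smooth_angle k (U : set E) (c s : E -> R) (q : R) : open U ->
  Ck k U c -> Ck k U s -> (forall x, U x -> 0 < c x * cos q + s x * sin q) ->
  Ck k U (fun x => angle (c x) (s x) q).
Proof.
move=> oU cc cs pos.
have cm (f : E -> R) (a : R) : Ck k U f -> Ck k U (fun x => f x * a).
  by move=> cf; apply: Ck_mul => //; exact: Ck_cst.
have cd : Ck k U (fun x => c x * cos q + s x * sin q) by apply: Ck_add => //; exact: cm.
have cn : Ck k U (fun x => s x * cos q - c x * sin q).
  by apply: Ck_add => //; [exact: cm|apply: Ck_opp => //; exact: cm].
have cV := Ck_comp1 oU (fun x Ux => lt0r_neq0 (pos x Ux)) cd (@Ck_inv R k).
apply: Ck_add => //; first exact: Ck_cst.
exact: (Ck_comp1 oU (fun _ _ => I) (Ck_mul oU cn cV) (Ck_atan k (@oT R))).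
Qed.

Lemma smooth_Gb j i q1 q2 : smooth (Ub j i q1 q2) (@Gb R j i q1 q2).
Proof.
move=> k; have oU := @open_Ub R j i q1 q2.
have cc n : Ck k (Ub j i q1 q2) (fun x : E => crd x j i n) by exact: Ck_crd.
have cV := Ck_comp1 oU (fun x (Ux : Ub j i q1 q2 x) =>
  let: And3 h _ _ := Ux in lt0r_neq0 h) (cc 0%N) (@Ck_inv R k).
apply: Ck_mk4 => //.
- exact: (Ck_mul oU (cc _) cV).
- by apply: smooth_angle => // x [].
- by apply: smooth_angle => // x [].
- exact: (Ck_mul oU (cc _) cV).
Qed.

Lemma Ub_pad m (y : 'rV[R]_m) j i q1 q2 (x : E) : (m <= 4)%N -> Ub j i q1 q2 x ->
  Ub j i q1 q2 (x + pad ambient y) /\ Gb j i q1 q2 (x + pad ambient y) = Gb j i q1 q2 x.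
Proof.
move=> m4; have e n : crd (x + pad ambient y) j i n = crd x j i n.
  by rewrite crdD crd_pad // addr0.
by move=> Ux; rewrite /Ub /Gb /= !e.
Qed.

Definition sg (h : bool) : R := if h then 1 else -1.

Lemma sg2 h : sg h * sg h = 1.
Proof. by case: h; rewrite /sg ?mulrNN mulr1. Qed.

Section Charts.
Variables (g j i h : bool) (q1 q2 : R).

(** The first coordinate is the depth [1 - s] or [1 + s] below the end of [-1, 1] selected by [h],
    so that this end becomes the boundary of the half-space. *)
Definition affW (a : C4) : C4 := mk4 (sg h * (1 - sc a)) (p1 a) (p2 a) (tc a).
(** The first coordinate is the shifted [tau], which the window keeps positive: charts of the
    boundary never meet the boundary of the half-space. *)
Definition affY (a : C3) : C4 := mk4 (sg h) (a 0 y1) (a 0 y2) (a 0 y0 - offset R i).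

Definition OW : set C4 := [set a : C4 | sc a < 2 /\ Ob i q1 q2 (affW a)].
Definition OY : set C3 := [set a | setT a /\ Ob i q1 q2 (affY a)].

Definition GW (x : E) : C4 := let b := Gb j i q1 q2 x in
  mk4 (1 - sg h * sc b) (p1 b) (p2 b) (tc b).
Definition GY (x : E) : C3 := let b := Gb j i q1 q2 x in
  mk3 (tc b + offset R i) (p1 b) (p2 b).

Definition UW : set E := [set x | Ub j i q1 q2 x /\
  [set r : R | -1 < r] (sg h * sc (Gb j i q1 q2 x))].
Definition UY : set E := [set x | Ub j i q1 q2 x /\
  [set r : R | 0 < r] (sg h * sc (Gb j i q1 q2 x))].

Definition FW (a : C4) : E := F g j (affW a).
Definition FY (a : C3) : E := F g j (affY a).

Lemma Ck_affW k : Ck k setT affW.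
Proof.
have c := @Ck_coordT R k.
apply: Ck_mk4 => //; apply: Ck_mul => //; first exact: Ck_cst.
apply: Ck_add => //; first exact: Ck_cst.
by apply: Ck_opp.
Qed.

Lemma Ck_affY k : Ck k setT affY.
Proof.
have c n : Ck k setT (fun b : C3 => b 0 n : R) by apply: Ck_coord; exact: openT.
by apply: Ck_mk4 => //; [exact: Ck_cst|apply: Ck_add => //; exact: Ck_cst].
Qed.

Lemma cont_Gb (x : E) n : Ub j i q1 q2 x ->
  {for x, continuous (fun x => sg h * (Gb j i q1 q2 x 0 n))}.
Proof.
move=> Ux; have cG := Ck_entry (@open_Ub R j i q1 q2) n (@smooth_Gb j i q1 q2 0).
exact: (Ck_mul (@open_Ub R j i q1 q2) (Ck_cst 0 _ (sg h)) cG).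
Qed.

Lemma open_OW : open OW.
Proof.
apply: open_preimage_in => [||x _]; [|exact: open_Ob|exact: (@Ck_affW 0)].
apply: (@open_comp _ _ (fun a : C4 => sc a) [set r : R | r < 2]).
  by move=> x _; exact: coord_continuous.
exact: open_lt.
Qed.

Lemma open_OY : open OY.
Proof.
by apply: open_preimage_in => [||x _]; [exact: openT|exact: open_Ob|exact: (@Ck_affY 0)].
Qed.

Lemma chartW : chart le4 (W g) OW FW UW GW.
Proof.
have oUb := @open_Ub R j i q1 q2.
split.
- exact: open_OW.
- by apply: open_preimage_in oUb (@open_gt _ (-1)) _ => x; exact: cont_Gb.
- move=> k; apply: (Ck_sub (@subsetT _ _)).
  exact: (@Ck_comp R _ setT k 4 ambient setT affW (F g j) (@oT _) (@oT _) (fun _ _ => I) (Ck_affW k) (@smooth_F R g j k)).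
- move=> k.
  have cG n : Ck k (Ub j i q1 q2) (fun x => Gb j i q1 q2 x 0 n).
    exact: Ck_entry (smooth_Gb _ _ _ _ _).
  apply: (@Ck_sub _ _ _ _ (Ub j i q1 q2)) => [x []//|].
  apply: Ck_mk4 => //; apply: Ck_add => //; first exact: Ck_cst.
  by apply: Ck_opp => //; apply: Ck_mul => //; exact: Ck_cst.
- by move=> a; exact: trim_mkE.
- move=> x y [Ux sx]; have [Ux' Gx'] := Ub_pad y (leqnn 4) Ux.
  by split; [split; rewrite //= Gx'|rewrite /GW Gx'].
- move=> a [a2 Oa]; have [Ua Ga] := F_maps g j Oa.
  split; first split=> //=.
    by rewrite /FW Ga !mk4E mulrA sg2; lra.
  rewrite /GW /FW Ga -[RHS]mk4K; apply: mk4_inj; rewrite !mk4E // mulrA sg2; ring.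
(* The bound [sc a < 2] keeps the opposite end out: with it, [(1 - sc a) ^+ 2 <= 1] amounts to
   [0 <= sc a]. *)
- move=> a [a2 Oa]; have [Ua Ga] := F_maps g j Oa; have [wa _ _] := Oa.
  have e : (sg h * (1 - sc a)) ^+ 2 = (1 - sc a) ^+ 2.
    by rewrite exprMn expr2 sg2 mul1r.
  split=> [Wa|a0].
    have [c0 _ _] := Ua.
    have [b [xE wb sb]] := W_repr Wa c0.
    move: Ua Ga; rewrite -[F g j (affW a)]/(FW a) xE => Ua Ga.
    have [+ _ _ _] := Gb_inv wb Ua; rewrite Ga => sE.
    move: sb; rewrite -sE mk4E e => s1 k k0.
    rewrite (_ : k = o0); last exact/val_inj.
    by move: s1; move: (sc a) => r; have := sqr_ge0 r; rewrite sqrrB expr1n; lra.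
  apply: W_window wa _; rewrite mk4E e.
  by have := a0 o0 erefl; nra.
- move=> x [Ux sx] Wx; have [c0 _ _] := Ux.
  have [b [xE wb sb]] := W_repr Wx c0; move: Ux sx; rewrite xE => Ux sx.
  have [_ _ Og Fg] := Gb_inv wb Ux.
  have aE : affW (GW (F g j b)) = Gb j i q1 q2 (F g j b).
    rewrite -[RHS]mk4K; apply: mk4_inj; rewrite !mk4E //.
    by rewrite opprB addrC subrK mulrA sg2 mul1r.
  split; last by rewrite /FW aE Fg.
  split; last by rewrite aE.
  by move: sx; rewrite /= /GW mk4E; move: (sg h * _) => r; lra.
Qed.

End Charts.

Lemma diff_affW h a w : 'd (affW h) a w = mk4 (- (sg h * sc w)) (p1 w) (p2 w) (tc w).
Proof.
apply: diff_affine; first by case: (Ck_affW h 1) => + _; exact.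
move=> r; rewrite -[RHS]mk4K -[LHS]mk4K.
by apply: mk4_inj; rewrite !(mk4E, mxE) ?mk4E; ring.
Qed.

Lemma diff_affY i h a w : 'd (affY i h) a w = mk4 0 (w 0 y1) (w 0 y2) (w 0 y0).
Proof.
apply: diff_affine; first by case: (Ck_affY i h 1) => + _; exact.
move=> r; rewrite -[RHS]mk4K -[LHS]mk4K.
by apply: mk4_inj; rewrite !(mk4E, mxE) ?mk4E; ring.
Qed.

Lemma diff_FW g j h a w :
  'd (FW g j h) a w = dF g j (affW h a) (mk4 (- (sg h * sc w)) (p1 w) (p2 w) (tc w)).
Proof.
have da : differentiable (affW h) a by case: (Ck_affW h 1) => + _; exact.
rewrite -diff_F -(diff_affW h a w); exact: (diff_compE w da (F_diff g j _)).
Qed.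

Lemma diff_FY g j i h a w :
  'd (FY g j i h) a w = dF g j (affY i h a) (mk4 0 (w 0 y1) (w 0 y2) (w 0 y0)).
Proof.
have da : differentiable (affY i h) a by case: (Ck_affY i h 1) => + _; exact.
rewrite -diff_F -(diff_affY i h a w); exact: (diff_compE w da (F_diff g j _)).
Qed.

Section AtPoint.
Variables (g j i : bool) (b : C4).
Hypothesis wb : window i b.
Hypothesis sb : sc b ^+ 2 <= 1.

Let h := 0 <= sc b.
Let a := mk4 (1 - sg h * sc b) (p1 b) (p2 b) (tc b).

Lemma Ob_self (c : C4) : window i c -> Ob i (p1 c) (p2 c) c.
Proof. by move=> wc; split; rewrite // subrr normr0 divr_gt0 // pi_gt0. Qed.

Lemma sg_sc : sg h * sc b = `|sc b|.
Proof.
rewrite /h /sg; case: (leP 0 (sc b)) => s0; first by rewrite mul1r ger0_norm.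
by rewrite mulN1r ltr0_norm.
Qed.

Lemma affW_pt : affW h a = b.
Proof.
rewrite -[RHS]mk4K; apply: mk4_inj; rewrite !mk4E //.
by rewrite opprB addrC subrK mulrA sg2 mul1r.
Qed.

Lemma OW_pt : OW i h (p1 b) (p2 b) a.
Proof.
split; last by rewrite affW_pt; exact: Ob_self.
by rewrite !mk4E sg_sc (le_lt_trans (y := 1)) ?ltr1n // gerBl.
Qed.

Lemma first_pt : first_ge0 a.
Proof.
move=> k k0; rewrite (_ : k = o0); last exact/val_inj.
rewrite !mk4E sg_sc subr_ge0 -(ler_pXn2r (n := 2)) ?nnegrE //.
by rewrite expr1n real_normK ?num_real.
Qed.

Lemma W_straightening : exists U V phi psi,
  straightening 4 (W g) (F g j b) U V phi psi.
Proof.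
have := chart_straightening (isT : (0 < 4)%N) (chartW g j i h (p1 b) (p2 b)) OW_pt.
by rewrite /FW affW_pt => S; do 4 eexists; exact: S.
Qed.

Lemma W_tangent v : tangent 4 (W g) (F g j b) v <-> exists w, v = dF g j b w.
Proof.
have := chart_tangent (isT : (0 < 4)%N) (chartW g j i h (p1 b) (p2 b)) v OW_pt.
rewrite /FW affW_pt -/(FW g j h) => H; split=> [|[w vE]].
  move=> /(H (W_window g j wb sb)).1 [w ->].
  by rewrite diff_FW affW_pt; eexists.
apply: (H (W_window g j wb sb)).2.
exists (mk4 (- (sg h * sc w)) (p1 w) (p2 w) (tc w)).
rewrite vE diff_FW affW_pt !mk4E; congr dF; rewrite -[LHS]mk4K; apply: mk4_inj => //.
by rewrite mulrN opprK mulrA sg2 mul1r.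
Qed.

Lemma W_boundary : boundary 4 (W g) (F g j b) <-> sc b ^+ 2 = 1.
Proof.
have := chart_boundary (isT : (0 < 4)%N) (chartW g j i h (p1 b) (p2 b)) OW_pt first_pt.
rewrite /FW affW_pt => ->; split=> [/(_ o0 erefl)|s1 k k0].
  rewrite !mk4E sg_sc => /eqP; rewrite subr_eq0 => /eqP e.
  by rewrite -[sc b ^+ 2]real_normK ?num_real // -e expr1n.
rewrite (_ : k = o0); last exact/val_inj.
rewrite !mk4E sg_sc (_ : `|sc b| = 1) ?subrr //.
by apply/eqP; rewrite -(eqrXn2 (n := 2)) // expr1n real_normK ?num_real // s1.
Qed.

Lemma W_outward (w : C4) : sc b ^+ 2 = 1 -> 0 < sc b * sc w ->
  outward 4 (W g) (F g j b) (dF g j b w).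
Proof.
move=> s1 sw.
pose w' := mk4 (- (sg h * sc w)) (p1 w) (p2 w) (tc w).
have := @chart_outward _ _ _ _ (isT : (0 < 4)%N) _ _ _ _ _ (chartW g j i h (p1 b) (p2 b)) _ w' OW_pt first_pt.
rewrite diff_FW affW_pt {1}/FW affW_pt.
rewrite (_ : mk4 _ _ _ _ = w); last first.
  rewrite -[RHS]mk4K; apply: mk4_inj; rewrite !mk4E // mulrN opprK mulrA sg2 mul1r //.
apply=> k k0; rewrite (_ : k = o0); last exact/val_inj.
have n1 : `|sc b| = 1.
  by apply/eqP; rewrite -(eqrXn2 (n := 2)) // expr1n real_normK ?num_real // s1.
split; first by rewrite !mk4E sg_sc n1 subrr.
rewrite mk4E oppr_lt0.
have sE : sc b = sg h by rewrite -[LHS]mul1r -(sg2 h) -mulrA sg_sc n1 mulr1.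
by rewrite -sE.
Qed.

End AtPoint.

Definition Y g : set E := boundary 4 (W g).

Lemma Y_F g j i b : window i b -> Y g (F g j b) -> sc b ^+ 2 <= 1 -> sc b ^+ 2 = 1.
Proof. by move=> wb Yb sb; apply/(W_boundary g j wb sb). Qed.

Lemma Y_window g j i b : window i b -> sc b ^+ 2 = 1 -> Y g (F g j b).
Proof. by move=> wb s1; apply/(W_boundary g j wb _) => //; rewrite s1. Qed.

Lemma Y_W g x : Y g x -> W g x. Proof. by case. Qed.

Lemma Y_patch g x : Y g x -> exists j i b, [/\ x = F g j b, window i b & sc b ^+ 2 = 1].
Proof.
move=> Yx; have [j [i [b [xE wb sb]]]] := W_patch (Y_W Yx).
by exists j, i, b; split=> //; apply: (Y_F (g := g) (j := j) wb) => //; rewrite -xE.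
Qed.

Lemma Y_repr g j i x : Y g x -> 0 < crd x j i 0 ->
  exists b, [/\ x = F g j b, window i b & sc b ^+ 2 = 1].
Proof.
move=> Yx c0; have [b [xE wb sb]] := W_repr (Y_W Yx) c0.
by exists b; split=> //; apply: (Y_F (g := g) (j := j) wb) => //; rewrite -xE.
Qed.

Lemma chartY g j i h q1 q2 :
  chart le3 (Y g) (OY i h q1 q2) (FY g j i h) (UY j i h q1 q2) (GY j i q1 q2).
Proof.
have oUb := @open_Ub R j i q1 q2.
have sgsq : sg h ^+ 2 = 1 by rewrite expr2 sg2.
split.
- exact: open_OY.
- by apply: open_preimage_in oUb (@open_gt _ 0) _ => x; exact: cont_Gb.
- move=> k; apply: (Ck_sub (@subsetT _ _)).
  exact: (@Ck_comp R _ setT k 4 ambient setT (affY i h) (F g j) (@oT _) (@oT _) (fun _ _ => I) (Ck_affY i h k) (@smooth_F R g j k)).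
- move=> k.
  have cG n : Ck k (Ub j i q1 q2) (fun x => Gb j i q1 q2 x 0 n).
    exact: Ck_entry (smooth_Gb _ _ _ _ _).
  apply: (@Ck_sub _ _ _ _ (Ub j i q1 q2)) => [x []//|].
  by apply: Ck_mk3 => //; apply: Ck_add => //; exact: Ck_cst.
- by move=> a; exact: trim_mkE.
- move=> x y [Ux sx]; have [Ux' Gx'] := Ub_pad y (isT : (3 <= 4)%N) Ux.
  by split; [split; rewrite //= Gx'|rewrite /GY Gx'].
- move=> a [_ Oa]; have [Ua Ga] := F_maps g j Oa.
  split; first by split=> //=; rewrite /FY Ga !mk4E sg2.
  by rewrite /GY /FY Ga !mk4E subrK mk3K.
- move=> a [_ Oa]; have [wa _ _] := Oa.
  split=> [_ k k0|_]; last by apply: Y_window wa _; rewrite mk4E.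
  rewrite (_ : k = y0); last exact/val_inj.
  by move: wa; rewrite /window mk4E subrK => /andP[/ltW].
- move=> x [Ux sx] Yx; have [c0 _ _] := Ux.
  have [b [xE wb sb]] := Y_repr Yx c0; move: Ux sx; rewrite xE => Ux sx.
  have [sE tE Og Fg] := Gb_inv wb Ux.
  have s1 : sc b = sg h.
    move: sx; rewrite /= sE; move/eqP: sb; rewrite sqrf_eq1 /sg.
    by case: (h) => /orP[] /eqP -> //; rewrite ?mul1r ?mulN1r ?opprK; lra.
  have aE : affY i h (GY j i q1 q2 (F g j b)) = Gb j i q1 q2 (F g j b).
    rewrite -[RHS]mk4K; apply: mk4_inj; rewrite ?mk3E ?addrK //.
    by rewrite sE s1.
  by split; [split; rewrite /= ?aE|rewrite /FY aE Fg].
Qed.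

Section AtBoundaryPoint.
Variables (g j i : bool) (b : C4).
Hypothesis wb : window i b.
Hypothesis sb : sc b ^+ 2 = 1.

Let h := 0 <= sc b.
Let a := mk3 (tc b + offset R i) (p1 b) (p2 b).

Lemma sg_bdry : sg h = sc b.
Proof.
move/eqP: sb; rewrite sqrf_eq1 /h /sg => /orP[] /eqP ->; first by rewrite ler01.
by rewrite ler0N1.
Qed.

Lemma affY_pt : affY i h a = b.
Proof.
by rewrite -[RHS]mk4K; apply: mk4_inj; rewrite ?mk3E ?addrK ?sg_bdry.
Qed.

Lemma OY_pt : OY i h (p1 b) (p2 b) a.
Proof. by split=> //; rewrite affY_pt; exact: Ob_self. Qed.

Lemma FY_pt : FY g j i h a = F g j b.
Proof. by rewrite /FY affY_pt. Qed.

Lemma Y_straightening : exists U V phi psi,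
  straightening 3 (Y g) (F g j b) U V phi psi.
Proof.
have := chart_straightening (isT : (0 < 3)%N) (chartY g j i h (p1 b) (p2 b)) OY_pt.
by rewrite FY_pt => S; do 4 eexists; exact: S.
Qed.

Lemma Y_tangent v : tangent 3 (Y g) (F g j b) v <->
  exists2 w : C4, sc w = 0 & v = dF g j b w.
Proof.
have := chart_tangent (isT : (0 < 3)%N) (chartY g j i h (p1 b) (p2 b)) v OY_pt.
rewrite FY_pt => /(_ (Y_window g j wb sb)) ->; split=> [[w ->]|[w w0 ->]].
  by rewrite diff_FY affY_pt; eexists; last reflexivity; rewrite mk4E.
exists (mk3 (tc w) (p1 w) (p2 w)); rewrite diff_FY affY_pt !mk3E.
by congr dF; rewrite -[LHS]mk4K w0.
Qed.

Lemma Y_no_boundary : ~ boundary 3 (Y g) (F g j b).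
Proof.
have first : first_ge0 a.
  move=> k k0; rewrite (_ : k = y0); last exact/val_inj.
  by rewrite mk3E; case/andP: wb => /ltW.
have := chart_boundary (isT : (0 < 3)%N) (chartY g j i h (p1 b) (p2 b)) OY_pt first.
rewrite FY_pt => -> /(_ y0 erefl); rewrite mk3E => e.
by move: wb; rewrite /window e ltxx.
Qed.

End AtBoundaryPoint.

Lemma W_submanifold g : submanifold 4 (@W R g).
Proof.
split; first by rewrite le4.
by move=> x /W_patch[j [i [b [-> wb sb]]]]; exact: (W_straightening g j wb).
Qed.

Lemma Y_submanifold g : submanifold 3 (@Y g).
Proof.
split; first by rewrite le3.
by move=> x /Y_patch[j [i [b [-> wb sb]]]]; exact: (Y_straightening g j wb sb).
Qed.

Lemma Y_boundary g : boundary 3 (Y g) = set0.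
Proof.
rewrite -subset0 => x bx; have [Yx _] := bx.
have [j [i [b [xE wb sb]]]] := Y_patch Yx.
by move: bx; rewrite xE => bx; exact: (Y_no_boundary wb sb bx).
Qed.

Lemma Y_eq g x : Y g x <-> exists j b, [/\ x = F g j b, sc b ^+ 2 = 1 & 0 <= tc b <= 1].
Proof.
split=> [/Y_patch[j [i [b [-> wb sb]]]]|[j [b [-> sb tb]]]].
  have := offset_bd R i => hi; move: wb; rewrite /window => wb.
  have [t0|t0] := leP 0 (tc b); first by exists j, b; split=> //; lra.
  exists (j (+) g), (deckV b); split; first by rewrite F_deckV //; lra.
    by rewrite !mk4E sqrrN.
  by rewrite !mk4E; lra.
have [t1|t1] := ltP (tc b) (1 / 2).
  by apply: (@Y_window g j true) sb; rewrite /window /offset; lra.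
have [t2|t2] := ltP (tc b) 1.
  by apply: (@Y_window g j false) sb; rewrite /window /offset; lra.
rewrite -F_deck; last lra.
apply: (@Y_window g _ true); first by rewrite /window /deck mk4E /offset; lra.
by rewrite /deck mk4E sqrrN.
Qed.

Lemma angle_reduce (p : R) : exists2 q, - pi <= q <= pi & cos q = cos p /\ sin q = sin p.
Proof.
have c1 : -1 <= cos p <= 1 by rewrite cos_geN1 cos_le1.
have a0 := acos_ge0 c1; have api := acos_lepi c1.
have cK : cos (acos (cos p)) = cos p by apply: acosK; rewrite in_itv.
have sn : 0 <= sin (acos (cos p)) by apply: sin_ge0_pi; rewrite a0 api.
have sE : sin (acos (cos p)) = `|sin p|.
  apply/eqP; rewrite -(eqrXn2 (n := 2)) // real_normK ?num_real //.
  by rewrite !sin2cos2 cK.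
have [s0|s0] := leP 0 (sin p).
  exists (acos (cos p)); first by rewrite api andbT; have := @pi_ge0 R; lra.
  by rewrite cK sE ger0_norm.
exists (- acos (cos p)); first by rewrite lerN2 api /=; have := @pi_ge0 R; lra.
by rewrite cosN sinN cK sE ltr0_norm // opprK.
Qed.

(** The angles matter only modulo [2 * pi]. Restricting them to [[- pi, pi]] exhibits [M] as the
    union, over the two labels, of continuous images of a compact box. *)
Lemma compact_image g (S : set R) (M : set E) : compact S ->
  (forall x, M x <-> exists j b, [/\ x = F g j b, S (sc b) & 0 <= tc b <= 1]) ->
  compact M.
Proof.
move=> cS ME.
pose A (k : 'I_4) : set R := match val k with
  | 0%N => S | 3%N => `[0, 1]%classic | _ => `[- pi, pi]%classic end.
pose B : set C4 := [set v | forall k, A k (v 0 k)].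
have cB : compact B.
  by apply: rV_compact => -[[|[|[|[|k]]]] lt] //=; exact: segment_compact.
have cF j : compact (F g j @` B).
  apply: continuous_compact => //; apply: continuous_subspaceT => b.
  exact: differentiable_continuous (F_diff g j b).
suff -> : M = F g false @` B `|` F g true @` B by exact: compactU.
rewrite eqEsubset; split=> x.
  move=> /ME[j [b [-> sb tb]]].
  have [q1 q1pi [c1 s1]] := angle_reduce (p1 b).
  have [q2 q2pi [c2 s2]] := angle_reduce (p2 b).
  have Bb : B (mk4 (sc b) q1 q2 (tc b)).
    move=> [[|[|[|[|k]]]] lt] //=.
    - by rewrite (_ : Ordinal lt = o0) ?mk4E //; exact/val_inj.
    - by rewrite (_ : Ordinal lt = o1) ?mk4E /= ?in_itv //; exact/val_inj.
    - by rewrite (_ : Ordinal lt = o2) ?mk4E /= ?in_itv //; exact/val_inj.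
    - by rewrite (_ : Ordinal lt = o3) ?mk4E /= ?in_itv //; exact/val_inj.
  have e : F g j (mk4 (sc b) q1 q2 (tc b)) = F g j b by apply: F_ext; rewrite !mk4E.
  by rewrite -e; case: (j); [right|left]; exists (mk4 (sc b) q1 q2 (tc b)).
by case=> -[b Bb <-]; apply/ME; eexists; exists b; split;
  try reflexivity; [exact: (Bb o0)|have := Bb o3; rewrite /A /= in_itv
  |exact: (Bb o0)|have := Bb o3; rewrite /A /= in_itv].
Qed.

Lemma compact_W g : compact (@W R g).
Proof.
apply: (@compact_image g `[-1, 1]%classic); first exact: segment_compact.
move=> x; split=> -[j [b [xE sb tb]]]; exists j, b; split=> //.
  by rewrite /= in_itv /=; nra.
by move: sb; rewrite /= in_itv /=; nra.
Qed.

Lemma compact_Y g : compact (@Y g).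
Proof.
apply: (@compact_image g [set s | s ^+ 2 = 1]) => [|x]; last exact: Y_eq.
rewrite (_ : [set s | _] = [set 1] `|` [set -1]).
  by apply: compactU; exact: compact_set1.
rewrite eqEsubset; split=> s /=; first by move/eqP; rewrite sqrf_eq1 => /orP[] /eqP; auto.
by case=> ->; rewrite ?sqrrN expr1n.
Qed.

Lemma Y_closed g : closed_submanifold 3 (@Y g).
Proof. by split; [exact: Y_submanifold|exact: compact_Y|exact: Y_boundary]. Qed.

End ModelCharts.

(** * Lifting circle-valued functions on the disk *)

Section CircleLift.
Variable R : realType.
Local Notation P := (R * R)%type.

Definition radius (z : P) : R := Num.max 1 (Num.sqrt (z.1 ^+ 2 + z.2 ^+ 2)).
(** The radial retraction of the plane onto the disk; precomposition with it turns functions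
    continuous on the disk into globally continuous ones. *)
Definition retract (z : P) : P := (z.1 / radius z, z.2 / radius z).

Lemma radius_ge1 z : 1 <= radius z.
Proof. by rewrite /radius le_max lexx. Qed.

Lemma radius_neq0 z : radius z != 0.
Proof. by rewrite gt_eqF // (lt_le_trans ltr01) // radius_ge1. Qed.

Lemma cont_fst : continuous (fst : P -> R).
Proof. by move=> z; exact: cvg_fst. Qed.

Lemma cont_snd : continuous (snd : P -> R).
Proof. by move=> z; exact: cvg_snd. Qed.

Lemma cont_mul (T : topologicalType) (f g : T -> R) : continuous f -> continuous g ->
  continuous (fun x => f x * g x).
Proof. by move=> cf cg x; apply: continuousM; [exact: cf|exact: cg]. Qed.

Lemma cont_add (T : topologicalType) (f g : T -> R) : continuous f -> continuous g ->
  continuous (fun x => f x + g x).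
Proof. by move=> cf cg x; apply: continuousD; [exact: cf|exact: cg]. Qed.

Lemma cont_opp (T : topologicalType) (f : T -> R) : continuous f ->
  continuous (fun x => - f x).
Proof. by move=> cf x; apply: continuousN; exact: cf. Qed.

Lemma cont_comp (T U V : topologicalType) (f : T -> U) (g : U -> V) :
  continuous f -> continuous g -> continuous (fun x => g (f x)).
Proof. by move=> cf cg x; apply: continuous_comp; [exact: cf|exact: cg]. Qed.

Lemma cont_pair (T U V : topologicalType) (f : T -> U) (g : T -> V) :
  continuous f -> continuous g -> continuous (fun x => (f x, g x)).
Proof. by move=> cf cg x; apply: cvg_pair; [exact: cf|exact: cg]. Qed.

Lemma cont_inv (T : topologicalType) (f : T -> R) : continuous f ->
  (forall x, f x != 0) -> continuous (fun x => (f x)^-1).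
Proof. by move=> cf f0 x; apply: cvgV => //; exact: cf. Qed.

Lemma cont_radius : continuous radius.
Proof.
have cr : continuous (fun z : P => Num.sqrt (z.1 ^+ 2 + z.2 ^+ 2)); last first.
  have -> : radius = fun z => 2^-1 * (1 + Num.sqrt (z.1 ^+ 2 + z.2 ^+ 2) +
      `|1 - Num.sqrt (z.1 ^+ 2 + z.2 ^+ 2)|).
    by apply/funext => z; rewrite /radius maxr_absE mulrC.
  have c1 : continuous (fun z : P => 1 : R) by exact: cst_continuous.
  apply: cont_mul; first exact: cst_continuous.
  apply: cont_add; first exact: cont_add.
  apply: cont_comp; last exact: norm_continuous.
  by apply: cont_add => //; exact: cont_opp.
apply: (@cont_comp _ _ _ (fun z : P => z.1 ^+ 2 + z.2 ^+ 2) (@Num.sqrt R)).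
  by apply: cont_add; apply: cont_mul; [exact: cont_fst|exact: cont_fst|exact: cont_snd|exact: cont_snd].
exact: sqrt_continuous.
Qed.

Lemma cont_retract : continuous retract.
Proof.
have cV := cont_inv cont_radius radius_neq0.
by apply: cont_pair; apply: cont_mul => //; [exact: cont_fst|exact: cont_snd].
Qed.

Lemma retract_disk z : disk (retract z).
Proof.
rewrite /disk /retract /= !exprMn -mulrDl exprVn.
rewrite ler_pdivrMr ?exprn_gt0 ?(lt_le_trans ltr01) ?radius_ge1 // mul1r.
set q := z.1 ^+ 2 + z.2 ^+ 2; have q0 : 0 <= q by rewrite addr_ge0 ?sqr_ge0.
rewrite -[X in X <= _](sqr_sqrtr q0) ler_pXn2r ?nnegrE ?sqrtr_ge0 //.
  by rewrite /radius le_max lexx orbT.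
by rewrite (le_trans ler01) ?radius_ge1.
Qed.

Lemma retract_id z : disk z -> retract z = z.
Proof.
rewrite /disk /retract /= => dz.
have -> : radius z = 1.
  by rewrite /radius; apply/max_idPl; rewrite -[X in _ <= X]sqrtr1 ler_wsqrtr.
by rewrite invr1 !mulr1; case: (z).
Qed.

Lemma cont_within_comp (T U V : topologicalType) (A : set U) (f : T -> U) (g : U -> V) :
  continuous f -> (forall x, A (f x)) -> {within A, continuous g} ->
  continuous (fun x => g (f x)).
Proof.
move=> cf Af /subspace_continuousP cg x.
apply: cvg_trans (cg _ (Af x)) => B /=.
move=> wB; have : nbhs (f x) [set u | A u -> B (g u)] by exact: wB.
move=> /cf fB; change (nbhs x [set t | B (g (f t))]).
have : nbhs x [set t | A (f t) -> B (g (f t))] by exact: fB.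
by apply: filterS => y /= /(_ (Af y)).
Qed.

Lemma disk_compact : compact (@disk R).
Proof.
have -> : @disk R = retract @` (`[-1, 1] `*` `[-1, 1])%classic.
  rewrite eqEsubset; split=> z; last by case=> w _ <-; exact: retract_disk.
  move=> dz; exists z; last exact: retract_id.
  move: dz; rewrite /disk /= => dz; split=> /=; rewrite in_itv /=.
    by have := sqr_ge0 z.2; nra.
  by have := sqr_ge0 z.1; nra.
apply: continuous_compact; first by apply: continuous_subspaceT; exact: cont_retract.
by apply: compact_setX; exact: segment_compact.
Qed.

(** The pairs of disk points whose unit vectors fail to have positive inner product form a compact
    set that misses the diagonal, so the distance of the two points has a positive minimum on it. *)
Lemma unit_near (c s : P -> R) : continuous c -> continuous s ->
  (forall z, c z ^+ 2 + s z ^+ 2 = 1) ->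
  exists2 d : R, 0 < d & forall z w, disk z -> disk w -> `|z - w| < d ->
    0 < c w * c z + s w * s z.
Proof.
move=> cc cs cs1.
pose K : set (P * P) := (@disk R `*` @disk R) `&`
  [set p | c p.2 * c p.1 + s p.2 * s p.1 <= 0].
have cf1 (h : P -> R) : continuous h -> continuous (fun p : P * P => h p.1).
  by move=> ch; apply: cont_comp => // p; exact: cvg_fst.
have cf2 (h : P -> R) : continuous h -> continuous (fun p : P * P => h p.2).
  by move=> ch; apply: cont_comp => // p; exact: cvg_snd.
have cK : compact K.
  apply: compact_closedI; first by apply: compact_setX; exact: disk_compact.
  apply: (@closed_comp _ _ (fun p : P * P => c p.2 * c p.1 + s p.2 * s p.1) [set r : R | r <= 0]).
    by move=> p _; apply: cont_add; apply: cont_mul; [exact: cf2|exact: cf1|exact: cf2|exact: cf1].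
  exact: closed_le.
have [[p Kp]|K0] := pselect (K !=set0); last first.
  exists 1 => // z w dz dw _; rewrite ltNge; apply/negP => le0.
  by apply: K0; exists (z, w).
have cd : {within K, continuous (fun p : P * P => `|p.1 - p.2|)}.
  apply: continuous_subspaceT; apply: cont_comp; last exact: norm_continuous.
  move=> q; apply: (@continuousB _ _ _ (fst : P * P -> P) (snd : P * P -> P) q).
    exact: cvg_fst.
  exact: cvg_snd.
have [q Kq qmin] := compact_EVT_min (ex_intro _ p Kp) cK cd.
exists `|q.1 - q.2|.
  rewrite normr_gt0 subr_eq0; apply/negP => /eqP q12.
  move: Kq; rewrite inE => -[_] /=; rewrite q12 -!expr2 cs1 leNgt.
  by rewrite ltr01.
move=> z w dz dw zw; rewrite ltNge; apply/negP => le0.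
have := qmin (z, w); rewrite inE => /(_ (conj (conj dz dw) le0)) /=.
by rewrite leNgt zw.
Qed.

Lemma cos_sin_inj (a c : R) : cos a = cos c -> sin a = sin c -> cos (a - c) = 1.
Proof. by move=> ec es; rewrite cosB ec es -!expr2 cos2Dsin2. Qed.

(** The product of [(c', s')] with the conjugate of [(c, s)] has positive real part, so [atan] of
    its slope is the increment of the argument. *)
Lemma angle_step (c s c' s' t : R) : c ^+ 2 + s ^+ 2 = 1 -> c' ^+ 2 + s' ^+ 2 = 1 ->
  0 < c' * c + s' * s -> c = cos t -> s = sin t ->
  c' = cos (t + atan ((s' * c - c' * s) / (c' * c + s' * s))) /\
  s' = sin (t + atan ((s' * c - c' * s) / (c' * c + s' * s))).
Proof.
move=> e e' re0 ct st.
set x := c' * c + s' * s in re0 *; set y := s' * c - c' * s.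
have xy : x ^+ 2 + y ^+ 2 = 1.
  have -> : x ^+ 2 + y ^+ 2 = (c ^+ 2 + s ^+ 2) * (c' ^+ 2 + s' ^+ 2) by rewrite /x /y; ring.
  by rewrite e e' mulr1.
set a := atan (y / x).
have ca : 0 < cos a by apply: cos_gt0_pihalf; rewrite atan_gtNpi2 atan_ltpi2.
have ta : tan a = y / x by rewrite /a atanK.
have x0 : x != 0 by rewrite gt_eqF.
have cn : cos a != 0 by rewrite gt_eqF.
have cx : cos a = x.
  apply/eqP; rewrite -(eqrXn2 (n := 2)) ?ltW //.
  have := cos2_tan2 cn; rewrite ta => h.
  have : (cos a) ^- 2 = x ^- 2.
    rewrite h expr_div_n -[X in X + _](@divff _ (x ^+ 2)) ?expf_neq0 //.
    by rewrite -mulrDl xy mul1r.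
  by move=> /invr_inj ->.
have sy : sin a = y.
  by move: ta; rewrite /tan cx => /(mulIf (invr_neq0 x0)).
rewrite cosD sinD cx sy -ct -st /x /y; split.
  transitivity (c' * (c ^+ 2 + s ^+ 2)); [by rewrite e mulr1|ring].
transitivity (s' * (c ^+ 2 + s ^+ 2)); [by rewrite e mulr1|ring].
Qed.

Lemma angle_exists (c s : R) : c ^+ 2 + s ^+ 2 = 1 -> exists t, c = cos t /\ s = sin t.
Proof.
move=> e; have c1 : -1 <= c <= 1 by have := sqr_ge0 s; nra.
have a0 := acos_ge0 c1; have api := acos_lepi c1.
have cK : cos (acos c) = c by apply: acosK; rewrite in_itv.
have sn : 0 <= sin (acos c) by apply: sin_ge0_pi; rewrite a0 api.
have sE : sin (acos c) = `|s|.
  apply/eqP; rewrite -(eqrXn2 (n := 2)) // real_normK ?num_real //.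
  by rewrite sin2cos2 cK -e addrC addKr.
have [s0|s0] := leP 0 s; first by exists (acos c); rewrite cK sE ger0_norm.
by exists (- acos c); rewrite cosN sinN cK sE ltr0_norm // opprK.
Qed.

(* The lift is the sum of the small increments of the argument along [n] steps
   of the segment from the centre. *)
Lemma circle_lift (c s : P -> R) : {within @disk R, continuous c} ->
  {within @disk R, continuous s} -> (forall z, disk z -> c z ^+ 2 + s z ^+ 2 = 1) ->
  exists2 t : P -> R, continuous t &
    forall z, disk z -> c z = cos (t z) /\ s z = sin (t z).
Proof.
move=> wc ws cs1.
pose c1 z := c (retract z); pose s1 z := s (retract z).
have cc : continuous c1 := cont_within_comp cont_retract retract_disk wc.
have cs : continuous s1 := cont_within_comp cont_retract retract_disk ws.
have e1 z : c1 z ^+ 2 + s1 z ^+ 2 = 1 by apply: cs1; exact: retract_disk.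
have [d d0 dP] := unit_near cc cs e1.
(* More than [1 / d] steps, so that consecutive points on a ray are closer than [d]. *)
pose n := (Num.truncn d^-1).+1.
have n0 : (n%:R : R) != 0 by rewrite pnatr_eq0.
have nd : n%:R^-1 < d.
  rewrite invf_plt ?posrE ?ltr0n //.
  by rewrite /n; apply: truncnS_gt.
pose ray (k : nat) (z : P) : P := (k%:R / n%:R * (retract z).1, k%:R / n%:R * (retract z).2).
have cray k : continuous (ray k).
  have c1' : continuous (fun z => (retract z).1).
    by apply: cont_comp; [exact: cont_retract|exact: cont_fst].
  have c2' : continuous (fun z => (retract z).2).
    by apply: cont_comp; [exact: cont_retract|exact: cont_snd].
  by apply: cont_pair; apply: cont_mul => //; exact: cst_continuous.
have dray k z : (k <= n)%N -> disk (ray k z).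
  move=> kn; have := retract_disk z; rewrite /disk /ray; set w := retract z => /= dz.
  have k1 : 0 <= (k%:R / n%:R : R) <= (1 : R).
    by rewrite divr_ge0 //= ler_pdivrMr ?ltr0n // mul1r ler_nat.
  move: (z.1 / _) (z.2 / _) dz => a e ae.
  move: (k%:R / _) k1 => r /andP[r0 r1].
  rewrite !exprMn -mulrDr; apply: mulr_ile1 => //.
  - by rewrite exprn_ge0.
  - by rewrite addr_ge0 ?sqr_ge0.
  - by rewrite exprn_ile1.
pose x k z := c1 (ray k.+1 z) * c1 (ray k z) + s1 (ray k.+1 z) * s1 (ray k z).
pose y k z := s1 (ray k.+1 z) * c1 (ray k z) - c1 (ray k.+1 z) * s1 (ray k z).
have x0 k z : (k < n)%N -> 0 < x k z.
  move=> kn; apply: dP; [exact: (dray _ _ (ltnW kn))|exact: dray|].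
  have -> : ray k z - ray k.+1 z =
      (- (n%:R^-1 * (retract z).1), - (n%:R^-1 * (retract z).2)).
    by apply: injective_projections; rewrite /= -[k.+1%:R]natr1; ring.
  have := retract_disk z; rewrite /disk; move: (retract z) => w /= dz.
  rewrite prod_normE /= gt_max !normrN !normrM normfV normr_nat.
  have h (r : R) : r ^+ 2 <= 1 -> n%:R^-1 * `|r| < d.
    move=> r1; apply: le_lt_trans nd.
    rewrite ler_piMr // -(ler_pXn2r (n := 2)) ?nnegrE // expr1n.
    by rewrite real_normK ?num_real.
  by rewrite !h //; [have := sqr_ge0 w.1; lra|have := sqr_ge0 w.2; lra].
have [t0 [tc ts]] := angle_exists (e1 (0, 0)).
pose t k z := t0 + \sum_(i < k) atan (y i z / x i z).
have tP k z : (k <= n)%N -> c1 (ray k z) = cos (t k z) /\ s1 (ray k z) = sin (t k z).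
  elim: k => [|k ih] kn.
    by rewrite /t big_ord0 addr0 /ray mul0r !mul0r.
  have [ih1 ih2] := ih (ltnW kn).
  have [r1 r2] := angle_step (e1 (ray k z)) (e1 (ray k.+1 z)) (x0 k z kn) ih1 ih2.
  by rewrite /t big_ord_recr /= addrA.
exists (t n).
  apply: cont_add; first exact: cst_continuous.
  have : forall k : nat, (k <= n)%N -> continuous (fun z => \sum_(i < k) atan (y i z / x i z)).
    elim=> [|k ih] kn.
      rewrite (_ : (fun z => _) = cst 0); first exact: cst_continuous.
      by apply/funext => z; rewrite big_ord0.
    rewrite (_ : (fun z => _) = (fun z => \sum_(i < k) atan (y i z / x i z) + atan (y k z / x k z))); last first.
      by apply/funext => z; rewrite big_ord_recr.
    apply: cont_add; first exact: ih (ltnW kn).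
    apply: cont_comp; last exact: continuous_atan.
    have cr j : continuous (fun z => c1 (ray j z)) by exact: cont_comp.
    have sr j : continuous (fun z => s1 (ray j z)) by exact: cont_comp.
    apply: cont_mul; first by apply: cont_add; [exact: cont_mul|apply: cont_opp; exact: cont_mul].
    apply: cont_inv; first by apply: cont_add; exact: cont_mul.
    by move=> z; rewrite gt_eqF // x0.
  exact.
move=> z dz; have [<- <-] := tP n z (leqnn n).
have -> : ray n z = z.
  by rewrite /ray divff // !mul1r retract_id //; case: (z).
by rewrite /c1 /s1 retract_id.
Qed.

(** The values of [f] lie in the discrete set of multiples of [2 * pi], so a change would force an
    intermediate value with cosine below 1. *)
Lemma cos1_const (f : R -> R) : {within `[0, 1], continuous f} ->
  (forall r, 0 <= r <= 1 -> cos (f r) = 1) -> f 0 = f 1.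
Proof.
move=> cf f1; apply/eqP/negPn/negP => ne.
have [v [v1 v2 v3]] : exists v, [/\ Num.min (f 0) (f 1) <= v,
    v <= Num.max (f 0) (f 1) & cos v != 1].
  pose m := Num.min (f 0) (f 1); pose M := Num.max (f 0) (f 1).
  have mM : m < M by rewrite /m /M; case: (ltgtP (f 0) (f 1)) ne.
  have cm : cos m = 1.
    by rewrite /m /Num.min; case: ifP => _; apply: f1; rewrite ?lexx ?ler01.
  have sm : sin m = 0 by apply/eqP; rewrite -sqrf_eq0 sin2cos2 cm expr1n subrr.
  pose d := Num.min 1 (M - m).
  have d0 : 0 < d by rewrite /d lt_min ltr01 subr_gt0.
  have d1 : d <= 1 by rewrite /d ge_min lexx.
  exists (m + d); split; first by rewrite lerDl ltW.
    by rewrite -lerBrDl /d ge_min lexx orbT.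
  rewrite cosD cm sm mul0r subr0 mul1r lt_eqF //.
  rewrite -cos0 ltr_cos ?in_itv /= ?lexx ?pi_ge0 ?ltW //=.
  by have := @pi_ge2 R; lra.
have [r] : exists2 r, r \in `[0, 1] & f r = v.
  by apply: IVT => //; rewrite v1 v2.
by rewrite in_itv /= => r01 fr; move: v3; rewrite -fr f1 // eqxx.
Qed.

Lemma circle_point1 : circle_point 1 = circle_point 0 :> P.
Proof. by rewrite /circle_point mulr0 mulr1 mulr_natl cos2pi sin2pi cos0 sin0. Qed.

Lemma circle_disk (r : R) : disk (circle_point r).
Proof. by rewrite /disk /circle_point /= cos2Dsin2. Qed.

Lemma cont_circle : continuous (@circle_point R).
Proof.
have cl : continuous (fun r : R => 2 * pi * r).
  by apply: cont_mul; [exact: cst_continuous|move=> x; exact: cvg_id].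
apply: cont_pair; apply: cont_comp cl _; [exact: continuous_cos|exact: continuous_sin].
Qed.

(** On the boundary circle, a lift defined on the whole disk differs from [a + v * r] by multiples
    of [2 * pi], hence by a constant; but the lift has equal values at [r = 0] and [r = 1]. *)
Lemma no_winding (c s : P -> R) (a v : R) : {within @disk R, continuous c} ->
  {within @disk R, continuous s} -> (forall z, disk z -> c z ^+ 2 + s z ^+ 2 = 1) ->
  (forall r, 0 <= r <= 1 -> c (circle_point r) = cos (a + v * r) /\
     s (circle_point r) = sin (a + v * r)) -> v = 0.
Proof.
move=> wc ws cs1 bd; have [t ct tP] := circle_lift wc ws cs1.
pose f r := t (circle_point r) - (a + v * r).
have : f 0 = f 1.
  apply: cos1_const.
    apply: continuous_subspaceT; apply: cont_add.
      by apply: cont_comp => //; exact: cont_circle.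
    apply: cont_opp; apply: cont_add; first exact: cst_continuous.
    by apply: cont_mul; [exact: cst_continuous|move=> x; exact: cvg_id].
  move=> r r01; have [e1 e2] := bd r r01; have [e3 e4] := tP _ (circle_disk r).
  by apply: cos_sin_inj; [rewrite -e3|rewrite -e4].
rewrite /f circle_point1 => /addrI /oppr_inj /addrI.
by rewrite mulr0 mulr1.
Qed.

End CircleLift.

(** * Reeb orbits *)

Section Orbits.
Variable R : realType.

Local Notation E := 'rV[R]_ambient.
Local Notation C4 := 'rV[R]_4.
Local Notation golden := (golden R).
Local Notation growth := (growth R).
Local Notation eU b := (expR (growth * tc b)).
Local Notation eV b := (expR (- (growth * tc b))).

Lemma window_region i (b : C4) : window i b -> - (1 / 2) < tc b < 1.
Proof.
rewrite /window; have := offset_bd R i; move: (tc b) (offset R i) => t o; lra.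
Qed.

(** [reebx] and [reeby] are the components of the Reeb field in the eigencoordinates. For [s = 1] or
    [-1] the two summands of the form contribute equally to its value 1:
    [phi^tau dx = s phi^(- tau) dy = 1 / 2]. Solving for [p1] and [p2] gives [reeb1] and [reeb2]. *)
Definition reebx (b : C4) := (2 * eU b)^-1.
Definition reeby (b : C4) := sc b / (2 * eV b).
Definition reeb1 (b : C4) := (reebx b - reeby b) / (golden + golden^-1).
Definition reeb2 (b : C4) := reebx b - golden * reeb1 b.

(** The kernel condition is tested on coordinate vectors. The two torus directions force the [tau]
    component to vanish; the [tau] direction and the normalization are two independent equations for
    the torus components. *)
Lemma reeb_unique (b w : C4) : sc b ^+ 2 = 1 -> sc w = 0 -> lam0 b w = 1 ->
  (forall u : C4, sc u = 0 -> om0 b w u = 0) ->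
  [/\ tc w = 0, p1 w = reeb1 b & p2 w = reeb2 b].
Proof.
move=> sb sw lw ow.
have gp := golden_gt0 R; have Tp := growth_gt0 R.
have gI : 0 < golden^-1 by rewrite invr_gt0.
have Up : 0 < eU b by exact: expR_gt0.
have Vp : 0 < eV b by exact: expR_gt0.
have h1 : growth * tc w * (golden * eU b + golden^-1 * (sc b * eV b)) = 0.
  have := ow (mk4 0 1 0 0); rewrite /om0 /dcft1 /dcft2 !mk4E sw => /(_ erefl) => h.
  by rewrite -[RHS]h; ring.
have h2 : growth * tc w * (eU b - sc b * eV b) = 0.
  have := ow (mk4 0 0 1 0); rewrite /om0 /dcft1 /dcft2 !mk4E sw => /(_ erefl) => h.
  by rewrite -[RHS]h; ring.
have h3 : growth * ((golden * eU b + golden^-1 * (sc b * eV b)) * p1 w +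
    (eU b - sc b * eV b) * p2 w) = 0.
  have := ow (mk4 0 0 0 1); rewrite /om0 /dcft1 /dcft2 !mk4E sw => /(_ erefl) => h.
  by rewrite -[RHS]oppr0 -h; ring.
have tw : tc w = 0.
  apply/eqP/negPn/negP => tn0.
  have gt0' : growth * tc w != 0 by rewrite mulf_neq0 // gt_eqF.
  move/eqP: h1; rewrite mulf_eq0 (negPf gt0') /= => /eqP h1.
  move/eqP: h2; rewrite mulf_eq0 (negPf gt0') /= subr_eq0 => /eqP h2.
  move: h1; rewrite -h2 => /eqP; rewrite -mulrDl mulf_eq0 => /orP[].
    by rewrite gt_eqF // addr_gt0.
  by rewrite gt_eqF.
move/eqP: h3; rewrite mulf_eq0 gt_eqF //= => /eqP h3.
move: lw; rewrite /lam0 /cft1 /cft2 => lw.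
have Un : eU b != 0 by rewrite gt_eqF.
have Vn : eV b != 0 by rewrite gt_eqF.
have xE : golden * p1 w + p2 w = reebx b.
  have U2 : 2 * eU b != 0 by rewrite mulf_neq0 ?pnatr_eq0.
  rewrite /reebx; apply: (mulfI U2); rewrite mulfV //.
  by apply: etrans (etrans (congr2 +%R lw h3) (addr0 _)); ring.
have yE : - (golden^-1 * p1 w) + p2 w = reeby b.
  rewrite /reeby.
  have : 2 * eV b * (sc b * (- (golden^-1 * p1 w) + p2 w)) = 1.
    by apply: etrans (etrans (congr2 (fun x y => x - y) lw h3) (subr0 _)); ring: sb.
  have V2 : 2 * eV b != 0 by rewrite mulf_neq0 ?pnatr_eq0.
  move=> e; apply: (mulfI V2); rewrite [RHS]mulrC divfK //.
  by rewrite -[RHS]mulr1 -[X in _ = _ * X]e; ring: sb.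
have sn : golden + golden^-1 != 0 by rewrite gt_eqF // addr_gt0.
have e1 : p1 w = reeb1 b.
  apply: (mulIf sn); rewrite /reeb1 divfK // -xE -yE; ring.
split=> //; rewrite /reeb2 -e1 -xE; ring.
Qed.

Lemma reeb_ext (b b' : C4) : sc b = sc b' -> tc b = tc b' ->
  reeb1 b = reeb1 b' /\ reeb2 b = reeb2 b'.
Proof. by move=> es et; rewrite /reeb2 /reeb1 /reebx /reeby es et. Qed.

Lemma reeb_neq0 (b : C4) : reeb1 b = 0 -> reeb2 b = 0 -> False.
Proof.
rewrite /reeb2 => r1; rewrite r1 mulr0 subr0 => /eqP.
by rewrite /reebx invr_eq0 mulf_eq0 pnatr_eq0 /= gt_eqF // expR_gt0.
Qed.

Lemma reeb_vectorE g j i (b : C4) v : window i b -> sc b ^+ 2 = 1 ->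
  reeb_vector 2 (@Y R g) (@lamA R) (F g j b) v ->
  v = dF g j b (mk4 0 (reeb1 b) (reeb2 b) 0).
Proof.
move=> wb sb [/(Y_tangent g j wb sb)[w sw ->] lw ow].
have reg := window_region wb.
rewrite eval_lamA_F // in lw.
have ow' (u : C4) : sc u = 0 -> om0 b w u = 0.
  move=> su; rewrite -(ext_lamA_F g j (F g j b)) //; apply: ow.
  by apply/(Y_tangent g j wb sb); exists u.
have [t0 e1 e2] := reeb_unique sb sw lw ow'.
by congr dF; rewrite -[LHS]mk4K sw t0 e1 e2.
Qed.

Lemma dF_reeb_crd g j (b : C4) (r1 r2 : R) j' i n : (n < 3)%N ->
  crd (dF g j b (mk4 0 r1 r2 0)) j' i n = 0.
Proof.
move=> n3; rewrite crd_mkE; last exact: leq_trans n3 _.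
have z (c w : C4) : sc w = 0 -> tc w = 0 -> dblk i n c w = 0.
  move=> sw tw; rewrite /dblk tw mulr0 mul0r add0r.
  by case: n n3 => [|[|[|n]]] // _; rewrite /dvec /= ?sw ?tw mulr0.
by rewrite /dFblk !z ?mk4E ?oppr0 // !addr0 !mulr0 addr0.
Qed.

Lemma diff_crd (x v : E) j i n : 'd (fun x : E => crd x j i n) x v = crd v j i n.
Proof.
apply: diff_affine; first by case: (Ck_crd 1 j i n (@openT E)) => + _; exact.
by move=> h; rewrite crdD crdZ addrK.
Qed.

Lemma is_derive_crd (gm : R -> E) (t : R) j i n : derivable gm t 1 ->
  is_derive t (1 : R) (fun t => crd (gm t) j i n) (crd ('D_1 gm t) j i n).
Proof.
move=> dg; have dgm : differentiable gm t by exact/derivable1_diffP.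
have dc : differentiable (fun x : E => crd x j i n) (gm t).
  by case: (Ck_crd 1 j i n (@openT E)) => + _; exact.
have dcg : differentiable ((fun x : E => crd x j i n) \o gm) t.
  exact: differentiable_comp.
apply: DeriveDef; first exact: diff_derivable dcg.
rewrite (deriveE (1 : R) dcg) (diff_compE (1 : R) dgm dc).
by rewrite diff_crd -(deriveE (1 : R) dgm).
Qed.

(** Rotating the solution back by the angle [r * t] gives a pair with zero derivative, so uniqueness
    follows from the constancy of such functions. *)
Lemma rotation_ode (f h : R -> R) (r : R) :
  (forall t, is_derive t (1 : R) f (- r * h t)) ->
  (forall t, is_derive t (1 : R) h (r * f t)) ->
  forall t, f t = f 0 * cos (r * t) - h 0 * sin (r * t) /\
            h t = f 0 * sin (r * t) + h 0 * cos (r * t).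
Proof.
move=> df dh.
have dr t : differentiable (fun t : R => r * t) t.
  by case: (Ck_mul (@openT R) (Ck_cst 1 setT r) (@Ck_id R 1 setT)) => + _; exact.
have ir (t : R) : is_derive t (1 : R) (fun t : R => r * t) r.
  by apply: is_derive_eq (is_derive_mulS (is_derive_cst r t (1 : R)) (is_derive_id t (1 : R))) _; rewrite /= ?mul0r ?mulr0 ?addr0 ?add0r ?mulr1.
have ic t := is_derive_comp_scalar (dr t) (ir t) (is_derive_cos _).
have is' t := is_derive_comp_scalar (dr t) (ir t) (is_derive_sin _).
have iA (t : R) : is_derive t (1 : R) (fun t => f t * cos (r * t) + h t * sin (r * t)) 0.
  by apply: is_derive_eq (is_deriveD (is_derive_mulS (df t) (ic t)) (is_derive_mulS (dh t) (is' t))) _; ring.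
have iB (t : R) : is_derive t (1 : R) (fun t => h t * cos (r * t) + - f t * sin (r * t)) 0.
  by apply: is_derive_eq (is_deriveD (is_derive_mulS (dh t) (ic t)) (is_derive_mulS (is_deriveN (df t)) (is' t))) _; rewrite /= !fctE; ring.
move=> t.
have := is_derive_0_is_cst t 0 iA; have := is_derive_0_is_cst t 0 iB.
rewrite mulr0 cos0 sin0 !mulr1 !mulr0 !addr0 => <- <-.
have cs := sin2cos2 (r * t).
by split; ring: cs.
Qed.

Lemma reeb_trajectoryE g (gm : R -> E) : reeb_trajectory 2 (@Y R g) (@lamA R) gm ->
  exists j i (b : C4), [/\ window i b, sc b ^+ 2 = 1 &
    forall t, gm t = F g j (mk4 (sc b) (p1 b + reeb1 b * t) (p2 b + reeb2 b * t) (tc b))].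
Proof.
move=> tr.
have [Y0 _ _] := tr 0; have [j [i [b [gm0 wb sb]]]] := Y_patch Y0.
exists j, i, b; split=> // t.
(* These entries are the bump, alone and multiplied by [tau] and [s]. The Reeb field annihilates
   them, so the trajectory keeps its patch, label, [tau] and [s] for all time. *)
have cst n : (n < 3)%N -> forall t, crd (gm t) j i n = crd (gm 0) j i n.
  move=> n3 t'; apply: (@is_derive_0_is_cst _ (fun t => crd (gm t) j i n)) => t''.
  have [Yt dt rt] := tr t''; have [j' [i' [b' [gmt wb' sb']]]] := Y_patch Yt.
  have := is_derive_crd j i n dt; rewrite gmt in rt.
  by rewrite (reeb_vectorE wb' sb' rt) dF_reeb_crd.
have k0 := cutoff_window wb; set k := cutoff _ in k0.
have kn : k != 0 by rewrite gt_eqF.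
have rep t' : exists b' : C4, [/\ gm t' = F g j b', window i b', sc b' ^+ 2 = 1 &
    [/\ cutoff (tc b' + offset R i) = k, tc b' = tc b & sc b' = sc b]].
  have [Yt _ _] := tr t'.
  have c0 : crd (gm t') j i 0 = k by rewrite cst // gm0 crd_F // blkE.
  have [b' [gE wb' sb']] : exists b' : C4, [/\ gm t' = F g j b', window i b' & sc b' ^+ 2 = 1].
    by apply: (Y_repr Yt); rewrite c0.
  exists b'; split=> //.
  have e0 : cutoff (tc b' + offset R i) = k by rewrite -c0 gE crd_F // blkE.
  have e1 := cst 1%N isT t'; have e2 := cst 2%N isT t'.
  rewrite gE gm0 !crd_F // !blkE e0 -/k in e1.
  rewrite gE gm0 !crd_F // !blkE e0 -/k in e2.
  by split=> //; [exact: (mulfI kn e1)|exact: (mulfI kn e2)].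
have der t' n : exists b' : C4, [/\ gm t' = F g j b', window i b',
    cutoff (tc b' + offset R i) = k &
    (n < 11)%N -> is_derive t' (1 : R) (fun t => crd (gm t) j i n)
      (k * (dvec b' (mk4 0 (reeb1 b) (reeb2 b) 0))`_n)].
  have [b' [gE wb' sb' [e0 et es]]] := rep t'.
  exists b'; split=> // n11.
  have [Yt dt rt] := tr t'.
  have := is_derive_crd j i n dt; rewrite gE in rt.
  rewrite (reeb_vectorE wb' sb' rt) crd_mkE // /dFblk.
  rewrite (dblk_out _ _ (window_deck wb')) (dblk_out _ _ (window_deckV wb')).
  have [-> ->] := reeb_ext es et.
  by rewrite eqxx mul1r addr0 mulr0 addr0 /dblk mk4E mulr0 mul0r add0r e0.
(* No lift of the angles along the trajectory is chosen: the cosine and sine entries [n] and [n.+1]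
   satisfy the rotation equation with constant speed [r]. *)
have ode (n : nat) (r : R) (a : C4 -> R) :
    (forall b', (vec b')`_n = cos (a b')) -> (forall b', (vec b')`_n.+1 = sin (a b')) ->
    (forall b', (dvec b' (mk4 0 (reeb1 b) (reeb2 b) 0))`_n = - sin (a b') * r) ->
    (forall b', (dvec b' (mk4 0 (reeb1 b) (reeb2 b) 0))`_n.+1 = cos (a b') * r) ->
    (n.+1 < 11)%N -> forall b', gm t = F g j b' -> window i b' ->
    cutoff (tc b' + offset R i) = k ->
    cos (a b') = cos (a b + r * t) /\ sin (a b') = sin (a b + r * t).
  move=> vc vs dc ds n11 b' gE wb' e0.
  have d1 t' : is_derive t' (1 : R) (fun t => crd (gm t) j i n) (- r * crd (gm t') j i n.+1).
    have [b'' [g'' w'' e'' H]] := der t' n.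
    apply: is_derive_eq (H (ltnW n11)) _.
    by rewrite g'' crd_F // /blk e'' dc vs; ring.
  have d2 t' : is_derive t' (1 : R) (fun t => crd (gm t) j i n.+1) (r * crd (gm t') j i n).
    have [b'' [g'' w'' e'' H]] := der t' n.+1.
    apply: is_derive_eq (H n11) _.
    by rewrite g'' crd_F ?(ltnW n11) // /blk e'' ds vc; ring.
  have [f1 f2] := rotation_ode d1 d2 t.
  move: f1 f2; rewrite gE gm0 !crd_F ?(ltnW n11) // /blk e0 -/k !vc !vs => f1 f2.
  split; apply: (mulfI kn); first by rewrite f1 cosD; ring.
  by rewrite f2 sinD; ring.
have [b' [gE wb' sb' [e0 et es]]] := rep t.
have [c1 s1] := ode 3%N (reeb1 b) (fun b => p1 b) (fun _ => erefl) (fun _ => erefl)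
  (fun b' => ltac:(by rewrite /= mk4E)) (fun b' => ltac:(by rewrite /= mk4E)) isT b' gE wb' e0.
have [c2 s2] := ode 5%N (reeb2 b) (fun b => p2 b) (fun _ => erefl) (fun _ => erefl)
  (fun b' => ltac:(by rewrite /= mk4E)) (fun b' => ltac:(by rewrite /= mk4E)) isT b' gE wb' e0.
by rewrite gE; apply: F_ext; rewrite mk4E.
Qed.

End Orbits.

(** * Closed Reeb orbits are not contractible *)

Section Noncontractible.
Variable R : realType.

Local Notation E := 'rV[R]_ambient.
Local Notation C4 := 'rV[R]_4.
Local Notation P := (R * R)%type.

Lemma cosD2n (x : R) (n : nat) : cos (x + 2 * pi * n%:R) = cos x.
Proof.
elim: n => [|n IH]; first by rewrite mulr0 addr0.
rewrite (_ : x + _ = (x + 2 * pi * n%:R) + pi *+ 2); first by rewrite cosD2pi.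
by rewrite -natr1; ring.
Qed.

Lemma cos_eq1_nat (x : R) : 0 <= x -> cos (2 * pi * x) = 1 -> exists k : nat, x = k%:R.
Proof.
move=> x0 cx; exists (Num.truncn x).
have /andP[k1 k2] := truncn_itv x0; set k := Num.truncn x in k1 k2 *.
apply/eqP; rewrite -subr_eq0; set y := x - k%:R.
have pp := pi_gt0 R.
have cy : cos (2 * pi * y) = 1.
  by rewrite -(cosD2n _ k) -mulrDr /y subrK.
have s0 : sin (pi * y) = 0.
  have e : 2 * pi * y = pi * y + pi * y by ring.
  move: cy; rewrite e cosD -!expr2 => cy; have := cos2Dsin2 (pi * y) => c2.
  by apply/eqP; rewrite -sqrf_eq0; apply/eqP; lra.
apply/negPn/negP => yn.
have y0 : 0 < y by rewrite lt_neqAle eq_sym yn /y subr_ge0.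
have y1 : y < 1 by rewrite /y ltrBlDl natr1.
have : 0 < sin (pi * y).
  by apply: sin_gt0_pi; rewrite mulr_gt0 //= -[X in _ < X]mulr1 ltr_pM2l.
by rewrite s0 ltxx.
Qed.

(* Summing over the labels loses no information on a single patch. *)
Definition lab (i : bool) (n : nat) (x : E) : R := crd x false i n + crd x true i n.

Lemma lab_F g j (b : C4) i n : (n < 11)%N ->
  lab i n (F g j b) = blk i n b + (blk i n (deck b) + blk i n (deckV b)).
Proof.
by move=> n11; rewrite /lab !crd_mkE // /Fblk; case: j g => -[]; rewrite /= ?mul1r ?mul0r ?addr0 ?add0r //; ring.
Qed.

Lemma lab_window g j (b : C4) i n : (n < 11)%N -> window i b -> lab i n (F g j b) = blk i n b.
Proof.
move=> n11 wb; rewrite lab_F // (blk_out _ (window_deck wb)) (blk_out _ (window_deckV wb)).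
by rewrite !addr0.
Qed.

Lemma lab_repr g i x : W g x -> 0 < lab i 0 x -> exists j b, x = F g j b /\ window i b.
Proof.
move=> Wx; rewrite /lab => l0.
have [c0|c0] := ltP 0 (crd x false i 0).
  by have [b [-> wb _]] := W_repr Wx c0; exists false, b.
have c1 : 0 < crd x true i 0 by lra.
by have [b [-> wb _]] := W_repr Wx c1; exists true, b.
Qed.

Lemma cont_lab i n : continuous (lab i n).
Proof. by apply: cont_add; exact: continuous_crd. Qed.

(** For [f] the cosine or the sine, the sum over the two patches is [f (2 * pi * tau)] on the model,
    yet it is continuous on the whole ambient space. *)
Definition twist (f : R -> R) (i : bool) (x : E) : R :=
  lab i 0 x ^+ 2 * f (2 * pi * (lab i 1 x / lab i 0 x)).

Lemma twist_F (f : R -> R) g j (b : C4) i : (forall t, f (t + 2 * pi) = f t) ->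
  twist f i (F g j b) = sq i (tc b) * f (2 * pi * tc b).
Proof.
move=> fper; rewrite /twist !lab_F //.
have e1 : tc (deck b) = tc b - 1 by rewrite mk4E.
have e2 : tc (deckV b) = tc b + 1 by rewrite mk4E.
have out c : ~ window i c -> cutoff (tc c + offset R i) = 0.
  by move=> nw; rewrite cutoff_out //; exact/negP.
have on c : window i c -> cutoff (tc c + offset R i) != 0.
  by move=> /cutoff_window w0; rewrite gt_eqF.
have sqE : sq i (tc b) = cutoff (tc b + offset R i) ^+ 2 +
    cutoff (tc (deck b) + offset R i) ^+ 2 + cutoff (tc (deckV b) + offset R i) ^+ 2.
  by rewrite e1 e2.
rewrite sqE !blkE.
have [wb|nwb] := pselect (window i b).
  rewrite (out _ (window_deck wb)) (out _ (window_deckV wb)) !mul0r !expr0n !addr0.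
  by rewrite [_ * tc b]mulrC mulfK ?on.
rewrite (out _ nwb) mul0r expr0n !add0r.
have [wd|nwd] := pselect (window i (deck b)).
  rewrite (out _ (window_deck_deckV wd)) mul0r expr0n !addr0.
  rewrite [_ * tc (deck b)]mulrC mulfK ?on // e1 -(fper (2 * pi * _)).
  by congr (_ * f _); ring.
rewrite (out _ nwd) mul0r expr0n !add0r.
have [wV|nwV] := pselect (window i (deckV b)).
  rewrite [_ * tc (deckV b)]mulrC mulfK ?on // e2 -(fper (2 * pi * tc b)).
  by congr (_ * f _); ring.
by rewrite (out _ nwV) expr0n !mul0r.
Qed.

(** The quotient giving [tau] is uncontrolled where the bump vanishes, but there the squared factor
    and the bound on [f] squeeze the product to 0. *)
Lemma cont_twist f i : continuous f -> (forall t, `|f t| <= 1) -> continuous (twist f i).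
Proof.
move=> cf f1 x; have [l0|l0] := eqVneq (lab i 0 x) 0.
  have c2 : continuous (fun x => lab i 0 x ^+ 2).
    by apply: cont_mul; exact: cont_lab.
  have t0 : twist f i x = 0 by rewrite /twist l0 expr0n mul0r.
  have c2x : (fun x => lab i 0 x ^+ 2) y @[y --> x] --> (0 : R).
    by have := c2 x; rewrite /continuous_at l0 expr0n.
  rewrite /continuous_at t0.
  apply: (@squeeze_cvgr _ (nbhs x) (nbhs_filter x) R (fun y => - lab i 0 y ^+ 2) (fun y => lab i 0 y ^+ 2)).
  - apply: nearW => y; rewrite -ler_norml /twist normrM ger0_norm ?sqr_ge0 //.
    by rewrite ler_piMr ?sqr_ge0.
  - by rewrite -oppr0; exact: cvgN c2x.
  - exact: c2x.
have c1 : {for x, continuous (fun y => lab i 0 y ^+ 2)}.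
  by apply: cont_mul; exact: cont_lab.
have ci : {for x, continuous (fun y => 2 * pi * (lab i 1 y / lab i 0 y))}.
  apply: continuousM; first exact: cst_continuous.
  by apply: continuousM; [exact: cont_lab|exact: (cvgV l0 (@cont_lab i 0 x))].
exact: (continuousM c1 (continuous_comp ci (cf _))).
Qed.

Definition em (b : C4) : C4 := mk4 (cos (p1 b)) (sin (p1 b)) (cos (p2 b)) (sin (p2 b)).
(* [em] is the point of the torus; [untw] is the inverse monodromy acting on it. *)
Definition untw (q : C4) : C4 := mk4 (p2 q) (tc q)
  (sc q * p2 q + p1 q * tc q) (p1 q * p2 q - sc q * tc q).

Lemma untw_em b : untw (em b) = em (deckV b).
Proof. by apply: mk4_inj; rewrite !mk4E ?cosB ?sinB. Qed.

Lemma iter_untw_em k b : iter k untw (em b) = em (iter k (@deckV R) b).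
Proof. by elim: k => //= k ->; rewrite untw_em. Qed.

Lemma em_deck b : untw (em (deck b)) = em b.
Proof. by rewrite untw_em deckK. Qed.

Definition fib (i : bool) (x : E) : C4 := mk4 (lab i 3 x / lab i 0 x) (lab i 4 x / lab i 0 x)
  (lab i 5 x / lab i 0 x) (lab i 6 x / lab i 0 x).

Lemma cont_fib i x : 0 < lab i 0 x -> {for x, continuous (fib i)}.
Proof.
pose U := [set x | 0 < lab i 0 x].
have oU : open U.
  by apply: (@open_comp _ _ (lab i 0) [set r : R | 0 < r]) => [y _|]; [exact: cont_lab|exact: open_gt].
have cl n : Ck 0 U (fun x => lab i n x / lab i 0 x).
  move=> y Uy; apply: continuousM; first exact: cont_lab.
  have l0 : lab i 0 y != 0 by rewrite gt_eqF.
  exact: (cvgV l0 (@cont_lab i 0 y)).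
by have H := Ck_mk4 oU (cl 3%N) (cl 4%N) (cl 5%N) (cl 6%N); exact: (H x).
Qed.

Lemma cont_untw : continuous untw.
Proof.
have cc n : Ck 0 setT (fun q : C4 => q 0 n : R) by apply: Ck_coord; exact: openT.
have oT := @openT C4.
have c3 : Ck 0 setT (fun q : C4 => sc q * p2 q + p1 q * tc q).
  by apply: (Ck_add oT); apply: Ck_mul.
have c4 : Ck 0 setT (fun q : C4 => p1 q * p2 q - sc q * tc q).
  by apply: (Ck_add oT); [exact: Ck_mul|apply: (Ck_opp oT); exact: Ck_mul].
by move=> q; have := Ck_mk4 oT (cc _) (cc _) c3 c4; apply.
Qed.

Lemma cont_iter_untw k : continuous (iter k untw).
Proof.
elim: k => [|k IH] q; first exact: cvg_id.
exact: (continuous_comp (IH q) (@cont_untw _)).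
Qed.

Lemma fib_F g j i b : window i b -> fib i (F g j b) = em b.
Proof.
move=> wb; have k0 := cutoff_window wb; have kn : cutoff (tc b + offset R i) != 0 by rewrite gt_eqF.
by rewrite /fib !lab_window // !blkE; apply: mk4_inj; rewrite mulrC mulKf.
Qed.

Lemma affine_deckV k (c x : C4) r :
  iter k (@deckV R) (c + r *: x) = iter k (@deckV R) c + r *: iter k (@ldeckV R) x.
Proof.
elim: k => //= k ->; rewrite -[LHS]mk4K -[RHS]mk4K.
by apply: mk4_inj; rewrite !(mk4E, mxE) ?mk4E; ring.
Qed.

Lemma ldeckV_eq0 k (x : C4) : p1 (iter k (@ldeckV R) x) = 0 -> p2 (iter k (@ldeckV R) x) = 0 ->
  p1 x = 0 /\ p2 x = 0.
Proof.
elim: k => //= k IH; rewrite !mk4E => e2 e1; apply: IH => //.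
by rewrite e2 subr0 in e1.
Qed.

Section Disk.
Variables (g : bool) (u : P -> E).
Hypothesis cu : {within @disk R, continuous u}.
Hypothesis Wu : forall z, disk z -> W g (u z).

(** The difference is asked to be a natural number, so that moving fibres back to one torus takes
    iterates of [untw] and never of its inverse. *)
Definition lifts_height (t : P -> R) := forall z i j w, disk z -> u z = F g j w ->
  window i w -> exists k : nat, t z = tc w + k%:R.

Lemma lift_height : exists2 t : P -> R, continuous t & lifts_height t.
Proof.
have cper t : cos (t + 2 * pi) = cos t :> R by have := cosD2n t 1; rewrite mulr1.
have sper t : sin (t + 2 * pi) = sin t :> R.
  by rewrite sinD mulr_natl cos2pi sin2pi mulr1 mulr0 addr0.
pose c x := twist cos false x + twist cos true x.
pose s x := twist sin false x + twist sin true x.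
have cE j (b : C4) : - (1 / 2) < tc b < 1 -> c (F g j b) = cos (2 * pi * tc b).
  by move=> tb; rewrite /c !twist_F // -mulrDl sq_sum // mul1r.
have sE j (b : C4) : - (1 / 2) < tc b < 1 -> s (F g j b) = sin (2 * pi * tc b).
  by move=> tb; rewrite /s !twist_F // -mulrDl sq_sum // mul1r.
have cc : continuous c.
  apply: cont_add; apply: cont_twist => [|t]; try exact: continuous_cos;
    by rewrite ler_norml cos_geN1 cos_le1.
have cs : continuous s.
  apply: cont_add; apply: cont_twist => [|t]; try exact: continuous_sin;
    by rewrite ler_norml sin_geN1 sin_le1.
have c2 z : disk z -> c (u z) ^+ 2 + s (u z) ^+ 2 = 1.
  move=> /Wu /W_patch[j [i [b [-> wb _]]]].
  by have reg := window_region wb; rewrite cE // sE // cos2Dsin2.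
have [t0 ct0 t0P] := circle_lift (cont_comp cu cc) (cont_comp cu cs) c2.
have : compact (t0 @` @disk R).
  by apply: continuous_compact; [exact: continuous_subspaceT|exact: disk_compact].
move=> /compact_bounded[M [_ bM]].
have pp := pi_gt0 R; have p2p : 0 < 2 * pi :> R by rewrite mulr_gt0.
have bd z : disk z -> `|t0 z| <= M + 1.
  by move=> dz; apply: (bM (M + 1)); [rewrite ltrDl|exists z].
(* The lift is bounded on the compact disk. In units of [2 * pi] it is at least [- m], so adding
   [m.+1] raises it above all values of [tau], which are below 1 in the windows. *)
pose m := Num.bound `|(M + 1) / (2 * pi)|.
have mE : (M + 1) / (2 * pi) < m%:R.
  exact: le_lt_trans (ler_norm _) (archi_boundP (normr_ge0 _)).
exists (fun z => t0 z * (2 * pi)^-1 + m.+1%:R).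
  apply: cont_add; last exact: cst_continuous.
  by apply: cont_mul => //; exact: cst_continuous.
move=> z i j w dz uz ww; have reg := window_region ww.
have [k kE] : exists k : nat, t0 z * (2 * pi)^-1 + m.+1%:R - tc w = k%:R; last first.
  by exists k; rewrite -kE [RHS]addrC subrK.
apply: cos_eq1_nat.
  have : - m%:R <= t0 z * (2 * pi)^-1.
    rewrite ler_pdivlMr // -lerN2 -mulNr opprK.
    apply: le_trans (ler_norm _) _; rewrite normrN; apply: le_trans (bd z dz) _.
    by rewrite -ler_pdivrMr // ltW.
  by move: reg; rewrite -natr1; lra.
have -> : 2 * pi * (t0 z * (2 * pi)^-1 + m.+1%:R - tc w) =
    t0 z - 2 * pi * tc w + 2 * pi * m.+1%:R.
  by rewrite mulrBr mulrDr [2 * pi * (t0 z / _)]mulrC divfK ?gt_eqF // addrAC.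
have [e1 e2] : c (u z) = cos (t0 z) /\ s (u z) = sin (t0 z) := t0P z dz.
by rewrite cosD2n; apply: cos_sin_inj; rewrite -?e1 -?e2 uz ?cE ?sE.
Qed.

Variable t : P -> R.
Hypothesis ct : continuous t.
Hypothesis tP : lifts_height t.

(* The lift [t] of [tau] to the disk determines a lift of the torus point to the
   universal cover in the direction of [tau]. *)
Definition turns i z := Num.truncn (t z + offset R i).
Definition fibre_at i z := iter (turns i z) untw (fib i (u z)).
Definition fibre z := if 0 < lab false 0 (u z) then fibre_at false z else fibre_at true z.

Lemma turns_window i (w : C4) z k : window i w -> t z = tc w + k%:R ->
  k%:R < t z + offset R i < k.+1%:R.
Proof.
rewrite /window -natr1 => + ->; move: (tc w) (offset R i) (k%:R) => a o c; lra.
Qed.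

Lemma fibre_at_em i j w z k : u z = F g j w -> window i w -> t z = tc w + k%:R ->
  fibre_at i z = iter k untw (em w).
Proof.
move=> uz ww tz; rewrite /fibre_at uz fib_F //; congr iter.
apply: truncn_def; have /andP[h1 h2] := turns_window ww tz.
by rewrite ltW.
Qed.

Lemma lab_pos i j (w : C4) : window i w -> 0 < lab i 0 (F g j w).
Proof. by move=> ww; rewrite lab_window // blkE cutoff_window. Qed.

(** With [w] the representative in window [false], patch [true] sees [w] itself if [tau < 1 / 2] and
    [deck w] if [tau > 1 / 2]. In the latter case it counts one more turn, and the extra [untw]
    undoes [deck]. At [tau = 1 / 2] it is inactive. *)
Lemma fibre_consistent z : disk z -> 0 < lab false 0 (u z) -> 0 < lab true 0 (u z) ->
  fibre_at true z = fibre_at false z.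
Proof.
move=> dz l0 l1; have [j [w [uz ww]]] := lab_repr (Wu dz) l0.
have [k tz] := tP dz uz ww; rewrite (fibre_at_em uz ww tz).
have w01 : 0 < tc w < 1 by move: ww; rewrite /window /offset addr0.
have [h|h|h] := ltgtP (tc w) (1 / 2).
- by apply: fibre_at_em uz _ tz; rewrite /window /offset; lra.
- have uz' : u z = F g (j (+) g) (deck w) by rewrite F_deck //; lra.
  have wd : window true (deck w) by rewrite /window /offset mk4E; lra.
  rewrite (@fibre_at_em _ _ _ _ k.+1 uz' wd); last by rewrite mk4E tz -natr1; ring.
  by rewrite iterSr em_deck.
- move: l1; rewrite uz lab_F // !blk_out ?addr0 ?ltxx // /window /offset ?mk4E; lra.
Qed.

Lemma fibreE i z : disk z -> 0 < lab i 0 (u z) -> fibre z = fibre_at i z.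
Proof.
move=> dz; rewrite /fibre; case: i => l1; last by rewrite l1.
by case: ifP => // l0; rewrite fibre_consistent.
Qed.

Lemma fibre_em i j w z : disk z -> u z = F g j w -> window i w ->
  exists2 k, t z = tc w + k%:R & fibre z = em (iter k (@deckV R) w).
Proof.
move=> dz uz ww; have [k tz] := tP dz uz ww; exists k => //.
rewrite (@fibreE i) ?uz ?lab_pos // (fibre_at_em uz ww tz).
by rewrite iter_untw_em.
Qed.

(** Near a point of the disk one fixed patch stays active, and the number of turns is locally
    constant there because [t + offset] lies strictly between consecutive integers. *)
Lemma cont_fibre : {within @disk R, continuous fibre}.
Proof.
apply/subspace_continuousP => z dz.
have [j [i [w [uz ww _]]]] := W_patch (Wu dz).
have lz : 0 < lab i 0 (u z) by rewrite uz lab_pos.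
have [k tz] := tP dz uz ww; have tk := turns_window ww tz.
have tz' : turns i z = k by apply: truncn_def; move/andP: tk => [/ltW -> ->].
have cuz : u x @[x --> within (@disk R) (nbhs z)] --> u z.
  by move/subspace_continuousP: cu; apply.
have cg : (fun x => iter k untw (fib i x)) y @[y --> u z] --> iter k untw (fib i (u z)).
  exact: (continuous_comp (cont_fib lz) (@cont_iter_untw k _)).
have lim := cvg_comp _ _ cuz cg.
change (fibre x @[x --> within (@disk R) (nbhs z)] --> fibre z).
rewrite (@fibreE i z dz lz) /fibre_at tz'.
apply: cvg_trans lim; apply: near_eq_cvg.
have n1 : \forall x \near within (@disk R) (nbhs z), 0 < lab i 0 (u x).
  have : nbhs (lab i 0 (u z)) [set r : R | 0 < r].
    by apply: open_nbhs_nbhs; split; [exact: open_gt|].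
  by move=> /(@cont_lab i 0 (u z)) /cuz.
have n2 : \forall x \near nbhs z, k%:R < t x + offset R i < k.+1%:R.
  have ct' : continuous (fun x => t x + offset R i).
    by apply: cont_add ct _; exact: cst_continuous.
  have : nbhs (t z + offset R i) [set r : R | k%:R < r < k.+1%:R].
    apply: open_nbhs_nbhs; split=> //.
    rewrite (_ : [set r : R | _] = `]k%:R, k.+1%:R[%classic); first exact: itv_open.
    by rewrite eqEsubset; split=> r; rewrite /= in_itv.
  by move=> /(ct' z).
have n3 : \forall x \near within (@disk R) (nbhs z), disk x by exact: withinT.
have n2' : \forall x \near within (@disk R) (nbhs z), k%:R < t x + offset R i < k.+1%:R.
  exact: cvg_within n2.
apply: filterS3 n1 n2' n3 => x l1 tx dx /=.
rewrite (@fibreE i x dx l1) /fibre_at (_ : turns i x = k) //.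
by apply: truncn_def; move/andP: tx => [/ltW -> ->].
Qed.

End Disk.

Lemma reeb_noncontractible g gm (T : R) :
  reeb_orbit 2 (@Y R g) (@lamA R) gm T -> ~ contractible (@Y R g) gm T.
Proof.
move=> [T0 tr per] [u [cu Yu bu]].
have Wu z : disk z -> W g (u z) by move=> /Yu /Y_W.
have [t ct tP] := lift_height cu Wu.
have [j [i [b [wb sb gmE]]]] := reeb_trajectoryE tr.
pose r1 := reeb1 b; pose r2 := reeb2 b; pose x : C4 := mk4 0 r1 r2 0.
have gmE' s : gm s = F g j (b + s *: x).
  rewrite gmE; congr F; rewrite -[RHS]mk4K.
  by apply: mk4_inj; rewrite /x !(mk4E, mxE) ?mk4E /r1 /r2; ring.
have tbs s : tc (b + s *: x) = tc b by rewrite /x !(mk4E, mxE) mulr0 addr0.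
have wbs s : window i (b + s *: x) by rewrite /window tbs.
have uE r : u (circle_point r) = F g j (b + (r * T) *: x) by rewrite bu gmE'.
have [k0 tk0 _] := fibre_em Wu tP (circle_disk 0) (uE 0) (wbs _).
have bd r : 0 <= r <= 1 -> fibre u t (circle_point r) =
    em (iter k0 (@deckV R) b + (r * T) *: iter k0 (@ldeckV R) x).
  move=> /andP[r0 r1'].
  have [k tk ->] := fibre_em Wu tP (circle_disk r) (uE r) (wbs _).
  suff -> : k = k0 by rewrite affine_deckV.
  (* Along the arc from [circle_point 0] to [circle_point r] the difference of the lift and [tc b]
     is continuous and integral, so the number of turns does not change. *)
  pose f s := 2 * pi * (t (circle_point (r * s)) - tc b).
  have : f 0 = f 1.
    apply: cos1_const.
      apply: continuous_subspaceT; apply: cont_mul; first exact: cst_continuous.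
      apply: cont_add; last exact: cst_continuous.
      apply: (@cont_comp _ _ _ (fun s => circle_point (r * s)) t) => //.
      apply: (@cont_comp _ _ _ (fun s => r * s) (@circle_point R)); last exact: cont_circle.
      by apply: cont_mul; [exact: cst_continuous|move=> ?; exact: cvg_id].
    move=> s _; rewrite /f.
    have [k' -> _] := fibre_em Wu tP (circle_disk (r * s)) (uE (r * s)) (wbs _).
    by rewrite tbs [_ + k'%:R]addrC addrK -[2 * pi * _]add0r cosD2n cos0.
  rewrite /f mulr0 mulr1 tk tk0 !tbs ![_ + _%:R]addrC !addrK => /esym.
  have p0 : 2 * pi != 0 :> R by rewrite gt_eqF // mulr_gt0 // pi_gt0.
  by move=> /(mulfI p0) /eqP; rewrite eqr_nat => /eqP.
have cQ := cont_fibre cu Wu ct tP.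
have cn n : {within @disk R, continuous (fun z => fibre u t z 0 n)}.
  exact: (cont_comp cQ (@coord_continuous _ _ _ 0 n)).
have Qem z : disk z -> exists c, fibre u t z = em c.
  move=> dz; have [j' [i' [w [uz ww _]]]] := W_patch (Wu z dz).
  by have [k _ ->] := fibre_em Wu tP dz uz ww; eexists.
have v1 : p1 (iter k0 (@ldeckV R) x) = 0.
  apply: (mulfI (lt0r_neq0 T0)); rewrite mulr0.
  apply: (no_winding (cn o0) (cn o1) (a := p1 (iter k0 (@deckV R) b))).
    by move=> z /Qem[c ->]; rewrite !mk4E cos2Dsin2.
  move=> r r01; rewrite bd // !mk4E !mxE.
  by rewrite -[_ * _ * r]mulrAC [T * r]mulrC.
have v2 : p2 (iter k0 (@ldeckV R) x) = 0.
  apply: (mulfI (lt0r_neq0 T0)); rewrite mulr0.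
  apply: (no_winding (cn o2) (cn o3) (a := p2 (iter k0 (@deckV R) b))).
    by move=> z /Qem[c ->]; rewrite !mk4E cos2Dsin2.
  move=> r r01; rewrite bd // !mk4E !mxE.
  by rewrite -[_ * _ * r]mulrAC [T * r]mulrC.
have [] := ldeckV_eq0 v1 v2; rewrite !mk4E; exact: reeb_neq0.
Qed.

End Noncontractible.

(** * The contact structure *)

Lemma continuous_mx (R : realType) (T : topologicalType) m n (f : T -> 'M[R]_(m, n)) x :
  (forall i j, {for x, continuous (fun y => f y i j)}) -> {for x, continuous f}.
Proof.
move=> cf; rewrite (_ : f = \sum_(i < m) \sum_(j < n) (fun y => f y i j *: delta_mx i j)).
  elim/big_ind : _ => [|g h cg ch|i _]; [exact: cst_continuous|exact: continuousD|].
  elim/big_ind : _ => [|g h cg ch|j _]; [exact: cst_continuous|exact: continuousD|].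
  exact: continuousZr_tmp.
apply/funext => y; rewrite fct_sumE {1}[f y]matrix_sum_delta; apply: eq_bigr => i _.
by rewrite fct_sumE.
Qed.

Lemma combE (R : realType) n (a c : R) (u w : 'rV[R]_n) k :
  (a *: u + c *: w) 0 k = a * u 0 k + c * w 0 k.
Proof. by rewrite !mxE. Qed.

Section ContactForm.
Variable R : realType.

Local Notation E := 'rV[R]_ambient.
Local Notation C4 := 'rV[R]_4.
Local Notation golden := (golden R).
Local Notation growth := (growth R).
Local Notation eU b := (expR (growth * tc b)).
Local Notation eV b := (expR (- (growth * tc b))).

Lemma ldeckK (w : C4) : ldeckV (ldeck w) = w.
Proof. by rewrite -[RHS]mk4K /ldeckV /ldeck; apply: mk4_inj; rewrite !mk4E; ring. Qed.

Lemma dF_deck g j (b w : C4) : 0 <= tc b <= 3 / 2 ->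
  dF g (j (+) g) (deck b) (ldeck w) = dF g j b w.
Proof.
move=> tb; apply: eq_mkE => j' i n _; rewrite /dFblk deckK ldeckK addbK.
have sb := offset_bd R i.
rewrite [dblk i n (deck (deck b)) _]dblk_out; last by rewrite /window !mk4E; lra.
rewrite [dblk i n (deckV b) _]dblk_out; last by rewrite /window !mk4E; lra.
by rewrite add0r addr0 addrC.
Qed.

Lemma dF_lin g j (b : C4) (a c : R) (u w : C4) :
  dF g j b (a *: u + c *: w) = a *: dF g j b u + c *: dF g j b w.
Proof. by rewrite -!diff_F linearD !linearZ. Qed.

Lemma dF0 g j (b : C4) : dF g j b 0 = 0.
Proof. by rewrite -diff_F linear0. Qed.

(* The contact planes are spanned by [d/dtau] and by the kernel of [lam0] in
   the torus directions. *)
Definition e1 : C4 := mk4 0 0 0 1.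
(** Normalizes the frame to [om0 b e1 (e2 b) = 1] on the boundary, so that it is a symplectic basis
    of the contact plane. *)
Definition scale2 : R := (2 * growth * (golden + golden^-1))^-1.
Definition e2 (b : C4) : C4 := mk4 0 (scale2 * sc b * cft2 b) (- (scale2 * sc b * cft1 b)) 0.

Lemma scale2E : scale2 * (2 * growth * (golden + golden^-1)) = 1.
Proof.
have gp := golden_gt0 R; have Tp := growth_gt0 R.
have gI : 0 < golden^-1 by rewrite invr_gt0.
by rewrite mulVf // gt_eqF // !mulr_gt0 // addr_gt0.
Qed.

Lemma eUV (b : C4) : eU b * eV b = 1.
Proof. by rewrite -expRD subrr expR0. Qed.

(** In eigencoordinates the exponentials cancel in the determinant of the form and its [tau]
    derivative, leaving [2 * growth * s * (golden + golden^-1)]. This is the contact condition; the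
    factor [s] is why it holds at the ends of the interval. *)
Lemma wronskian (b : C4) : sc b ^+ 2 = 1 ->
  scale2 * sc b * (dcft1 b e1 * cft2 b - dcft2 b e1 * cft1 b) = 1.
Proof.
move=> sb; rewrite /dcft1 /dcft2 /cft1 /cft2 !mk4E.
have h1 := eUV b; have h2 := scale2E; have h3 := golden_inv R.
set U := eU b in h1 *; set V := eV b in h1 *; set s := sc b in sb *.
apply: etrans h2; move: (scale2) (growth) => c T.
set p := golden^-1.
ring: sb h1.
Qed.

Lemma om0_e12 (b : C4) : sc b ^+ 2 = 1 -> om0 b e1 (e2 b) = 1.
Proof.
by move=> sb; rewrite -[RHS](wronskian sb) /om0 /e2 !mk4E; ring.
Qed.

Lemma lam0_e2 (b : C4) : lam0 b (e2 b) = 0.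
Proof. by rewrite /lam0 !mk4E; ring. Qed.

(** Cramer's rule in the torus directions: [wronskian] supplies the determinant, and the defect in
    each torus component is a multiple of [lam0 b w]. *)
Lemma contact_decomp (b w : C4) : sc b ^+ 2 = 1 -> sc w = 0 -> lam0 b w = 0 ->
  w = tc w *: e1 + om0 b e1 w *: e2 b.
Proof.
move=> sb sw lw; rewrite -[LHS]mk4K -[RHS]mk4K.
have h := wronskian sb.
have oE : om0 b e1 w = dcft1 b e1 * p1 w + dcft2 b e1 * p2 w by rewrite /om0 !mk4E; ring.
apply: mk4_inj; rewrite !combE !mk4E ?oE.
- by rewrite sw; ring.
- rewrite -[LHS]mul1r -h; apply/eqP; rewrite -subr_eq0; apply/eqP.
  transitivity (- (scale2 * sc b * dcft2 b e1 * lam0 b w)); last by rewrite lw mulr0 oppr0.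
  by rewrite /lam0; ring.
- rewrite -[LHS]mul1r -h; apply/eqP; rewrite -subr_eq0; apply/eqP.
  transitivity (scale2 * sc b * dcft1 b e1 * lam0 b w); last by rewrite lw mulr0.
  by rewrite /lam0; ring.
- by ring.
Qed.

Lemma om0_lin (b : C4) (a c : R) (u w z : C4) :
  om0 b z (a *: u + c *: w) = a * om0 b z u + c * om0 b z w.
Proof. by rewrite /om0 /dcft1 /dcft2 !combE; ring. Qed.

Lemma om0_anti (b u w : C4) : om0 b u w = - om0 b w u.
Proof. by rewrite /om0; ring. Qed.

Definition xi g := contact_boundary 2 (@W R g) (@lamA R).

Section Patch.
Variables (g j i : bool) (b : C4).
Hypothesis wb : window i b.
Hypothesis sb : sc b ^+ 2 = 1.
Let reg := window_region wb.

Lemma xi_F v : xi g (F g j b) v <-> exists a c : R,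
  v = a *: dF g j b e1 + c *: dF g j b (e2 b).
Proof.
split=> [[/(Y_tangent g j wb sb)[w sw ->]]|[a [c ->]]].
  rewrite eval_lamA_F // => lw; exists (tc w), (om0 b e1 w).
  by rewrite -dF_lin -contact_decomp.
rewrite -dF_lin; split.
  by apply/(Y_tangent g j wb sb); eexists; last exact: erefl; rewrite combE !mk4E; ring.
rewrite eval_lamA_F // /lam0 !combE !mk4E; ring.
Qed.

Lemma ext_frame x (a c a' c' : R) :
  ext_d (@lamA R) x (a *: dF g j b e1 + c *: dF g j b (e2 b))
     (a' *: dF g j b e1 + c' *: dF g j b (e2 b)) = a * c' - c * a'.
Proof.
rewrite -!dF_lin ext_lamA_F // om0_lin.
rewrite (om0_anti _ _ e1) (om0_anti _ _ (e2 b)) !om0_lin om0_e12 //.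
have self u : om0 b u u = 0 by rewrite /om0; ring.
rewrite !self (om0_anti _ (e2 b)) om0_e12 //; ring.
Qed.

Lemma frame_free (a c : R) : a *: dF g j b e1 + c *: dF g j b (e2 b) = 0 -> a = 0 /\ c = 0.
Proof.
move=> h; have z : 0 *: dF g j b e1 + 0 *: dF g j b (e2 b) = 0 by rewrite !scale0r addr0.
have h1 := ext_frame 0 0 1 a c; have h2 := ext_frame 0 1 0 a c.
have e0 u : ext_d (@lamA R) 0 u 0 = 0.
  rewrite ext_lamA; apply: big1 => j' _; apply: big1 => i' _.
  have crd0 n : crd (0 : E) j' i' n = 0 by rewrite /crd; case: insub => // k; rewrite mxE.
  by rewrite /pairB !crd0; ring.
by move: h1 h2; rewrite h !e0; split; lra.
Qed.

Lemma alpha_neq0 : exists2 v, tangent 3 (@Y R g) (F g j b) v & eval1 (@lamA R) (F g j b) v != 0.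
Proof.
exists (dF g j b (mk4 0 (cft1 b) (cft2 b) 0)).
  by apply/(Y_tangent g j wb sb); eexists; last exact: erefl; rewrite mk4E.
rewrite eval_lamA_F // /lam0 !mk4E -!expr2 paddr_eq0 ?sqr_ge0 // !sqrf_eq0.
apply/negP => /andP[/eqP c1 /eqP c2].
have := wronskian sb; rewrite c1 c2 !mulr0 subrr mulr0 => /eqP.
by rewrite eq_sym oner_eq0.
Qed.

End Patch.

Lemma contact_form_lamA g : contact_form 2 (@Y R g) (xi g) (@lamA R).
Proof.
split; first exact: smooth_lamA.
- by move=> p v _.
- by move=> p /Y_patch[j [i [b [-> wb sb]]]]; exact: (alpha_neq0 g j wb sb).
move=> p v /Y_patch[j [i [b [-> wb sb]]]] /(xi_F g j wb sb)[a [c ->]] vn.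
have [c0|cn] := eqVneq c 0; last first.
  exists (1 *: dF g j b e1 + 0 *: dF g j b (e2 b)); first by apply/(xi_F g j wb sb); eexists; eexists.
  by rewrite (ext_frame g j wb sb) mulr0 sub0r mulr1 oppr_eq0.
exists (0 *: dF g j b e1 + 1 *: dF g j b (e2 b)); first by apply/(xi_F g j wb sb); eexists; eexists.
rewrite (ext_frame g j wb sb) mulr0 subr0 mulr1; apply: contraNneq vn => ->.
by rewrite c0 !scale0r addr0.
Qed.

Lemma closed_contact g : closed_contact_manifold 2 (@Y R g) (xi g).
Proof. by split; [exact: Y_closed|exists (@lamA R); exact: contact_form_lamA]. Qed.

Lemma Y_adc g : adc 2 (@Y R g) (xi g).
Proof.
exists (fun=> @lamA R), (fun k => k.+1%:R); split.
- split=> k; first exact: contact_form_lamA.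
  exists (fun=> 1); split=> [p _|p _|p v _] //; last by rewrite mul1r.
  exists setT, (fun=> 1); split=> //; [exact: openT|by move=> n; exact: Ck_cst].
- by split=> k; rewrite ?ltr0n // ltr_nat.
- apply/cvgryPge => A; exists (Num.bound `|A|) => // n /= h.
  apply: le_trans (ler_norm A) _; apply: le_trans (ltW (archi_boundP (normr_ge0 A))) _.
  by rewrite ler_nat (leq_trans h).
- by move=> k gm T orb /(reeb_noncontractible orb).
Qed.

(** * Descent of functions to the quotient *)

Definition same_point (b b' : C4) := [/\ sc b = sc b', tc b = tc b',
  cos (p1 b) = cos (p1 b') /\ sin (p1 b) = sin (p1 b') &
  cos (p2 b) = cos (p2 b') /\ sin (p2 b) = sin (p2 b')].

(* What is needed for a function of [(j, b)] to descend to [Y g]. *)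
Record compatible g (V : Type) (f : bool -> C4 -> V) : Prop := Compatible {
  compatible_ext : forall j b b', same_point b b' -> f j b = f j b';
  compatible_deck : forall j (b : C4), sc b ^+ 2 = 1 -> 1 / 2 < tc b < 1 ->
    f (j (+) g) (deck b) = f j b }.

Section Descent.
Variables (g : bool) (V : Type) (f : bool -> C4 -> V).
Hypothesis cf : compatible g f.
Let f_ext := compatible_ext cf.
Let f_deck := compatible_deck cf.

Lemma same_window j i (b b' : C4) : window i b -> window i b' -> F g j b = F g j b' ->
  f j b = f j b'.
Proof.
move=> wb wb' FF; have k0 := cutoff_window wb.
have e n : (n < 11)%N -> blk i n b = blk i n b' by move=> n11; rewrite -!(crd_F g j) ?FF.
have := e 0%N isT; rewrite !blkE => ck.
have kn : cutoff (tc b + offset R i) != 0 by rewrite gt_eqF.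
have e' n : (n < 11)%N -> (vec b)`_n = (vec b')`_n.
  by move=> n11; apply: (mulfI kn); rewrite {2}ck; exact: e.
by apply: f_ext; split; [exact: (e' 2%N)|exact: (e' 1%N)|
  split; [exact: (e' 3%N)|exact: (e' 4%N)]|split; [exact: (e' 5%N)|exact: (e' 6%N)]].
Qed.

(** Two representatives in windows agree up to periods of the angles, possibly after one [deck] in
    either direction; compatibility with [deckV] is compatibility with [deck] read backwards. *)
Lemma descent_eq j i (b : C4) j' i' (b' : C4) : window i b -> window i' b' -> sc b' ^+ 2 = 1 ->
  F g j b = F g j' b' -> f j b = f j' b'.
Proof.
move=> wb wb' sb' FF; have := offset_bd R i'; have := offset_bd R i => hi hi'.
have : 0 < crd (F g j b) j i 0 by rewrite crd_F // blkE cutoff_window.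
rewrite FF crd_mkE // /Fblk.
have [wi|nwi] := pselect (window i b').
  rewrite (blk_out _ (window_deck wi)) (blk_out _ (window_deckV wi)) addr0 mulr0 addr0.
  case: eqVneq => [e _|_]; last by rewrite mul0r ltxx.
  by rewrite -e in FF *; exact: (same_window wb wi).
rewrite (blk_out _ nwi) mulr0 add0r.
case: eqVneq => [e|_]; last by rewrite mul0r ltxx.
have [wd|nwd] := pselect (window i (deck b')).
  move: wd wb' => wd; rewrite /window => wb'.
  have tb : 1 / 2 < tc b' < 1.
    by move: wd wb'; rewrite /window mk4E; move: (tc b') (offset R i) (offset R i') hi hi' => *; lra.
  move=> _; rewrite -(f_deck j' sb' tb) -e; apply: (same_window wb wd).
  by rewrite FF e F_deck //; move: tb; move: (tc b') => *; lra.
rewrite (blk_out _ nwd) add0r.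
have [wV|nwV] := pselect (window i (deckV b')); last by rewrite (blk_out _ nwV) mulr0 ltxx.
have tb : 1 / 2 < tc (deckV b') < 1.
  by move: wV wb'; rewrite /window mk4E; move: (tc b') (offset R i) (offset R i') hi hi' => *; lra.
have sV : sc (deckV b') ^+ 2 = 1 by rewrite mk4E sqrrN.
move=> _; have := f_deck (j' (+) g) sV tb; rewrite deckVK addbK => ->.
rewrite -e; apply: (same_window wb wV).
by rewrite FF e F_deckV //; move: tb; rewrite mk4E; move: (tc b') => *; lra.
Qed.

(** A representative is picked by choice; the default [(true, 0)] enters only off [Y g]. *)
Definition descent (x : E) : V :=
  let jb := xget (true, 0) [set jb : bool * C4 |
    [/\ x = F g jb.1 jb.2, sc jb.2 ^+ 2 = 1 & exists i, window i jb.2]] in f jb.1 jb.2.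

Lemma descentE j i (b : C4) : window i b -> sc b ^+ 2 = 1 -> descent (F g j b) = f j b.
Proof.
move=> wb sb; rewrite /descent; case: xgetP => [jb' -> [FF s' [i' w']]|/(_ (j, b)) []].
  by apply/esym; apply: (descent_eq wb w').
by split=> //; exists i.
Qed.

End Descent.

Lemma descent_Gb g (V : Type) (f : bool -> C4 -> V) j i q1 q2 x :
  compatible g f -> Y g x -> Ub j i q1 q2 x -> descent g f x = f j (Gb j i q1 q2 x).
Proof.
move=> cf Yx Ux; have [c0 _ _] := Ux.
have [b [xE wb sb]] := Y_repr Yx c0.
move: Ux; rewrite xE => Ux; have [es et [wG _ _] FG] := Gb_inv wb Ux.
by rewrite -{1}FG (descentE cf j wG) // es.
Qed.

Lemma continuous_descent g (V : topologicalType) (f : bool -> C4 -> V) :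
  compatible g f -> (forall j, continuous (f j)) -> {within Y g, continuous (descent g f)}.
Proof.
move=> cf ctf; apply/subspace_continuousP => x Yx.
have [j [i [b [xE wb sb]]]] := Y_patch Yx.
have Ux : Ub j i (p1 b) (p2 b) x by rewrite xE; have [] := F_maps g j (Ob_self wb).
change (descent g f y @[y --> within (Y g) (nbhs x)] --> descent g f x).
rewrite (descent_Gb cf Yx Ux).
have cG : {for x, continuous (Gb j i (p1 b) (p2 b))} 
  := @smooth_Gb _ j i _ _ 0 x Ux.
have lim : (f j (Gb j i (p1 b) (p2 b) y)) @[y --> within (Y g) (nbhs x)] -->
    f j (Gb j i (p1 b) (p2 b) x).
  by apply: cvg_within_filter; exact: (continuous_comp cG (ctf j _)).
apply: cvg_trans lim; apply: near_eq_cvg.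
have n1 : \forall y \near within (Y g) (nbhs x), Ub j i (p1 b) (p2 b) y.
  by apply: cvg_within; apply: open_nbhs_nbhs; split=> //; exact: open_Ub.
have n2 : \forall y \near within (Y g) (nbhs x), Y g y by exact: withinT.
by apply: filterS2 n1 n2 => y Uy Yy; rewrite (descent_Gb cf Yy Uy).
Qed.

Lemma dF_ext g j (b b' w : C4) : same_point b b' -> dF g j b w = dF g j b' w.
Proof.
have dE i n (c c' v : C4) : same_point c c' -> dblk i n c v = dblk i n c' v.
  move=> [s t [c1 s1] [c2 s2]].
  by rewrite /dblk /vec /dvec /dcft1 /dcft2 /cft1 /cft2 s t c1 s1 c2 s2.
move=> bb'; apply: eq_mkE => j' i n _; rewrite /dFblk (dE i n b b') //.
case: bb' => s t [c1 s1] [c2 s2].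
rewrite (dE i n (deck b) (deck b')); last first.
  by split; rewrite !mk4E ?s ?t // cosD sinD c1 s1 c2 s2 -cosD -sinD.
rewrite (dE i n (deckV b) (deckV b')) //.
by split; rewrite !mk4E ?s ?t // cosB sinB c1 s1 c2 s2 -cosB -sinB.
Qed.

(** * A global frame, the complex structure and the first Chern class *)

Definition frame1 g := descent g (fun j b => dF g j b e1).
Definition frame2 g := descent g (fun j b => dF g j b (e2 b)).

(** [ldeck] preserves [lam0] and [om0] and fixes [e1], so the image of [e2 b] lies in the contact
    plane at [deck b] with coordinates 0 and 1 in the frame there. *)
Lemma e2_deck (b : C4) : sc b ^+ 2 = 1 -> e2 (deck b) = ldeck (e2 b).
Proof.
move=> sb; have sd : sc (deck b) ^+ 2 = 1 by rewrite mk4E sqrrN.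
have l1 : ldeck e1 = e1 by apply: mk4_inj; rewrite !mk4E; ring.
have s0 : sc (ldeck (e2 b)) = 0 by rewrite !mk4E oppr0.
have lw : lam0 (deck b) (ldeck (e2 b)) = 0 by rewrite lam0_deck lam0_e2.
rewrite [RHS](contact_decomp sd s0 lw) -{2}l1 om0_deck om0_e12 // !mk4E.
by rewrite scale0r add0r scale1r.
Qed.

Lemma ldeck_e1 : ldeck e1 = e1.
Proof. by apply: mk4_inj; rewrite !mk4E; ring. Qed.

Lemma compatible_frame1 g : compatible g (fun j b => dF g j b e1).
Proof.
split=> [j b b'|j b sb tb]; first exact: dF_ext.
by rewrite -{1}ldeck_e1 dF_deck //; move: (tc b) tb => *; lra.
Qed.

Lemma compatible_frame2 g : compatible g (fun j b => dF g j b (e2 b)).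
Proof.
split=> [j b b' bb'|j b sb tb].
  rewrite (_ : e2 b' = e2 b); first exact: dF_ext.
  by case: bb' => s t _ _; rewrite /e2 /cft1 /cft2 s t.
by rewrite e2_deck // dF_deck //; move: (tc b) tb => *; lra.
Qed.

Lemma frame1E g j i (b : C4) : window i b -> sc b ^+ 2 = 1 -> frame1 g (F g j b) = dF g j b e1.
Proof. by move=> wb sb; exact: (descentE (compatible_frame1 g) j wb sb). Qed.

Lemma frame2E g j i (b : C4) : window i b -> sc b ^+ 2 = 1 -> frame2 g (F g j b) = dF g j b (e2 b).
Proof. by move=> wb sb; exact: (descentE (compatible_frame2 g) j wb sb). Qed.

Lemma cont_dF g j (w : C4 -> C4) : (forall k, continuous (fun b => w b 0 k)) ->
  continuous (fun b => dF g j b (w b)).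
Proof.
move=> cw b.
have cD k : {for b, continuous (fun b => 'D_(delta_mx 0 k) (F g j) b)}.
  by have [_ /(_ (delta_mx 0 k))] := @smooth_F R g j 1; apply.
rewrite (_ : (fun b => _) = \sum_k (fun b => w b 0 k *: 'D_(delta_mx 0 k) (F g j) b)).
  elim/big_ind : _ => [|f h cf ch|k _]; [exact: cst_continuous|exact: continuousD|].
  exact: (cvgZ (cw k b) (cD k)).
apply/funext => c; rewrite fct_sumE -diff_F {1}(row_sum_delta (w c)) linear_sum.
by apply: eq_bigr => k _; rewrite linearZ /= deriveE //; exact: F_diff.
Qed.

Lemma cont_frame1 g : {within Y g, continuous (frame1 g)}.
Proof.
apply: (continuous_descent (compatible_frame1 g)) => j.
by apply: (@cont_dF g j (fun=> e1)) => k; exact: cst_continuous.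
Qed.

Lemma cont_frame2 g : {within Y g, continuous (frame2 g)}.
Proof.
apply: (continuous_descent (compatible_frame2 g)) => j.
apply: cont_dF => k b.
have cs : continuous (fun b : C4 => scale2 * sc b).
  by apply: cont_mul; [exact: cst_continuous|exact: coord_continuous].
have [c1 c2] := @Ck_cft R 0.
have C : {for b, continuous e2}; last exact: (continuous_comp C (@coord_continuous _ _ _ 0 k _)).
have cst (r : R) : Ck 0 (setT : set C4) (fun=> r) by exact: Ck_cst.
have m1 : Ck 0 setT (fun b : C4 => scale2 * sc b * cft2 b).
  by move=> x _; apply: continuousM; [exact: cs|exact: c2].
have m2 : Ck 0 setT (fun b : C4 => - (scale2 * sc b * cft1 b)).
  by move=> x _; apply: continuousN; apply: continuousM; [exact: cs|exact: c1].
have H := Ck_mk4 (@openT C4) (cst 0) m1 m2 (cst 0); exact: (H b I).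
Qed.

(* For a symplectic basis [(u, w)] of a plane, the complex structure of that
   plane sending [u] to [w]. *)
Definition cxm (u w : E) : 'M[R]_ambient := \matrix_(k, l)
  (ext_d (@lamA R) 0 (delta_mx 0 k) w * w 0 l + ext_d (@lamA R) 0 (delta_mx 0 k) u * u 0 l).
Definition cxs g (p : E) : 'M[R]_ambient := cxm (frame1 g p) (frame2 g p).

Lemma ext_lamA0 x u v : ext_d (@lamA R) x u v = ext_d (@lamA R) 0 u v.
Proof. by rewrite !ext_lamA. Qed.

Lemma ext_lamA_suml x (a : 'I_ambient -> R) (u : 'I_ambient -> E) v :
  ext_d (@lamA R) x (\sum_k a k *: u k) v = \sum_k a k * ext_d (@lamA R) x (u k) v.
Proof.
elim/big_rec2 : _ => [|k y w _ IH].
  rewrite ext_lamA; apply: big1 => j' _; apply: big1 => i' _.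
  have crd0 n : crd (0 : E) j' i' n = 0 by rewrite /crd; case: insub => // k; rewrite mxE.
  by rewrite /pairB !crd0; ring.
rewrite -{}IH !ext_lamA big_distrr -big_split /=; apply: eq_bigr => j _.
rewrite big_distrr -big_split /=; apply: eq_bigr => i _.
by rewrite /pairB !crdD !crdZ; ring.
Qed.

Lemma mul_cxm p (v u w : E) : v *m cxm u w =
  ext_d (@lamA R) p v w *: w + ext_d (@lamA R) p v u *: u.
Proof.
apply/rowP => l; rewrite !mxE !(ext_lamA0 p) {2 3}(row_sum_delta v) !ext_lamA_suml.
have split2 N (a x y : 'I_N -> R) (s t : R) : \sum_k a k * (x k * s + y k * t) =
    (\sum_k a k * x k) * s + (\sum_k a k * y k) * t.
  by rewrite !mulr_suml -big_split; apply: eq_bigr => k _; rewrite mulrDr !mulrA.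
by rewrite -split2; apply: eq_bigr => k _; rewrite [cxm _ _ _ _]mxE.
Qed.

Lemma cont_ext_lamA (v : E) : continuous (fun w => ext_d (@lamA R) 0 v w).
Proof.
rewrite (_ : (fun w => _) = (fun w => \sum_j \sum_i
  (pairB (crd v j i) (crd w j i) - pairB (crd w j i) (crd v j i)))).
  have cc j i n := @continuous_crd R j i n.
  have cs (r : R) : continuous (fun _ : E => r) by exact: cst_continuous.
  have cP j i : continuous (fun w : E => pairB (crd v j i) (crd w j i)).
    by apply: cont_add; [apply: cont_add; [apply: cont_add|]|];
      try apply: cont_opp; apply: cont_mul; first [exact: cs|exact: cc].
  have cP' j i : continuous (fun w : E => pairB (crd w j i) (crd v j i)).
    by apply: cont_add; [apply: cont_add; [apply: cont_add|]|];
      try apply: cont_opp; apply: cont_mul; first [exact: cs|exact: cc].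
  move=> w; rewrite (_ : (fun w => _) = \sum_j \sum_i (fun w => 
     (pairB (crd v j i) (crd w j i) - pairB (crd w j i) (crd v j i)))).
    elim/big_ind : _ => [|f h cf ch|j _]; [exact: cst_continuous|exact: continuousD|].
    elim/big_ind : _ => [|f h cf ch|i _]; [exact: cst_continuous|exact: continuousD|].
    by apply: cont_add; [exact: cP|apply: cont_opp; exact: cP'].
  by apply/funext => x; rewrite fct_sumE; apply: eq_bigr => j _; rewrite fct_sumE.
by apply/funext => w; rewrite ext_lamA.
Qed.

Lemma cont_cxs g : {within Y g, continuous (cxs g)}.
Proof.
move=> p; apply: continuous_mx => k l.
rewrite (_ : (fun y => _) = (fun p => ext_d (@lamA R) 0 (delta_mx 0 k) (frame2 g p) * frame2 g p 0 l +
   ext_d (@lamA R) 0 (delta_mx 0 k) (frame1 g p) * frame1 g p 0 l)); last first.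
  by apply/funext => y; rewrite mxE.
have c1 := @cont_frame1 g; have c2 := @cont_frame2 g.
move: p; apply: cont_add; apply: cont_mul.
- exact: (cont_comp c2 (@cont_ext_lamA _)).
- exact: (cont_comp c2 (@coord_continuous _ _ _ 0 l)).
- exact: (cont_comp c1 (@cont_ext_lamA _)).
- exact: (cont_comp c1 (@coord_continuous _ _ _ 0 l)).
Qed.

Lemma cxs_frame g j i (b : C4) (a c : R) : window i b -> sc b ^+ 2 = 1 ->
  (a *: dF g j b e1 + c *: dF g j b (e2 b)) *m cxs g (F g j b) =
  (- c) *: dF g j b e1 + a *: dF g j b (e2 b).
Proof.
move=> wb sb; rewrite (mul_cxm (F g j b)) (frame1E g j wb sb) (frame2E g j wb sb).
have h1 := ext_frame g j wb sb (F g j b) a c 1 0.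
have h2 := ext_frame g j wb sb (F g j b) a c 0 1.
move: h1 h2; rewrite !scale0r !scale1r addr0 add0r => -> ->.
by rewrite !mulr0 !mulr1 subr0 sub0r addrC.
Qed.

Lemma compatible_cxs g : compatible_complex_structure (@Y R g) (xi g) (@lamA R) (cxs g).
Proof.
split; first exact: cont_cxs.
move=> p v /Y_patch[j [i [b [-> wb sb]]]] /(xi_F g j wb sb)[a [c ->]].
have ef := ext_frame g j wb sb (F g j b).
have cf a1 c1 := cxs_frame g j a1 c1 wb sb.
rewrite !cf; split.
- by apply/(xi_F g j wb sb); eexists; eexists.
- by rewrite opprD !scaleNr.
- move=> vn; rewrite ef mulrN opprK -!expr2.
  rewrite lt_neqAle addr_ge0 ?sqr_ge0 // andbT eq_sym paddr_eq0 ?sqr_ge0 // !sqrf_eq0.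
  by apply: contraNN vn => /andP[/eqP -> /eqP ->]; rewrite !scale0r addr0.
- move=> w /(xi_F g j wb sb)[a' [c' ->]]; rewrite cf !ef; ring.
Qed.

Lemma Y_c1 g : c1_vanishes 2 (@Y R g) (xi g).
Proof.
exists (@lamA R), (cxs g); split; [exact: contact_form_lamA|exact: compatible_cxs|].
(* One open set covers: the contact planes form a complex line bundle framed by [frame1], whose only
   transition matrix is the identity, so the cocycle can be taken to be 0. *)
exists 1%N, (fun=> setT), (fun _ _ _ _ => 0); split.
- by split=> [i|p _]; [exact: openT|exists ord0].
- exists (fun=> frame1 g), (fun _ _ _ => 0); split.
  + move=> k; split; first by rewrite setIT; exact: cont_frame1.
    move=> p /Y_patch[j [i [b [-> wb sb]]]] _; rewrite (frame1E g j wb sb); split.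
      move=> a; rewrite (_ : row a _ = dF g j b e1); last first.
        by apply/rowP => l; rewrite mxE ord1.
      apply/(xi_F g j wb sb); exists 1, 0; by rewrite scale1r scale0r addr0.
    apply: inj_row_free => v v0.
    have := cxs_frame g j 1 0 wb sb; rewrite !scale1r oppr0 !scale0r addr0 add0r => e.
    have z : v 0 (lshift 1 0) *: dF g j b e1 + v 0 (rshift 1 0) *: dF g j b (e2 b) = 0.
      rewrite -[RHS]v0 -[X in X *m _]hsubmxK mul_row_col e.
      by rewrite [lsubmx _]mx11_scalar [rsubmx _]mx11_scalar !mul_scalar_mx !mxE.
    have [a0 c0] := frame_free wb sb z.
    rewrite -[v]hsubmxK [lsubmx _]mx11_scalar [rsubmx _]mx11_scalar !mxE a0 c0.
    by rewrite !raddf0 row_mx0.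
  + by move=> k l; exact: cst_continuous.
  + move=> k l p _ _ _; exists 1%:M.
      rewrite /complex_mul (_ : map_mx (@complex.Re R) _ = 1%:M); last first.
        by apply/matrixP => x y; rewrite !mxE !ord1 eqxx.
      rewrite (_ : map_mx (@complex.Im R) _ = 0) ?mul1mx ?mul0mx ?addr0 //.
      by apply/matrixP => x y; rewrite !mxE !ord1 eqxx.
    by rewrite det1; exists 1; rewrite ?ltr01 // cos0 sin0 mulr0 mulr1.
  + by move=> *; rewrite subr0 addr0 mulr0z mulr0.
- exists (fun _ _ _ => 0); split; last by move=> *; rewrite subr0 addr0.
  by move=> k l p _; apply: (@filterS _ _ _ setT) => //; exact: filterT.
Qed.

End ContactForm.

(** * Liouville fillings *)

Section Fillings.
Variable R : realType.

Local Notation E := 'rV[R]_ambient.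
Local Notation C4 := 'rV[R]_4.
Local Notation golden := (golden R).
Local Notation growth := (growth R).
Local Notation eU b := (expR (growth * tc b)).
Local Notation eV b := (expR (- (growth * tc b))).

(** The form is [growth * phi^tau dtau /\ dx + phi^(- tau) (ds - growth * s dtau) /\ dy]. Pairing
    with the torus directions determines the [tau] and [s] components, pairing with the other two
    the torus components. *)
Lemma om0_nondegenerate (b w : C4) : (forall u, om0 b w u = 0) -> w = 0.
Proof.
move=> h.
have gp := golden_gt0 R; have Tp := growth_gt0 R; have uv := eUV b.
have gI : 0 < golden^-1 by rewrite invr_gt0.
pose D := growth * (golden + golden^-1).
have D0 : D != 0 by rewrite gt_eqF // mulr_gt0 // addr_gt0.
have h0 := h (mk4 1 0 0 0); have h1 := h (mk4 0 1 0 0).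
have h2 := h (mk4 0 0 1 0); have h3 := h (mk4 0 0 0 1).
move: h0 h1 h2 h3; rewrite /om0 /dcft1 /dcft2 !mk4E /D in D0 *.
set U := eU b in uv *; set V := eV b in uv *; set s := sc b.
move: D0 uv; move: (growth) (golden) (golden^-1) U V s => T g G U V s D0 uv h0 h1 h2 h3.
have z x : T * (g + G) * x = 0 -> x = 0.
  by move/eqP; rewrite mulf_eq0 (negPf D0) /= => /eqP.
have k1 : g * (T * tc w * U) - G * (sc w - s * T * tc w) * V = 0 by rewrite -[RHS]h1; ring.
have k2 : T * tc w * U + (sc w - s * T * tc w) * V = 0 by rewrite -[RHS]h2; ring.
have k0 : G * V * p1 w - V * p2 w = 0 by rewrite -[RHS]h0; ring.
have k3 : T * ((g * U + G * s * V) * p1 w + (U - s * V) * p2 w) = 0.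
  by rewrite -[RHS]oppr0 -[in RHS]h3; ring.
have t0 : tc w = 0.
  apply: z; transitivity (V * (g * (T * tc w * U) - G * (sc w - s * T * tc w) * V)
     + G * V * (T * tc w * U + (sc w - s * T * tc w) * V)); first by ring: uv.
  by rewrite k1 k2 !mulr0 addr0.
have s0 : sc w = 0.
  transitivity (U * (T * tc w * U + (sc w - s * T * tc w) * V)); last by rewrite k2 mulr0.
  by rewrite t0; ring: uv.
have q1 : p1 w = 0.
  apply: z; transitivity (V * (T * ((g * U + G * s * V) * p1 w + (U - s * V) * p2 w)) +
    T * (U - s * V) * (G * V * p1 w - V * p2 w)); first by ring: uv.
  by rewrite k3 k0 !mulr0 addr0.
have q2 : p2 w = 0.
  transitivity (- (U * (G * V * p1 w - V * p2 w))); last by rewrite k0 mulr0 oppr0.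
  by rewrite q1; ring: uv.
rewrite -[w]mk4K t0 s0 q1 q2.
by apply/rowP => -[[|[|[|[|k]]]] lt]; rewrite // !mxE.
Qed.

Lemma W_liouville g : liouville_domain 2 (@W R g) (@lamA R).
Proof.
split; [exact: W_submanifold|exact: compact_W|exact: smooth_lamA| |].
  move=> p v Tv vn; have [Wp _] := Tv.
  have [j [i [b [pE wb sb]]]] := W_patch Wp; rewrite pE in Tv *.
  have [w vE] := (W_tangent g j wb sb v).1 Tv.
  apply: contrapT => nex; move/eqP: vn; apply; rewrite vE.
  rewrite (_ : w = 0) ?dF0 //; apply: (@om0_nondegenerate b) => u.
  rewrite -(ext_lamA_F g j (F g j b)); last exact: window_region wb.
  apply: contrapT => /eqP ne; apply: nex; exists (dF g j b u); last by rewrite vE.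
  by apply/(W_tangent g j wb sb); exists u.
move=> p /Y_patch[j [i [b [-> wb sb]]]].
have sb' : sc b ^+ 2 <= 1 by rewrite sb.
have reg := window_region wb.
(* Contraction with [d/dtau / growth] gives [phi^tau dx - s phi^(- tau) dy]; the component [2 * s]
   along [s] corrects the sign of the second term and points outward at both ends. *)
exists (dF g j b (mk4 (2 * sc b) 0 0 growth^-1)).
  split; first by apply/(W_tangent g j wb sb'); eexists.
  move=> w /(W_tangent g j wb sb')[u ->]; rewrite ext_lamA_F // eval_lamA_F //.
  rewrite /om0 /lam0 /dcft1 /dcft2 /cft1 /cft2 !mk4E mulfV; last by rewrite gt_eqF // growth_gt0.
  by rewrite mulfK ?gt_eqF ?growth_gt0 //; ring.
by apply: (W_outward g j wb sb' sb); rewrite mk4E mulrCA -expr2 sb mulr1.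
Qed.

Lemma xi_eval g j i (b w : C4) : window i b -> sc b ^+ 2 = 1 -> sc w = 0 ->
  xi g (F g j b) (dF g j b w) <-> lam0 b w = 0.
Proof.
move=> wb sb sw; rewrite -(eval_lamA_F g j); last exact: window_region wb.
split=> [[_ //]|lw]; split=> //.
by apply/(Y_tangent g j wb sb); exists w.
Qed.

(** A map that changes only the label is the identity in the coordinates [b], and [lam0] does not
    involve the label. The new label may depend on [s], which is constant on a boundary chart. *)
Lemma relabel_contact g g' (f : E -> E) (l : bool -> R -> bool) :
  (forall j i (b : C4), window i b -> sc b ^+ 2 = 1 -> f (F g j b) = F g' (l j (sc b)) b) ->
  forall p v w, tangent 3 (Y g) p v -> has_differential (Y g) f p v w ->
  (xi g p v <-> xi g' (f p) w).
Proof.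
move=> fE p v w Tv dv; have [Yp _] := Tv.
have [j [i [b [pE wb sb]]]] := Y_patch Yp; rewrite {}pE in Tv dv *.
have [u su vE] := (Y_tangent g j wb sb v).1 Tv.
rewrite {}vE in Tv dv *.
pose h := 0 <= sc b; pose a := mk3 (tc b + offset R i) (p1 b) (p2 b).
pose a' := mk3 (tc u) (p1 u) (p2 u).
have sgE : sg R h = sc b by exact: sg_bdry.
have -> : w = dF g' (l j (sc b)) b u.
  have onY c : OY i h (p1 b) (p2 b) c -> window i (affY i h c) /\ sc (affY i h c) = sc b.
    by move=> [_ [wc _ _]]; split=> //; rewrite mk4E.
  have uE : mk4 0 (a' 0 y1) (a' 0 y2) (a' 0 y0) = u.
    by rewrite !mk3E -[RHS]mk4K su.
  have e0 := affY_pt i sb.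
  have dE : dF g j b u = 'd (FY g j i h) a a' by rewrite diff_FY uE e0.
  have dE' : dF g' (l j (sc b)) b u = 'd (FY g' (l j (sc b)) i h) a a'.
    by rewrite diff_FY uE e0.
  have pE : F g j b = FY g j i h a by rewrite /FY e0.
  rewrite dE'; rewrite dE pE in dv.
  apply: (chart_differential (chartY g j i h (p1 b) (p2 b)) (OY_pt wb sb) _ _ _ dv).
  - by move=> c /onY[wc scE]; apply: (Y_window g j wc); rewrite scE.
  - by move=> c /onY[wc scE]; rewrite /FY (fE _ _ _ wc) scE.
  - have da : differentiable (affY i h) a by case: (Ck_affY R i h 1) => + _; exact.
    exact: differentiable_comp da (F_diff _ _ _).
by rewrite (fE _ _ _ wb sb) !(xi_eval _ _ wb sb su).
Qed.

(** [deck] moves the source label by [g] and changes the sign of [s]; together these move the target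
    label by [~~ g]. *)
Lemma compatible_swap g :
  compatible g (fun j (b : C4) => F (~~ g) (j (+) (sc b < 0)) b).
Proof.
split=> [j b b' [s t [c1 s1] [c2 s2]]|j b sb tb].
  by rewrite s; exact: F_ext.
have -> : sc (deck b) < 0 = ~~ (sc b < 0).
  rewrite mk4E oppr_lt0 -leNgt le_eqVlt; case: eqVneq => // s0.
  by move/eqP: sb; rewrite -s0 expr0n eq_sym oner_eq0.
rewrite -(F_deck (~~ g) (j (+) (sc b < 0))); last by move: (tc b) tb => *; lra.
by congr F; case: g j (sc b < 0) => -[] [].
Qed.

Definition swap g : E -> E := descent g (fun j (b : C4) => F (~~ g) (j (+) (sc b < 0)) b).

Lemma swapE g j i (b : C4) : window i b -> sc b ^+ 2 = 1 ->
  swap g (F g j b) = F (~~ g) (j (+) (sc b < 0)) b.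
Proof. by move=> wb sb; exact: (descentE (compatible_swap g) j wb sb). Qed.

Lemma swapK g x : Y g x -> Y (~~ g) (swap g x) /\ swap (~~ g) (swap g x) = x.
Proof.
move=> /Y_patch[j [i [b [-> wb sb]]]]; rewrite (swapE g j wb sb).
split; first exact: (Y_window (~~ g) _ wb sb).
by rewrite (swapE _ _ wb sb) negbK -addbA addbb addbF.
Qed.

Lemma smooth_swap g : smooth_on (Y g) (swap g).
Proof.
move=> x Yx; have [j [i [b [xE wb sb]]]] := Y_patch Yx.
pose h := 0 <= sc b; have sgE : sg R h = sc b by exact: sg_bdry.
have [_ oU _ _ _ _ _] := chartY g j i h (p1 b) (p2 b).
(* The condition [0 < sg h * s] in [UY] fixes the sign of [s], so one constant label serves in the
   local extension. *)
exists (UY j i h (p1 b) (p2 b)), (fun y => F (~~ g) (j (+) (sc b < 0)) (Gb j i (p1 b) (p2 b) y)).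
have [Ux Gx] := F_maps g j (Ob_self wb); rewrite -xE in Ux Gx.
split.
- exact: oU.
- by split=> //; rewrite Gx sgE /= -expr2 sb ltr01.
- move=> k; apply: (@Ck_comp _ _ _ k _ _ setT) => //; first exact: openT.
    by apply: Ck_sub (@smooth_Gb R j i (p1 b) (p2 b) k) => y [].
  exact: smooth_F.
- move=> y [Uy /= sy] Yy; rewrite /swap (descent_Gb (compatible_swap g) Yy Uy).
  congr F; congr (_ (+) _).
  move: sy; rewrite sgE; move/eqP: sb; rewrite sqrf_eq1 => /orP[] /eqP ->.
    by rewrite mul1r => s0; rewrite ltNge ltW // ltNge ler01.
  by rewrite mulN1r oppr_gt0 => ->; rewrite ltrN10.
Qed.

Lemma contactomorphic_swap g :
  contactomorphic 2 (@Y R g) (xi g) (@Y R (~~ g)) (@xi R (~~ g)).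
Proof.
exists (swap g), (swap (~~ g)); split.
- by split; exact: smooth_swap.
- by move=> p /swapK.
- by move=> q /swapK; rewrite negbK.
- move=> p v w; apply: (@relabel_contact g (~~ g) (swap g) (fun j s => j (+) (s < 0))).
  by move=> j i b wb sb; exact: (swapE g j wb sb).
Qed.

Lemma contactomorphic_id g : contactomorphic 2 (@Y R g) (xi g) (@Y R g) (xi g).
Proof.
exists id, id; split=> //.
- have sid : smooth_on (@Y R g) id.
    move=> p Yp; exists setT, id; split=> //; first exact: openT.
    by move=> k; apply: Ck_idrow; exact: openT.
  by split.
- move=> p v w; apply: (@relabel_contact g g id (fun j s => j)).
  by move=> j i b _ _.
Qed.

Lemma filling_swap g : liouville_filling 2 (@Y R (~~ g)) (@xi R (~~ g)) (@W R g) (@lamA R).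
Proof. by split; [exact: W_liouville|exact: contactomorphic_swap]. Qed.

Lemma filling_id g : liouville_filling 2 (@Y R g) (@xi R g) (@W R g) (@lamA R).
Proof. by split; [exact: W_liouville|exact: contactomorphic_id]. Qed.

End Fillings.

(** * Cohomology in degree zero *)

(** Rank at most 1, in a form that an injective homomorphism pulls back; it separates the two groups
    without computing either. *)
Definition dependent (A : zmodType) := forall a b : A, exists m n : int,
  (m != 0) || (n != 0) /\ a *~ m + b *~ n = 0.

Lemma dependent_iso (A B : zmodType) : group_isomorphic A B -> dependent B -> dependent A.
Proof.
move=> [f bf] dB a b; have [m [n [mn e]]] := dB (f a) (f b); exists m, n; split=> //.
by apply: (bij_inj bf); rewrite raddf0 raddfD !raddfMz.
Qed.

Section DegreeZero.
Variables (R : realType) (X : topologicalType).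

Fact origin_subproof : std_simplex R 0 (const_mx 1).
Proof. by split=> [i|]; rewrite ?big_ord1 mxE ?ler01. Qed.

Definition origin : set_type (std_simplex R 0) := SigSub (mem_set origin_subproof).

Lemma simplex0E (x : set_type (std_simplex R 0)) : x = origin.
Proof.
apply: val_inj; apply/rowP => i; rewrite ord1 mxE.
by have [_] := set_mem (valP x); rewrite big_ord1.
Qed.

Lemma singular_simplex_ext k (s s' : singular_simplex R X k) : s =1 s' -> s = s'.
Proof.
case: s s' => [s cs] [s' cs'] /= /funext ss'; rewrite -ss' in cs' *.
by congr SingularSimplex; exact: Prop_irrelevance.
Qed.

Definition point_simplex (x : X) : singular_simplex R X 0 :=
  SingularSimplex (fun p => @cst_continuous _ _ x p).

Lemma point_simplexE (s : singular_simplex R X 0) : s = point_simplex (s origin).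
Proof. by apply: singular_simplex_ext => p /=; rewrite (simplex0E p). Qed.

Lemma codiff_0 (c : cochain R X 0) (s : singular_simplex R X 1) :
  codiff c s = c (simplex_face s ord0) - c (simplex_face s ord_max).
Proof.
rewrite /codiff big_ord_recl big_ord1 expr0 mul1r expr1 mulN1r.
by congr (_ - c (simplex_face _ _)); exact/val_inj.
Qed.

Notation H0 := (cohomology R X 0).
Local Notation B0 := (@coboundary_pred R X 0 : zmodClosed (cocycle R X 0)).
Definition cls (c : cocycle R X 0) : H0 := \pi_(Quotient.quot B0)%qT c.

Lemma cls_repr (a : H0) : exists c, a = cls c.
Proof. by exists (repr a); rewrite /cls reprK. Qed.

Lemma cls_eq0 c : cls c = 0 <-> forall s, cocycle_val c s = 0.
Proof.
rewrite (_ : (cls c = 0) <-> (cls c = cls 0)); last by rewrite /cls raddf0.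
have -> : (cls c = cls 0) <-> c - 0 \in B0.
  by rewrite Quotient.idealrBE; split=> [/eqP|/eqP].
rewrite subr0; split=> [/asboolP /= c0 s|c0]; first by rewrite c0.
by apply/asboolP/funext.
Qed.

Lemma mulz_cochain (c : cochain R X 0) (m : int) s : (c *~ m) s = c s *~ m.
Proof. case: m => n; first by rewrite -!pmulrn natmulfctE.
by rewrite NegzE -!nmulrn -!mulNrn natmulfctE. Qed.

Lemma cls_comb (c d : cocycle R X 0) (m n : int) : cls c *~ m + cls d *~ n = 0 <->
  forall s, m * cocycle_val c s + n * cocycle_val d s = 0.
Proof.
rewrite (_ : cls c *~ m + cls d *~ n = cls (c *~ m + d *~ n)); last first.
  by rewrite /cls raddfD !raddfMz.
have e s : cocycle_val (c *~ m + d *~ n) s = m * cocycle_val c s + n * cocycle_val d s.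
  have -> : cocycle_val (c *~ m + d *~ n) = cocycle_val c *~ m + cocycle_val d *~ n.
    by rewrite -[LHS]/(\val _) raddfD !raddfMz.
  rewrite -[LHS]/((cocycle_val c *~ m) s + (cocycle_val d *~ n) s).
  by rewrite !mulz_cochain !mulrzz ![cocycle_val _ _ * _]mulrC.
by rewrite cls_eq0; split=> h s; have := h s; rewrite e.
Qed.

Lemma constant_dependent : (forall (c : cocycle R X 0) s s', cocycle_val c s = cocycle_val c s') ->
  dependent H0.
Proof.
move=> cc a b; have [c ->] := cls_repr a; have [d ->] := cls_repr b.
have [[s0 _]|ns] := pselect (exists s0 : singular_simplex R X 0, True); last first.
  exists 1, 0; split=> //; apply/cls_comb => s; case: ns; by exists s.
have [/andP[/eqP c0 /eqP d0]|nz] := boolP ((cocycle_val c s0 == 0) && (cocycle_val d s0 == 0)).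
  exists 1, 0; split=> //; apply/cls_comb => s.
  by rewrite (cc c s s0) c0 mulr0 mul0r addr0.
exists (cocycle_val d s0), (- cocycle_val c s0); split.
  by rewrite oppr_eq0 orbC -negb_and.
apply/cls_comb => s; rewrite (cc c s s0) (cc d s s0); ring.
Qed.

Lemma cocycle_faces (c : cocycle R X 0) (s : singular_simplex R X 1) :
  cocycle_val c (simplex_face s ord0) = cocycle_val c (simplex_face s ord_max).
Proof.
have /asboolP dc := cocycleP c.
by apply/eqP; rewrite -subr_eq0 -codiff_0 dc.
Qed.

End DegreeZero.

(** * Degree-zero cocycles along paths *)

Section Paths.
Variables (R : realType) (N : nat) (M : set 'rV[R]_N).
Local Notation E := 'rV[R]_N.

Lemma continuous_set_type (T : topologicalType) (f : T -> set_type M) :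
  continuous (fun x => val (f x)) -> continuous f.
Proof. by move=> cf; apply: continuous_comp_initial. Qed.

(** The first barycentric coordinate of the 1-simplex serves as time: composed with [p] it gives a
    singular simplex whose faces are the two points. *)
Lemma path_cocycle (c : cocycle R (set_type M) 0) (p : R -> E) (x y : set_type M) :
  continuous p -> (forall t, 0 <= t <= 1 -> M (p t)) -> val x = p 0 -> val y = p 1 ->
  cocycle_val c (point_simplex R x) = cocycle_val c (point_simplex R y).
Proof.
move=> cp Mp xE yE.
have Ms (z : set_type (std_simplex R 1)) : M (p (val z 0 ord0)).
  apply: Mp; have [z0 z1] := set_mem (valP z); rewrite z0 /= -z1 big_ord_recl.
  by rewrite lerDl sumr_ge0.
pose s z : set_type M := SigSub (mem_set (Ms z)).
have cs : continuous s.
  apply: continuous_set_type => z /=.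
  have cv : continuous (fun z : set_type (std_simplex R 1) => (\val z : 'rV[R]_2)).
    exact: initial_continuous.
  have cz := continuous_comp (cv z) (@coord_continuous _ _ _ 0 ord0 _).
  exact: (continuous_comp cz (cp _)).
have -> : point_simplex R x = simplex_face (SingularSimplex cs) ord0.
  rewrite [RHS]point_simplexE; congr point_simplex; apply: val_inj.
  by rewrite /= mxE unlift_none xE.
have -> : point_simplex R y = simplex_face (SingularSimplex cs) ord_max.
  rewrite [RHS]point_simplexE; congr point_simplex; apply: val_inj.
  rewrite /= mxE; case: unliftP => [i _|/(congr1 val) //].
  by rewrite mxE yE.
exact: cocycle_faces.
Qed.

(* A path in the simplex defined for all real times, which avoids clamping. *)
Definition arc (t : R) : 'rV[R]_2 := \row_(k < 2) if k == ord0 then cos t ^+ 2 else sin t ^+ 2.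

Lemma arc_simplex t : std_simplex R 1 (arc t).
Proof.
split=> [i|]; first by rewrite mxE; case: ifP; rewrite sqr_ge0.
by rewrite big_ord_recl big_ord1 !mxE /= cos2Dsin2.
Qed.

(** By the intermediate value theorem the nonvanishing [D] keeps its sign along a singular
    1-simplex, so any function of that sign is a cocycle. *)
Lemma sign_cocycle (D : E -> R) (f : bool -> int) : continuous D -> (forall x, M x -> D x != 0) ->
  exists c : cocycle R (set_type M) 0, forall s : singular_simplex R (set_type M) 0,
    cocycle_val c s = f (0 < D (val (s (origin R)))).
Proof.
move=> cD D0.
pose c : cochain R (set_type M) 0 := fun s => f (0 < D (val (s (origin R)))).
have dc : c \in @cocycle_pred R (set_type M) 0; last by exists (Cocycle dc).
apply/asboolP/funext => s; rewrite codiff_0 /c; apply/eqP; rewrite subr_eq0; apply/eqP.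
congr f.
pose q t : set_type (std_simplex R 1) := SigSub (mem_set (arc_simplex t)).
have cq : continuous q.
  apply: continuous_comp_initial => t /=; apply: continuous_mx => i k.
  rewrite (_ : (fun y => _) = (fun y => if k == ord0 then cos y ^+ 2 else sin y ^+ 2)); last first.
    by apply/funext => y; rewrite mxE.
  by case: (k == ord0); apply: cont_mul; first [exact: continuous_cos|exact: continuous_sin].
have cf : continuous (fun t => D (val (s (q t)))).
  move=> t; apply: (@continuous_comp _ _ _ (fun t => val (s (q t))) D); last exact: cD.
  apply: (@continuous_comp _ _ _ (fun t => s (q t)) val); last exact: initial_continuous.
  by apply: continuous_comp; [exact: cq|exact: simplex_continuous].
have -> : simplex_face s ord0 (origin R) = s (q (pi / 2)).
  congr (s _); apply: val_inj; apply/rowP => k; rewrite !mxE cos_pihalf sin_pihalf.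
  case: unliftP => [k' ->|->]; first by rewrite mxE expr1n.
  by rewrite expr0n.
have -> : simplex_face s ord_max (origin R) = s (q 0).
  congr (s _); apply: val_inj; apply/rowP => k; rewrite !mxE cos0 sin0.
  case: unliftP => [k' ->|->]; last by rewrite expr0n.
  by rewrite mxE expr1n (ord1 k').
have Dn t : D (val (s (q t))) != 0 by apply: D0; exact: set_mem (valP _).
have pp : 0 <= pi / 2 :> R by rewrite divr_ge0 ?pi_ge0.
apply/idP/idP => h; apply: contrapT => /negP; rewrite -leNgt => h'.
  have [] := @IVT R _ 0 (pi / 2) 0 pp (continuous_subspaceT cf).
    by rewrite ge_min le_max h' (ltW h) orbT.
  by move=> t _ /eqP; rewrite (negPf (Dn t)).
have [] := @IVT R _ 0 (pi / 2) 0 pp (continuous_subspaceT cf).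
  by rewrite ge_min le_max h' (ltW h) orbT.
by move=> t _ /eqP; rewrite (negPf (Dn t)).
Qed.

End Paths.

(** * Degree-zero cohomology of the two fillings *)

Section Model.
Variable R : realType.

Local Notation E := 'rV[R]_ambient.
Local Notation C4 := 'rV[R]_4.

Lemma F_W g j (b : C4) : sc b ^+ 2 <= 1 -> 0 <= tc b <= 1 -> W g (F g j b).
Proof. by move=> sb tb; exists j, b. Qed.

(** For a given label the region [s ^+ 2 <= 1], [0 <= tau <= 1] of the cover is convex, so the image
    of a segment joins the two points. *)
Lemma segment_cocycle g j (b b' : C4) (c : cocycle R (set_type (@W R g)) 0)
    (sb : sc b ^+ 2 <= 1) (tb : 0 <= tc b <= 1) (sb' : sc b' ^+ 2 <= 1) (tb' : 0 <= tc b' <= 1)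
    (x y : set_type (@W R g)) : val x = F g j b -> val y = F g j b' ->
  cocycle_val c (point_simplex R x) = cocycle_val c (point_simplex R y).
Proof.
move=> xE yE; pose l t : C4 := (1 - t) *: b + t *: b'.
apply: (@path_cocycle _ _ _ c (fun t => F g j (l t))).
- have cl : continuous l.
    move=> t; apply: continuous_mx => i k.
    rewrite (_ : (fun y => _) = (fun y => (1 - y) * b i k + y * b' i k)); last first.
      by apply/funext => r; rewrite !mxE.
    have ci : continuous (fun y : R => y) by move=> ?; exact: cvg_id.
    have cs (r : R) : continuous (fun _ : R => r) by exact: cst_continuous.
    apply: cont_add; apply: cont_mul => //.
    by apply: cont_add => //; exact: cont_opp.
  by move=> t; apply: continuous_comp; [exact: cl|exact: (@smooth_F R g j 0)].
- move=> t /andP[t0 t1]; apply: F_W; rewrite /l combE; last by nra.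
  move: (sc b) (sc b') sb sb' => s s' sb sb'.
  have -> : ((1 - t) * s + t * s') ^+ 2 =
      (1 - t) * s ^+ 2 + t * s' ^+ 2 - t * (1 - t) * (s - s') ^+ 2 by ring.
  have h1 : (1 - t) * s ^+ 2 <= 1 - t by rewrite ler_piMr // subr_ge0.
  have h2 : t * s' ^+ 2 <= t by rewrite ler_piMr.
  have h3 : 0 <= t * (1 - t) * (s - s') ^+ 2 
    by apply: mulr_ge0; [apply: mulr_ge0 => //; rewrite subr_ge0|exact: sqr_ge0].
  by move: h1 h2 h3; lra.
- by rewrite /l subr0 scale1r scale0r addr0.
- by rewrite /l subrr scale0r scale1r add0r.
Qed.

Lemma W_true_connected : dependent (cohomology R (set_type (@W R true)) 0).
Proof.
(* A point with [tau = 1]: its image under [deck] has [tau = 0] and the other label, so it connects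
   the two labelled pieces. *)
pose b1 : C4 := mk4 0 0 0 1.
have sb1 : sc b1 ^+ 2 <= 1 by rewrite mk4E expr0n ler01.
have tb1 : 0 <= tc b1 <= 1 by rewrite mk4E ler01 lexx.
have sd1 : sc (deck b1) ^+ 2 <= 1 by rewrite !mk4E oppr0 expr0n ler01.
have td1 : 0 <= tc (deck b1) <= 1 by rewrite !mk4E subrr lexx ler01.
pose x1 : set_type (@W R true) := SigSub (mem_set (F_W true false sb1 tb1)).
have x1E : val x1 = F true true (deck b1).
  by rewrite /= -(F_deck true false) // !mk4E; lra.
apply: constant_dependent => c.
suff h s : cocycle_val c s = cocycle_val c (point_simplex R x1).
  by move=> s s'; rewrite !h.
rewrite [s]point_simplexE; move: (s _) => x.
have [j [b [xE sb tb]]] : W true (val x) by exact: set_mem (valP x).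
case: j xE => xE.
  exact: (segment_cocycle c sb tb sd1 td1 xE x1E).
exact: (segment_cocycle c sb tb sb1 tb1 xE).
Qed.

(** For [g = false] the whole orbit keeps its label, so only bumps of that label contribute and the
    sign tells the two components apart. *)
Definition label_diff (x : E) : R :=
  (crd x true false 0 + crd x true true 0) - (crd x false false 0 + crd x false true 0).

Lemma label_diff_F j (b : C4) : 0 <= tc b <= 1 ->
  if j then 0 < label_diff (F false j b) else label_diff (F false j b) < 0.
Proof.
move=> tb.
have bge i (c : C4) : 0 <= blk i 0 c.
  rewrite blkE; have [w|w] := pselect (window i c); first by rewrite ltW // cutoff_window.
  by rewrite cutoff_out //; exact/negP.
pose B i := blk i 0 b + (blk i 0 (deck b) + blk i 0 (deckV b)).
have Bpos : 0 < B false + B true.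
  have bg i : 0 <= B i by rewrite !addr_ge0.
  have [h|h] := boolP (0 < tc b < 1).
    apply: ltr_wpDr => //; apply: ltr_wpDr; first by rewrite addr_ge0.
    by rewrite blkE cutoff_gt0 // /offset addr0.
  apply: ltr_wpDl => //; have [t0|t0] := eqVneq (tc b) 0.
    apply: ltr_wpDr; first by rewrite addr_ge0.
    by rewrite blkE cutoff_gt0 // /offset t0; lra.
  apply: ltr_wpDl => //; apply: ltr_wpDr => //.
  have t1 : tc b = 1 by move: h t0; move: (tc b) tb => t tb; lra.
  by rewrite blkE cutoff_gt0 // mk4E /offset t1; lra.
have cE j' i : crd (F false j b) j' i 0 = (j' == j)%:R * B i.
  by rewrite crd_mkE // /Fblk addbF -mulrDr.
rewrite /label_diff !cE; case: j {cE} => /=; rewrite !mul1r !mul0r; lra.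
Qed.

Lemma W_false_independent : ~ dependent (cohomology R (set_type (@W R false)) 0).
Proof.
move=> dep.
have cD : continuous label_diff.
  apply: cont_add; first by apply: cont_add; exact: continuous_crd.
  by apply: cont_opp; apply: cont_add; exact: continuous_crd.
have D0 x : W false x -> label_diff x != 0.
  move=> [j [b [-> sb tb]]]; have := label_diff_F j tb; case: j => h; first by rewrite gt_eqF.
  by rewrite lt_eqF.
(* The indicators of the two labels: evaluating a relation between them at one point of each
   component isolates its coefficients. *)
have [c cE] := sign_cocycle (fun l => l%:Z) cD D0.
have [d dE] := sign_cocycle (fun l => (~~ l)%:Z) cD D0.
have [m [n [mn /cls_comb e]]] := dep (cls c) (cls d).
pose b1 : C4 := mk4 0 0 0 0.
have sb1 : sc b1 ^+ 2 <= 1 by rewrite mk4E expr0n ler01.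
have tb1 : 0 <= tc b1 <= 1 by rewrite mk4E ler01 lexx.
pose x j : set_type (@W R false) := SigSub (mem_set (F_W false j sb1 tb1)).
have := e (point_simplex R (x true)); have := e (point_simplex R (x false)).
rewrite !cE !dE /=; have := label_diff_F true tb1; have := label_diff_F false tb1 => /= h0 -> /=.
rewrite ltNge (ltW h0) /= !mulr1 !mulr0 addr0 add0r => n0 m0.
by move: mn; rewrite n0 m0 eqxx.
Qed.

Lemma H0_not_isomorphic : ~ group_isomorphic (cohomology R (set_type (@W R false)) 0)
  (cohomology R (set_type (@W R true)) 0).
Proof. by move=> /dependent_iso /(_ W_true_connected); exact: W_false_independent. Qed.

End Model.

Theorem mainTheorem1 (R : realType) :
  exists n : nat, (2 <= n)%N /\
  exists (N : nat) (Y : set 'rV[R]_N) (xi : 'rV[R]_N -> set 'rV[R]_N),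
    closed_contact_manifold n Y xi /\
    c1_vanishes n Y xi /\
    adc n Y xi /\
    exists (N1 : nat) (W1 : set 'rV[R]_N1) (lambda1 : form1 R N1)
           (N2 : nat) (W2 : set 'rV[R]_N2) (lambda2 : form1 R N2),
      liouville_filling n Y xi W1 lambda1 /\
      liouville_filling n Y xi W2 lambda2 /\
      exists k : nat,
        ~ group_isomorphic (cohomology R (set_type W1) k)
                           (cohomology R (set_type W2) k).
Proof.
exists 2%N; split=> //; exists ambient, (@Y R true), (@xi R true).
split; first exact: closed_contact.
split; first exact: Y_c1.
split; first exact: Y_adc.
exists ambient, (@W R false), (@lamA R), ambient, (@W R true), (@lamA R).
split; first exact: (@filling_swap R false).
split; first exact: filling_id.
by exists 0%N; exact: H0_not_isomorphic.
Qed.
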